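(* Let $\mathcal{X}\subset\mathbb{R}^{k+1}$ be open and let $\mathcal{O}\subset\mathbb{R}^n$ be convex. Let $G\in C^2(\overline{\mathcal{O}};\mathbb{R}^{n\times(k+1)})$, $Q\in C^1(\mathcal{O};\mathbb{R}^{k+1})$ and $B\in C^1(\mathcal{O};\mathbb{R}^n)$ satisfy, for some constant $C$ independent of $V$, $$D_UB\in L^\infty(\mathcal{O}),\qquad |B(V)|\le C(1+|V|),\qquad |Q(V)|\le C(1+|V|^3)\quad\text{for all }V\in\mathcal{O},$$ $$\sup_{i,j\in\{1,\dots,n\}}\|\partial_{U_i}\partial_{U_j}G\|_{L^\infty(\mathcal{O};\mathbb{R}^{n\times(k+1)})}<+\infty,$$ and suppose that $$D_UQ_j(U)=B(U)\,D_UG_j(U)\qquad\text{for all }U\in\mathcal{O},\ j\in\{1,\dots,k+1\}.$$ If $U:\mathcal{X}\to\mathcal{O}$ is a weak solution of $\operatorname{div}_X(G(U(X)))=0$ in $\mathcal{X}$ such that $U\in\underline{B}^{1/3}_{3,VMO}(\mathcal{X}_1)$ for every $\mathcal{X}_1\subset\subset\mathcal{X}$, then $U$ is also a weak solution of the companion law $\operatorname{div}_X(Q(U(X)))=0$ in $\mathcal{X}$.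
   Context: $G_j$ denotes the $j$-th column of the matrix-valued map $G$ (an $\mathbb{R}^n$-valued map) and $Q_j$ the $j$-th component of $Q$. $D_UG_j$ is the $n\times n$ Jacobian of $G_j$ and $B$ is regarded as a row vector, so the relation $D_UQ_j=B\,D_UG_j$ means $\partial_{U_l}Q_j=\sum_{i=1}^n B_i\,\partial_{U_l}G_{ij}$ for $l=1,\dots,n$. Weak solutions: $U$ is a weak solution of $\operatorname{div}_X(G(U))=0$ in $\mathcal{X}$ if $\int_{\mathcal{X}}G(U(X)):D_X\psi(X)\,dX=0$ for every $\psi\in C^1_c(\mathcal{X};\mathbb{R}^n)$. Analogously, $U$ is a weak solution of $\operatorname{div}_X(Q(U))=0$ in $\mathcal{X}$ if $\int_{\mathcal{X}}Q(U(X))\cdot D_X\psi(X)\,dX=0$ for every $\psi\in C^1_c(\mathcal{X})$. Function space: for an open set $\mathcal{Y}\subset\mathbb{R}^{k+1}$, $U\in\underline{B}^{1/3}_{3,VMO}(\mathcal{Y})$ means that $U\in L^3(\mathcal{Y})$ and that for every $\mathcal{Y}'\subset\subset\mathcal{Y}$ there is a nonnegative function $\omega_{\mathcal{Y}'}(\epsilon)$ tending to $0$ as $\epsilon\to0$ such that for all $0<\epsilon<\tfrac12 d(\mathcal{Y}',\partial\mathcal{Y})$ $$\int_{\mathcal{Y}'}\frac{1}{|B_\epsilon(X)|}\int_{B_\epsilon(X)}|U(X)-U(Y)|^3\,dY\,dX\le\omega_{\mathcal{Y}'}(\epsilon)\,\epsilon .$$ Here $B_\epsilon(X)$ is the ball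 of radius $\epsilon$ about $X$, and $\mathcal{Y}'\subset\subset\mathcal{Y}$ means that the closure of $\mathcal{Y}'$ is compact and contained in $\mathcal{Y}$. *)

(* Defs.v *)
From HB Require Import structures.
From mathcomp Require Import all_boot all_order all_algebra.
From mathcomp Require Import all_classical all_reals all_analysis.

Set Implicit Arguments.
Unset Strict Implicit.
Unset Printing Implicit Defensive.

Import Order.TTheory GRing.Theory Num.Theory.
Import numFieldNormedType.Exports.

Local Open Scope classical_set_scope.
Local Open Scope ring_scope.

(* [R^n] is ['rV[R]_n], with the sigma-algebra generated by the coordinates (the
   library's choice for [n.-tuple T]); for [T := R] these are the Borel sets. *)
Definition measure_rV_display : measure_display -> measure_display.
Proof. exact. Qed.

Section measurable_rV.
Context {d} {T : sigmaRingType d}.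
Variable n : nat.

Let coors : 'I_n -> 'rV[T]_n -> T := fun i x => x ord0 i.

Let rV_set0 : g_sigma_preimage coors set0.
Proof. exact: sigma_algebra0. Qed.

Let rV_setC A : g_sigma_preimage coors A -> g_sigma_preimage coors (~` A).
Proof. exact: sigma_algebraC. Qed.

Let rV_bigcup (F : _^nat) : (forall i, g_sigma_preimage coors (F i)) ->
  g_sigma_preimage coors (\bigcup_i (F i)).
Proof. exact: sigma_algebra_bigcup. Qed.

HB.instance Definition _ := @isMeasurable.Build (measure_rV_display d)
  ('rV[T]_n) (g_sigma_preimage coors) rV_set0 rV_setC rV_bigcup.

End measurable_rV.

Lemma measurable_coord d (T : sigmaRingType d) n (i : 'I_n) :
  measurable_fun [set: 'rV[T]_n] (fun x : 'rV[T]_n => x ord0 i).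
Proof.
move=> _ Y mY; rewrite setTI; apply: sub_sigma_algebra => /=.
rewrite -bigcup_seq/=; exists i => /=; first by rewrite mem_index_enum.
by exists Y => //; rewrite setTI.
Qed.

Lemma measurable_fun_coordP d1 d2 (T1 : measurableType d1)
    (T2 : measurableType d2) n (f : T1 -> 'rV[T2]_n) :
  (forall i, measurable_fun setT (fun x => f x ord0 i)) ->
  measurable_fun setT f.
Proof.
move=> mf _ A; rewrite setTI => mA.
pose S := image_set_system setT f measurable.
have : S A; last by rewrite /S /image_set_system /= setTI.
move: A mA; apply: smallest_sub.
  by apply: sigma_algebra_image; exact: sigma_algebra_measurable.
move=> A; rewrite -bigcup_seq => -[i _ [B mB <-]].
rewrite /S /image_set_system /= !setTI.
by have := mf i measurableT B mB; rewrite setTI.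
Qed.

Definition rV_cons (R : realType) n (p : R * 'rV[R]_n) : 'rV[R]_n.+1 :=
  \row_i (if unlift ord0 i is Some j then p.2 ord0 j else p.1).

Lemma measurable_rV_cons (R : realType) n :
  measurable_fun setT (@rV_cons R n).
Proof.
apply: measurable_fun_coordP => i.
case: (unliftP ord0 i) => [j ->|->].
  rewrite (_ : (fun x => _) = (fun v : 'rV[R]_n => v ord0 j) \o snd).
    by apply: measurableT_comp => //; exact: measurable_coord.
  by apply/funext => p /=; rewrite mxE liftK.
rewrite (_ : (fun x => _) = fst) //.
by apply/funext => p /=; rewrite mxE unlift_none.
Qed.

Section lebesgue_step.
Context {R : realType} (n : nat).
Variable mu : {sigma_finite_measure set 'rV[R]_n -> \bar R}.

Definition lebesgue_step : set 'rV[R]_n.+1 -> \bar R :=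
  pushforward (@lebesgue_measure R \x mu)%E (@rV_cons R n).

Let step0 : lebesgue_step set0 = 0%E.
Proof. by rewrite /lebesgue_step /pushforward preimage_set0 measure0. Qed.

Let step_ge0 A : (0 <= lebesgue_step A)%E.
Proof. by rewrite /lebesgue_step /pushforward measure_ge0. Qed.

Let mpre A : measurable A -> measurable (@rV_cons R n @^-1` A).
Proof. by move=> mA; rewrite -[X in measurable X]setTI; exact: measurable_rV_cons. Qed.

Let step_sigma_additive : semi_sigma_additive lebesgue_step.
Proof.
move=> F mF tF mUF; rewrite /lebesgue_step /pushforward preimage_bigcup.
apply: measure_semi_sigma_additive.
- by move=> i; exact: mpre.
- apply/trivIsetP => /= i j _ _ ij; rewrite -preimage_setI.
  by move/trivIsetP : tF => /(_ _ _ _ _ ij) ->//; rewrite preimage_set0.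
- by rewrite -preimage_bigcup; exact: mpre.
Qed.

HB.instance Definition _ := isMeasure.Build _ _ _
  lebesgue_step step0 step_ge0 step_sigma_additive.

Let step_sigma_finite : sigma_finite setT lebesgue_step.
Proof.
have [F FT Ffin] : sigma_finite setT (@lebesgue_measure R \x mu)%E.
  have /sigma_finiteP[F [TF ndF Foo]] := sigma_finiteT (@lebesgue_measure R).
  have /sigma_finiteP[G [TG ndG Goo]] := sigma_finiteT mu.
  exists (fun k => F k `*` G k).
    rewrite -setXTT TF TG predeqE => -[x y]; split.
      move=> [/= [i _ Fix] [k _ Gky]]; exists (maxn i k) => //; split.
      - by move: x Fix; exact/subsetPset/ndF/leq_maxl.
      - by move: y Gky; exact/subsetPset/ndG/leq_maxr.
    by move=> [i _ []/= ? ?]; split; exists i.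
  move=> k; have [? ?] := Foo k; have [? ?] := Goo k.
  split; first exact: measurableX.
  by rewrite product_measure1E// lte_mul_pinfty// ge0_fin_numE.
pose uncons (v : 'rV[R]_n.+1) : R * 'rV[R]_n :=
  (v ord0 ord0, \row_j v ord0 (lift ord0 j)).
have consK : cancel (@rV_cons R n) uncons.
  move=> [x v]; rewrite /uncons /rV_cons; congr pair.
    by rewrite mxE unlift_none.
  by apply/rowP => j; rewrite !mxE liftK.
have muncons : measurable_fun setT uncons.
  apply/measurable_fun_pairP; split => /=; first exact: measurable_coord.
  apply: measurable_fun_coordP => j.
  rewrite (_ : (fun x => _) = (fun x : 'rV[R]_n.+1 => x ord0 (lift ord0 j))).
    exact: measurable_coord.
  by apply/funext => x; rewrite /uncons /= mxE.
exists (fun i => uncons @^-1` F i).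
  by rewrite -preimage_bigcup -FT preimage_setT.
move=> i; have [mFi Fi] := Ffin i; split.
  by rewrite -[X in measurable X]setTI; exact: muncons.
rewrite /lebesgue_step /pushforward -comp_preimage.
by rewrite (_ : uncons \o _ = id) //; apply/funext => p /=; rewrite consK.
Qed.

HB.instance Definition _ := Measure_isSigmaFinite.Build _ _ _
  lebesgue_step step_sigma_finite.

End lebesgue_step.

(* Product of [n] copies of [lebesgue_measure]: [R^0] carries the unit mass,
   and [R^(n+1)] is identified with [R * R^n] through [rV_cons]. *)
Fixpoint lebesgue_rV (R : realType) (n : nat) :
    {sigma_finite_measure set 'rV[R]_n -> \bar R} :=
  match n with
  | 0 => \d_(0 : 'rV[R]_0)
  | m.+1 => lebesgue_step (lebesgue_rV R m)
  end.

(* The norm [`|A|] of the library is the maximum of the entries. *)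
Definition enorm (R : realType) m n (A : 'M[R]_(m, n)) : R :=
  Num.sqrt (\sum_(i < m) \sum_(j < n) A i j ^+ 2).

Definition eball (R : realType) n (x : 'rV[R]_n) (e : R) : set 'rV[R]_n :=
  [set y | enorm (y - x) < e].

(* Infimum in [\bar R]: the distance to the empty set is [+oo]. *)
Definition edist_set (R : realType) n (A B : set 'rV[R]_n) : \bar R :=
  ereal_inf [set (enorm (x - y))%:E | x in A & y in B].

Definition boundary (T : topologicalType) (A : set T) : set T :=
  closure A `\` interior A.

Definition compactly_inside (T : topologicalType) (A B : set T) : Prop :=
  compact (closure A) /\ closure A `<=` B.

(* [Df i] is the [i]-th partial derivative of [f] on [A], in the sense that
     f y = f x + \sum_i (y - x)_i Df i x + o(|y - x|)   as y -> x within A.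
   At interior points of [A] this is Frechet differentiability; if [A] is
   convex with nonempty interior, [Df] is determined by [f] on [A].  The
   factor [`|y - x|^-1] is 0 at [y = x]. *)
Definition partials_on (R : realType) n (W : normedModType R)
    (A : set 'rV[R]_n) (f : 'rV[R]_n -> W) (Df : 'I_n -> 'rV[R]_n -> W) :=
  forall x, A x ->
    `|y - x|^-1 *: (f y - f x - \sum_(i < n) (y - x) ord0 i *: Df i x)
      @[y --> within A (nbhs x)] --> (0 : W).

Definition partial (R : realType) m (W : normedModType R) (j : 'I_m)
    (psi : 'rV[R]_m -> W) (x : 'rV[R]_m) : W :=
  'D_(delta_mx ord0 j) psi x.

Lemma partials_on_differentiable (R : realType) n (W : normedModType R)
    (A : set 'rV[R]_n) (f : 'rV[R]_n -> W) :
  (forall x, A x -> differentiable f x) ->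
  partials_on A f (fun i => partial i f).
Proof.
move=> df x Ax; apply: cvg_within_filter.
have dfx := df x Ax.
have lin (h : 'rV[R]_n) : \sum_(i < n) h ord0 i *: partial i f x = 'd f x h.
  rewrite [in RHS](row_sum_delta h) linear_sum; apply: eq_bigr => i _.
  by rewrite linearZ /partial deriveE.
have /funext/eqaddoP Ho := diffE dfx.
rewrite lim_id // in Ho.
apply/cvgrPdist_le => e e0.
have {}Ho := Ho e e0; apply: filterS Ho => y Hy.
rewrite sub0r normrN normrZ normfV ?normr_id.
rewrite lin.
have [->|xy] := eqVneq (`|y - x|) 0; first by rewrite invr0 mul0r ltW.
rewrite mulrC ler_pdivrMr ?lt_neqAle 1?eq_sym ?xy ?normr_ge0 //.
rewrite -addrA -opprD.
exact: Hy.
Qed.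

Definition C1_on (R : realType) n (W : normedModType R)
    (A : set 'rV[R]_n) (f : 'rV[R]_n -> W) (Df : 'I_n -> 'rV[R]_n -> W) :=
  partials_on A f Df /\ forall i, {within A, continuous (Df i)}.

Definition C2_on (R : realType) n (W : normedModType R)
    (A : set 'rV[R]_n) (f : 'rV[R]_n -> W) (Df : 'I_n -> 'rV[R]_n -> W)
    (D2f : 'I_n -> 'I_n -> 'rV[R]_n -> W) :=
  C1_on A f Df /\ forall i, C1_on A (Df i) (D2f i).

Definition C1c (R : realType) m (W : normedModType R) (X : set 'rV[R]_m)
    (psi : 'rV[R]_m -> W) : Prop :=
  [/\ forall x, differentiable psi x,
      forall j, continuous (partial j psi) &
      compactly_inside [set x | psi x != 0] X].

(* The integral is taken in [\bar R], where [+oo - +oo = -oo]; for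
   measurable integrands, vanishing therefore includes integrability. *)
Definition weak_sol_system (R : realType) m n (X : set 'rV[R]_m)
    (G : 'rV[R]_n -> 'M[R]_(n, m)) (U : 'rV[R]_m -> 'rV[R]_n) : Prop :=
  forall psi : 'rV[R]_m -> 'rV[R]_n, C1c X psi ->
    (\int[lebesgue_rV R m]_(x in X)
       (\sum_(i < n) \sum_(j < m) G (U x) i j * partial j psi x ord0 i)%:E
     = 0)%E.

Definition weak_sol_scalar (R : realType) m n (X : set 'rV[R]_m)
    (Q : 'rV[R]_n -> 'rV[R]_m) (U : 'rV[R]_m -> 'rV[R]_n) : Prop :=
  forall psi : 'rV[R]_m -> R, C1c X psi ->
    (\int[lebesgue_rV R m]_(x in X)
       (\sum_(j < m) Q (U x) ord0 j * partial j psi x)%:E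
     = 0)%E.

(* Elements of [L^3] are represented by Borel functions. *)
Definition in_L3 (R : realType) m n (Y : set 'rV[R]_m)
    (U : 'rV[R]_m -> 'rV[R]_n) : Prop :=
  measurable_fun Y U /\
  (lebesgue_rV R m).-integrable Y (fun x => (enorm (U x) ^+ 3)%:E).

Definition besov_vmo (R : realType) m n (Y : set 'rV[R]_m)
    (U : 'rV[R]_m -> 'rV[R]_n) : Prop :=
  in_L3 Y U /\
  forall Y' : set 'rV[R]_m, measurable Y' -> compactly_inside Y' Y ->
  exists omega : R -> R,
    [/\ forall e, 0 <= omega e,
        omega e @[e --> 0^'+] --> 0 &
        forall e : R, 0 < e ->
          (e%:E < (2^-1)%:E * edist_set Y' (boundary Y))%E ->
          (\int[lebesgue_rV R m]_(x in Y')
             (((fine (lebesgue_rV R m (eball x e)))^-1)%:E *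
              \int[lebesgue_rV R m]_(y in eball x e)
                (enorm (U x - U y) ^+ 3)%:E)
           <= (omega e * e)%:E)%E].

(* Main.v *)
Require Import Defs.
From HB Require Import structures.
From mathcomp Require Import all_boot all_order all_algebra.
From mathcomp Require Import all_classical all_reals all_analysis.
From mathcomp Require Import measurable_realfun.
From mathcomp Require Import ring lra.

Set Implicit Arguments.
Unset Strict Implicit.
Unset Printing Implicit Defensive.

Import Order.TTheory GRing.Theory Num.Theory.
Import numFieldNormedType.Exports.

Local Open Scope classical_set_scope.
Local Open Scope ring_scope.

(** The companion law follows from a commutator argument of Constantin, E and
    Titi type.  Let [V] be the average of [U] over a ball of radius [e] with a
    smooth weight.  The system is linear in [G(U)], so the average [H] of
    [G(U)] is divergence free at distance more than [e] from the complement of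
    [X], and the chain rule with the compatibility relation turns [B(V)] times
    the divergence of [G(V) - H] into the divergence of [Q(V)].  Tested against
    [phi] and integrated by parts this reads

      [\int \sum_j d_j phi Q_j(V) =
         \int \sum_ij d_j (phi B_i(V)) (G_ij(V) - H_ij)],

    so that [\int \sum_j d_j phi Q_j(U)] is the sum of the right-hand side and
    of [\int \sum_j d_j phi (Q_j(U) - Q_j(V))].

    In [G(V) - H] the linear part of the Taylor expansion of [G] averages out,
    and the second derivatives of [G] are bounded: what is left is quadratic in
    the increments of [U] ([commutator_le]).  The derivative of [B(V)] costs one
    more increment divided by [e].  The product is cubic, that is [1 / e] times
    the mean [defect] of the cubed increments, and its integral tends to 0 by
    the hypothesis on [U].  The other terms carry a power of the weight
    [1 + |U|], coming from the growth of [B] and [Q]; Young's inequality splits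
    each of them into [d (1 + |U|)^3] and [d^-2] times the defect
    ([young_products]).  The outcome is [companion_estimate], in which [e] tends
    to 0 first and [d] afterwards ([vanishing_by_scales]).

    Three points need care.  The average [V] has to stay in [O], an arbitrary
    convex set, for [B(V)], [Q(V)] and the Taylor expansion to make sense: this
    is [barycenter_convex].  The partial derivatives of [G], [Q] and [B] are
    relative to a set, so the chain rule and the mean value theorem are proved
    in that form ([is_derive_chain], [convex_mean_value]).  Finally [U] is
    replaced by a map with values in [O] on the whole space which agrees with
    [U] near the support of the test function ([extension]), so that averages
    are taken over full balls. *)

(** * Real-valued integrals *)

Section real_integrals.
Context d (T : measurableType d) (R : realType) (mu : {measure set T -> \bar R}).
Implicit Types f g : T -> R.

Notation integrableR f := (mu.-integrable setT (EFin \o f)).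

Lemma measurable_integrableR f : integrableR f -> measurable_fun setT f.
Proof. by move=> /measurable_int/measurable_EFinP. Qed.

Lemma integrableRZ c f : integrableR f -> integrableR (fun x => c * f x).
Proof. by move=> fi; exact: (integrableZl measurableT c fi). Qed.

Lemma integrableRB f g : integrableR f -> integrableR g ->
  integrableR (fun x => f x - g x).
Proof. by move=> fi gi; exact: (integrableB measurableT fi gi). Qed.

Lemma integrableR_sum (I : Type) (s : seq I) (P : pred I) (h : I -> T -> R) :
  (forall i, P i -> integrableR (h i)) ->
  integrableR (fun x => \sum_(i <- s | P i) h i x).
Proof.
move=> hi; apply: (eq_integrable measurableT (fun x => (\sum_(i <- s | P i) (h i x)%:E)%E)).
  by move=> x _ /=; rewrite sumEFin.
exact: integrable_sum.
Qed.

Lemma le_integrableR f g : measurable_fun setT f -> (forall x, `|f x| <= g x) ->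
  integrableR g -> integrableR f.
Proof.
move=> mf fg gi; apply: (le_integrable measurableT _ _ gi) => [|x _ /=].
  exact/measurable_EFinP.
by rewrite lee_fin (le_trans (fg x)) // ler_norm.
Qed.

Lemma Rintegral_sum (I : Type) (s : seq I) (P : pred I) (h : I -> T -> R) :
  (forall i, P i -> integrableR (h i)) ->
  \int[mu]_x (\sum_(i <- s | P i) h i x) = \sum_(i <- s | P i) \int[mu]_x h i x.
Proof.
move=> hi; elim: s => [|i s IH].
  rewrite big_nil; under eq_Rintegral => x _ do rewrite big_nil.
  by rewrite Rintegral_cst // mul0r.
under eq_Rintegral => x _ do rewrite big_cons.
rewrite big_cons; case: ifPn => // Pi.
by rewrite RintegralD // ?IH //; [exact: hi | exact: integrableR_sum].
Qed.

End real_integrals.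

(** * Borel sets of the coordinate space *)

Section norm_rV.
Context {R : realType} {m : nat}.
Implicit Types x : 'rV[R]_m.

Lemma normr_coord_le x i : `|x ord0 i| <= `|x|.
Proof.
rewrite [leRHS]/Num.norm /= mx_normrE; apply: (le_bigmax _ _ (ord0, i)).
Qed.

Lemma normr_rV_le x r : 0 <= r -> (forall i, `|x ord0 i| <= r) -> `|x| <= r.
Proof.
move=> r0 xr; rewrite [leLHS]/Num.norm /= mx_normrE; apply/bigmax_leP; split=> //.
by move=> [i j] _ /=; rewrite ord1.
Qed.

Lemma normr_rV_lt x r : 0 < r -> (forall i, `|x ord0 i| < r) -> `|x| < r.
Proof.
move=> r0 xr; rewrite [ltLHS]/Num.norm /= mx_normrE; apply/bigmax_ltP; split=> //.
by move=> [i j] _ /=; rewrite ord1.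
Qed.

End norm_rV.

Section measurable_rV_topology.
Context {R : realType} {m : nat}.

Definition open_cube (c : 'rV[R]_m) (r : R) : set 'rV[R]_m :=
  [set x | forall i, `|x ord0 i - c ord0 i| < r].

Lemma measurable_open_cube c r : measurable (open_cube c r).
Proof.
rewrite (_ : open_cube c r =
    \bigcap_i ((fun x : 'rV[R]_m => x ord0 i) @^-1` `]c ord0 i - r, c ord0 i + r[%classic)).
  apply: fin_bigcap_measurable => [|i _]; first exact: finite_finset.
  rewrite -[X in measurable X]setTI; apply: measurable_coord => //.
apply/seteqP; split => x /=.
  by move=> xc i _ /=; rewrite in_itv /= -ltr_distl; exact: xc.
by move=> xc i; have := xc i Logic.I; rewrite /= in_itv /= -ltr_distl.
Qed.

(** Cubes with rational centres and rational sizes are countably many, and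
    those contained in an open set cover it. *)
Lemma open_measurable_rV (A : set 'rV[R]_m) : open A -> measurable A.
Proof.
move=> oA.
pose D := [set p : 'rV[rat]_m * nat |
  open_cube (map_mx ratr p.1) p.2.+1%:R^-1 `<=` A].
rewrite (_ : A = \bigcup_(p in D) open_cube (map_mx ratr p.1) p.2.+1%:R^-1).
  rewrite bigcup_mkcond; apply: countable_bigcupT_measurable => // p.
  by case: ifP => _ //; exact: measurable_open_cube.
apply/seteqP; split => [x Ax|x [p pD xp]]; last exact: pD.
move: oA; rewrite openE => /(_ x Ax) /nbhs_ballP[e /= e0 xeA].
have [k _ /(_ _ (leqnn _)) ke] := near_infty_natSinv_lt (PosNum (divr_gt0 e0 (@ltr0n R 2))).
set r := (k.+1%:R^-1 : R) in ke; have r0 : 0 < r by rewrite invr_gt0.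
have /choice[q qP] : forall i, exists q : rat, `|x ord0 i - ratr q| < r.
  move=> i; have [q] := @rat_in_itvoo R (x ord0 i - r) (x ord0 i + r) ltac:(lra).
  by rewrite in_itv /= => qx; exists q; rewrite ltr_norml; lra.
exists (\row_i q i, k) => /= [y /= yr|i]; last by rewrite !mxE.
apply: xeA; rewrite mx_norm_ball /ball_ /=; apply: normr_rV_lt => // i.
move: (yr i) (qP i); rewrite !mxE /=.
move: ke; rewrite -/r /= => ke; rewrite !ltr_norml => /andP[? ?] /andP[? ?].
apply/andP; lra.
Qed.

Lemma closed_measurable_rV (A : set 'rV[R]_m) : closed A -> measurable A.
Proof.
move=> cA; rewrite -[X in measurable X]setCK; apply: measurableC.
by apply: open_measurable_rV; exact: closed_openC.
Qed.

(** The preimage under [g] of an open interval is the trace on [O] of an open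
    set [W]; as [u] takes its values in [O], pulling back by [u] does not see
    the difference between this trace and [W]. *)
Lemma measurable_comp_within d (T : measurableType d) (O : set 'rV[R]_m)
    (g : 'rV[R]_m -> R) (u : T -> 'rV[R]_m) :
  {within O, continuous g} -> (forall x, O (u x)) -> measurable_fun setT u ->
  measurable_fun setT (g \o u).
Proof.
move=> /continuousP cg Ou mu.
apply: (measurability _ (RGenOpens.measurableE R)).
move=> _ [_ [a [b ->] <-]]; rewrite setTI.
have [|W oW WE] := (open_subspaceP O (g @^-1` `]a, b[)).1.
  by apply: cg; exact: interval_open.
rewrite comp_preimage (_ : _ @^-1` _ = u @^-1` W).
  by rewrite -[X in measurable X]setTI; apply: mu => //; exact: open_measurable_rV.
by apply/seteqP; split => x /= xW;
  [have : (W `&` O) (u x) by rewrite WE | have : (g @^-1` `]a, b[ `&` O) (u x) by rewrite -WE];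
  case.
Qed.

Lemma continuous_measurable_rV (f : 'rV[R]_m -> R) :
  continuous f -> measurable_fun setT f.
Proof.
move=> cf; rewrite -[f]/(f \o id); apply: (@measurable_comp_within _ _ setT) => //.
exact: continuous_subspaceT.
Qed.

End measurable_rV_topology.

(** * Lebesgue measure by slices *)

Section lebesgue_rV_recursion.
Context {R : realType} {m : nat}.
Local Open Scope ereal_scope.
Notation leb := (@lebesgue_measure R).
Notation mu := (lebesgue_rV R m).

Lemma ge0_integral_rV_cons (f : 'rV[R]_m.+1 -> \bar R) :
  measurable_fun [set: 'rV[R]_m.+1] f -> (forall x, 0 <= f x) ->
  \int[lebesgue_rV R m.+1]_x f x = \int[leb \x mu]_p f (rV_cons p).
Proof.
move=> mf f0.
exact: (@ge0_integral_pushforward _ _ (measurableTypeR R * 'rV[R]_m)%type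
  'rV[R]_m.+1 R _ (@measurable_rV_cons R m) (leb \x mu)%E setT f).
Qed.

Lemma integrable_rV_cons (f : 'rV[R]_m.+1 -> \bar R) :
  (lebesgue_rV R m.+1).-integrable setT f ->
  (leb \x mu).-integrable setT (f \o @rV_cons R m).
Proof.
move=> /integrableP[mf foo]; apply/integrableP; split.
  by apply: measurableT_comp mf _; exact: measurable_rV_cons.
rewrite -(@ge0_integral_rV_cons (fun x => `|f x|))//.
exact: measurableT_comp.
Qed.

Lemma integral_rV_cons (f : 'rV[R]_m.+1 -> \bar R) :
  (lebesgue_rV R m.+1).-integrable setT f ->
  \int[lebesgue_rV R m.+1]_x f x = \int[leb \x mu]_p f (rV_cons p).
Proof.
move=> fi.
etransitivity; first apply: (@integral_pushforward _ _
  (measurableTypeR R * 'rV[R]_m)%type 'rV[R]_m.+1 R _ (@measurable_rV_cons R m)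
  (leb \x mu)%E setT f) => //.
- exact: measurable_int fi.
- exact: integrable_rV_cons.
- by rewrite preimage_setT.
Qed.

End lebesgue_rV_recursion.

Section lebesgue_cube.
Context {R : realType}.

Lemma lebesgue_open_cube m (c : 'rV[R]_m) r : 0 <= r ->
  lebesgue_rV R m (open_cube c r) = ((2 * r) ^+ m)%:E.
Proof.
move=> r0; elim: m c => [|m IH] c.
  rewrite expr0 /= (_ : open_cube c r = setT) ?diracT //.
  by apply/seteqP; split => // x _ [].
pose c' := \row_j c ord0 (lift ord0 j).
change (lebesgue_rV R m.+1 (open_cube c r)) with
  ((@lebesgue_measure R \x lebesgue_rV R m)%E (@rV_cons R m @^-1` open_cube c r)).
rewrite (_ : _ @^-1` _ = `]c ord0 ord0 - r, c ord0 ord0 + r[%classic `*` open_cube c' r).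
  rewrite product_measure1E //; last exact: measurable_open_cube.
  rewrite IH; rewrite [X in (X * _)%E](_ : _ = (lebesgue_measure `]c ord0 ord0 - r, c ord0 ord0 + r[%classic)) //.
  rewrite lebesgue_measure_itv /= lte_fin ltrD2l.
  case: ltP => [_|r0'].
    by rewrite -EFinD -EFinM exprS; congr (_ * _)%:E; lra.
  have -> : r = 0 by lra.
  by rewrite mul0e mulr0 expr0n.
apply/seteqP; split => [[t v] /= tv|[t v] [/= tc vc] i].
  split => /=.
    by have := tv ord0; rewrite mxE unlift_none /= in_itv /= -ltr_distl.
  by move=> i; have := tv (lift ord0 i); rewrite !mxE liftK.
case: (unliftP ord0 i) => [j ->|->]; rewrite mxE ?liftK ?unlift_none /=.
  by have := vc j; rewrite mxE.
by move: tc; rewrite in_itv /= -ltr_distl.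
Qed.

Lemma lebesgue_bounded m (A : set 'rV[R]_m) r : measurable A ->
  (forall x, A x -> `|x| <= r) -> (lebesgue_rV R m A < +oo)%E.
Proof.
move=> mA Ar.
apply: (@le_lt_trans _ _ (lebesgue_rV R m (open_cube 0 (`|r| + 1)))).
  apply: le_measure; rewrite ?inE//; first exact: measurable_open_cube.
  move=> x /Ar xr i; rewrite mxE subr0.
  by rewrite (le_lt_trans (normr_coord_le _ _))// (le_lt_trans xr)// ltr_pwDr// ler_norm.
by rewrite lebesgue_open_cube ?ltry// addr_ge0.
Qed.

End lebesgue_cube.

(** * Integrals of partial derivatives *)

(** Along the line [x + h v1] the map [c] moves by [h v2], so both difference
    quotients are the same function of [h].  This transports directional
    derivatives through translations and coordinate slices. *)
Lemma is_derive_affine (R : realType) (V1 V2 W : normedModType R)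
    (f : V2 -> W) (c : V1 -> V2) x v1 v2 d :
  (forall h, c (h *: v1 + x) = h *: v2 + c x) ->
  is_derive x v1 (f \o c) d <-> is_derive (c x) v2 f d.
Proof.
move=> cE; have E : (fun h : R => h^-1 *: ((f \o c \o shift x) (h *: v1) - (f \o c) x)) =
    (fun h : R => h^-1 *: ((f \o shift (c x)) (h *: v2) - f (c x))).
  by apply/funext => h /=; rewrite cE.
split => -[dx dE]; apply: DeriveDef; rewrite ?/derivable ?/derive;
  by [rewrite -E|rewrite E].
Qed.

Section bounded_support.
Context {R : realType} {m : nat}.

Lemma closed_closed_cube r : closed [set x : 'rV[R]_m | `|x| <= r].
Proof.
apply: (@closed_comp _ _ (fun x : 'rV[R]_m => `|x|) [set t | t <= r]).
  by move=> x _; exact: norm_continuous.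
exact: closed_le.
Qed.

Lemma compact_closed_cube r : compact [set x : 'rV[R]_m | `|x| <= r].
Proof.
apply: bounded_closed_compact; last exact: closed_closed_cube.
by exists r; split; rewrite ?num_real// => M rM x /= xr; rewrite (le_trans xr) // ltW.
Qed.

Lemma measurable_closed_cube r : measurable [set x : 'rV[R]_m | `|x| <= r].
Proof.
by apply: closed_measurable_rV; exact: closed_closed_cube.
Qed.

Lemma continuous_bounded_on_cube (g : 'rV[R]_m -> R) r : continuous g ->
  exists2 M, 0 <= M & forall x, `|x| <= r -> `|g x| <= M.
Proof.
move=> cg.
have /compact_bounded[M [_ MP]] : compact (g @` [set x : 'rV[R]_m | `|x| <= r]).
  apply: continuous_compact; last exact: compact_closed_cube.
  exact: continuous_subspaceT.
exists (`|M| + 1); first by rewrite addr_ge0.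
move=> x xr; apply: MP; last by exists x.
by rewrite (le_lt_trans (ler_norm M)) // ltrDl.
Qed.

Lemma integrable_bounded_support (g : 'rV[R]_m -> R) r :
  continuous g -> (forall x, r < `|x| -> g x = 0) ->
  (lebesgue_rV R m).-integrable setT (EFin \o g).
Proof.
move=> cg g0; have [M M0 gM] := continuous_bounded_on_cube r cg.
pose D := [set x : 'rV[R]_m | `|x| <= r].
have mD : measurable D by exact: measurable_closed_cube.
rewrite (_ : EFin \o g = (EFin \o g) \_ D).
  apply/(integrable_mkcond _ mD); apply: measurable_bounded_integrable => //.
  - by apply: (@lebesgue_bounded _ _ _ r).
  - by apply: measurable_funTS; exact: continuous_measurable_rV.
  - exists M; split; rewrite ?num_real// => N MN x /= xD.
    by rewrite (le_trans (gM _ xD)) ?ltW.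
apply/funext => x; rewrite /patch; case: ifPn => // /negP xD /=.
by rewrite g0 // ltNge; apply/negP => xr; apply: xD; rewrite inE.
Qed.

End bounded_support.

Section integral_of_derivative.
Context {R : realType}.

(** Fundamental theorem of calculus on an interval whose ends lie where [f]
    vanishes. *)
Lemma integral_derive_support (f g : R -> R) r :
  continuous g -> (forall t : R, is_derive t 1 f (g t)) ->
  (forall t, r <= `|t| -> f t = 0 /\ g t = 0) ->
  (\int[@lebesgue_measure R]_t (g t)%:E = 0)%E.
Proof.
move=> cg fg supp; pose a := `|r| + 1.
have a0 : 0 < a by rewrite ltr_wpDl.
have ra : r <= a by rewrite (le_trans (ler_norm _)) // lerDl.
rewrite (_ : (fun t => (g t)%:E) = (EFin \o g) \_ `[- a, a]); last first.
  apply/funext => t; rewrite /patch; case: ifPn => // /negP ta /=.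
  have [|_ ->//] := supp t.
  rewrite (le_trans ra) // leNgt; apply/negP => ta'; apply: ta.
  by rewrite inE /= in_itv /= -ler_norml ltW.
rewrite -integral_mkcond.
have cf t : {for t, continuous f}.
  by apply: differentiable_continuous; apply/derivable1_diffP; case: (fg t).
rewrite (@continuous_FTC2 _ _ f); first last.
- by move=> t _; rewrite derive1E; case: (fg t).
- split; first by move=> t _; case: (fg t).
  + by apply: cvg_at_right_filter; exact: cf.
  + by apply: cvg_at_left_filter; exact: cf.
- exact: continuous_subspaceT.
- lra.
have [-> _] : f a = 0 /\ g a = 0 by apply: supp; rewrite ger0_norm // ltW.
have [-> _] : f (- a) = 0 /\ g (- a) = 0.
  by apply: supp; rewrite normrN ger0_norm // ltW.
by rewrite subee.
Qed.

Lemma continuous_rV (T : topologicalType) m (c : T -> 'rV[R]_m) :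
  (forall i, continuous (fun x => c x ord0 i)) -> continuous c.
Proof.
move=> cc x; apply/cvgrPdist_lt => e e0.
have : \forall y \near x, forall i, `|c x ord0 i - c y ord0 i| < e.
  apply: filter_forall => i; have /cvgrPdist_lt := cc i x; exact.
by apply: filterS => y ye; apply: normr_rV_lt => // i; rewrite !mxE.
Qed.

Lemma rV_cons_ord0 m (p : R * 'rV[R]_m) : rV_cons p ord0 ord0 = p.1.
Proof. by rewrite mxE unlift_none. Qed.

Lemma rV_cons_lift m (p : R * 'rV[R]_m) j : rV_cons p ord0 (lift ord0 j) = p.2 ord0 j.
Proof. by rewrite mxE liftK. Qed.

Lemma continuous_rV_cons_l m (v : 'rV[R]_m) : continuous (fun t => rV_cons (t, v)).
Proof.
apply: continuous_rV => i; case: (unliftP ord0 i) => [j ->|->] t.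
  rewrite (_ : (fun _ => _) = cst (v ord0 j)); first exact: cvg_cst.
  by apply/funext => ?; rewrite rV_cons_lift.
rewrite (_ : (fun _ => _) = id); first exact: cvg_id.
by apply/funext => ?; rewrite rV_cons_ord0.
Qed.

Lemma continuous_rV_cons_r m (t : R) : continuous (fun v : 'rV[R]_m => rV_cons (t, v)).
Proof.
apply: continuous_rV => i; case: (unliftP ord0 i) => [j ->|->] v.
  rewrite (_ : (fun _ => _) = (fun v : 'rV[R]_m => v ord0 j)).
    exact: coord_continuous.
  by apply/funext => ?; rewrite rV_cons_lift.
rewrite (_ : (fun _ => _) = cst t); first exact: cst_continuous.
by apply/funext => ?; rewrite rV_cons_ord0.
Qed.

Lemma normr_rV_cons_l m t (v : 'rV[R]_m) : `|t| <= `|rV_cons (t, v)|.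
Proof. by have := normr_coord_le (rV_cons (t, v)) ord0; rewrite mxE unlift_none. Qed.

Lemma normr_rV_cons_r m t (v : 'rV[R]_m) : `|v| <= `|rV_cons (t, v)|.
Proof.
apply: normr_rV_le => // i.
by have := normr_coord_le (rV_cons (t, v)) (lift ord0 i); rewrite mxE liftK.
Qed.

(** Fubini reduces the claim to one variable.  By induction on the dimension,
    either the derivative is along the first coordinate, and the inner integral
    over this coordinate is 0, or it is along a later one, and the inner
    integral over the remaining coordinates is 0 by induction. *)
Lemma integral_partial_support m (f g : 'rV[R]_m -> R) (j : 'I_m) r :
  continuous g -> (forall x, is_derive x (delta_mx ord0 j) f (g x)) ->
  (forall x, r <= `|x| -> f x = 0 /\ g x = 0) ->
  (\int[lebesgue_rV R m]_x (g x)%:E = 0)%E.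
Proof.
elim: m f g j => [|m IH] f g j cg fg supp; first by case: j fg.
have ig : (lebesgue_rV R m.+1).-integrable setT (EFin \o g).
  by apply: (@integrable_bounded_support _ _ _ r) => // x /ltW /supp[].
rewrite (integral_rV_cons ig).
have := integrable_rV_cons ig => igc.
case: (unliftP ord0 j) => [j' jE|jE].
  rewrite -integral12_prod_meas1 //; rewrite (eq_integral (cst 0%E)) ?integral0 // => t _.
  apply: (IH (fun v => f (rV_cons (t, v))) (fun v => g (rV_cons (t, v))) j').
    + move=> v; apply: continuous_comp; first exact: continuous_rV_cons_r.
      exact: cg.
    + move=> v; apply/(@is_derive_affine _ _ _ _ f (fun v => rV_cons (t, v)) _ _ (delta_mx ord0 j)) => //.
      move=> h; apply/rowP => i; case: (unliftP ord0 i) => [i' ->|->];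
        rewrite !mxE ?liftK ?unlift_none /= ?mxE jE.
        by rewrite (inj_eq (@lift_inj _ ord0)).
      by rewrite (_ : (ord0 == _) = false) // mulr0 add0r.
    + by move=> v vr; apply: supp; rewrite (le_trans vr) // normr_rV_cons_r.
rewrite -integral21_prod_meas1 //; rewrite (eq_integral (cst 0%E)) ?integral0 // => v _.
apply: (@integral_derive_support (fun t => f (rV_cons (t, v))) (fun t => g (rV_cons (t, v))) r).
  + move=> t; apply: continuous_comp; first exact: continuous_rV_cons_l.
    exact: cg.
  + move=> t; apply/(@is_derive_affine _ _ _ _ f (fun t => rV_cons (t, v)) _ _ (delta_mx ord0 j)) => //.
    move=> h; apply/rowP => i; case: (unliftP ord0 i) => [i' ->|->];
      rewrite !mxE ?liftK ?unlift_none /= ?mxE jE /=.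
      by rewrite mulr0 add0r.
    by [].
  + by move=> t vr; apply: supp; rewrite (le_trans vr) // normr_rV_cons_l.
Qed.

End integral_of_derivative.

(** * Calculus with partial derivatives relative to a set *)

Lemma cvg_sumR (R : realType) (I T : Type) (F : set_system T) (r : seq I)
    (P : pred I) (f : I -> T -> R) (a : I -> R) : Filter F ->
  (forall i, P i -> f i x @[x --> F] --> a i) ->
  \sum_(i <- r | P i) f i x @[x --> F] --> \sum_(i <- r | P i) a i.
Proof. by move=> FF fa; apply: cvg_big => //; exact: add_continuous. Qed.

Lemma continuous_sumR (R : realType) (I : Type) (T : topologicalType) (r : seq I)
    (P : pred I) (f : I -> T -> R) : (forall i, P i -> continuous (f i)) ->
  continuous (fun x => \sum_(i <- r | P i) f i x).
Proof. by move=> fc; apply: continuous_big => //; exact: add_continuous. Qed.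

Section continuous_arithmetic.
Context {R : realType} {T : topologicalType}.
Implicit Types f g : T -> R.

Lemma continuousRD f g : continuous f -> continuous g -> continuous (fun x => f x + g x).
Proof. by move=> cf cg x; apply: (@cvgD _ _ _ (nbhs x) _ f g); [exact: cf|exact: cg]. Qed.

Lemma continuousRB f g : continuous f -> continuous g -> continuous (fun x => f x - g x).
Proof. by move=> cf cg x; apply: (@cvgB _ _ _ (nbhs x) _ f g); [exact: cf|exact: cg]. Qed.

Lemma continuousRM f g : continuous f -> continuous g -> continuous (fun x => f x * g x).
Proof. by move=> cf cg x; apply: (@cvgM _ _ (nbhs x) _ f g); [exact: cf|exact: cg]. Qed.

Lemma continuousRZ c f : continuous f -> continuous (fun x => c * f x).
Proof. by move=> cf; apply: continuousRM => // x; exact: cvg_cst. Qed.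

End continuous_arithmetic.

Section partials.
Context {R : realType} {n : nat}.
Implicit Types (A O : set 'rV[R]_n) (f : 'rV[R]_n -> R).

Lemma convex_setE O : convex_set (O : set (convex_lmodType 'rV[R]_n)) ->
  forall x y t, 0 <= t <= 1 -> O x -> O y -> O (t *: x + (1 - t) *: y).
Proof.
move=> cO x y t t01 Ox Oy.
have := cO x y (Itv01 (proj1 (andP t01)) (proj2 (andP t01))).
by rewrite !inE; exact.
Qed.

Lemma convex_segment O : convex_set (O : set (convex_lmodType 'rV[R]_n)) ->
  forall x y t, 0 <= t <= 1 -> O x -> O y -> O (x + t *: (y - x)).
Proof.
move=> cO x y t t01 Ox Oy.
have -> : x + t *: (y - x) = t *: y + (1 - t) *: x.
  by apply/rowP => i; rewrite !mxE; ring.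
exact: convex_setE.
Qed.

Lemma partials_onS (W : normedModType R) A O (f : 'rV[R]_n -> W) Df :
  O `<=` A -> partials_on A f Df -> partials_on O f Df.
Proof.
move=> OA pf x Ox; have := pf x (OA x Ox); apply: cvg_trans; apply: cvg_app.
exact: within_subset.
Qed.

Lemma partials_on_coord p q A (f : 'rV[R]_n -> 'M[R]_(p, q)) Df i j :
  partials_on A f Df -> partials_on A (fun x => f x i j) (fun l x => Df l x i j).
Proof.
move=> pf x Ax; have := cvg_comp _ _ (pf x Ax) (@coord_continuous R p q i j 0).
rewrite mxE; apply: cvg_trans; apply: near_eq_cvg; near=> y => /=.
rewrite !mxE summxE; congr (_ * (_ - _)).
by apply: eq_bigr => l _; rewrite mxE.
Unshelve. all: by end_near. Qed.

(** First order expansion with an explicit remainder [|y - x| r y].  It holds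
    at [y = x] too, where the quotient defining [r] is 0. *)
Lemma partials_on_remainder A f Df x : partials_on A f Df -> A x ->
  exists2 r : 'rV[R]_n -> R, r y @[y --> within A (nbhs x)] --> 0 &
    forall y, f y = f x + \sum_(l < n) (y - x) ord0 l * Df l x + `|y - x| * r y.
Proof.
move=> pf Ax; exists (fun y => `|y - x|^-1 * (f y - f x - \sum_(i < n) (y - x) ord0 i * Df i x)).
  exact: pf.
move=> y; have [->|yx] := eqVneq y x.
  rewrite subrr normr0 mul0r big1 ?addr0 // => l _; by rewrite mxE mul0r.
by rewrite mulVKf ?normr_eq0 ?subr_eq0 //; ring.
Qed.

Lemma partials_on_continuous A f Df : partials_on A f Df ->
  {within A, continuous f}.
Proof.
move=> pf; apply/subspace_continuousP => x Ax.
have [r r0 fE] := partials_on_remainder pf Ax.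
have dyx : `|y - x| @[y --> within A (nbhs x)] --> 0.
  apply/cvgr0Pnorm_lt => e e0; have : nbhs x (ball x e) by exact: nbhsx_ballx.
  rewrite mx_norm_ball /ball_ /within /= => xe.
  by apply: filterS xe => y yx _; rewrite normr_id distrC.
rewrite (_ : f = fun y => f x + \sum_(l < n) (y - x) ord0 l * Df l x + `|y - x| * r y);
  last exact/funext.
rewrite [X in _ --> X](_ : _ = f x + \sum_(l < n) 0 * Df l x + 0 * 0).
  apply: cvgD; last exact: cvgM.
  apply: cvgD; first exact: cvg_cst.
  apply: cvg_sumR => l _; apply: cvgM; last exact: cvg_cst.
  apply/cvgr0Pnorm_lt => e e0; move/cvgr0Pnorm_lt : dyx => /(_ e e0).
  by apply: filterS => y; rewrite normr_id; apply: le_lt_trans; exact: normr_coord_le.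
by rewrite big1 ?mulr0 ?mul0r ?addr0 ?subrr ?normr0 ?mul0r ?addr0 // => l _; rewrite ?mxE ?subrr mul0r.
Qed.

(** Only the values of [f] on [A] matter, so it is enough that the line
    [u (h v + x)] stays in [A] for small [h].  Expand [f] at [u x] with the
    remainder [r]: the linear part gives the derivative, and the remainder
    divided by [h] is a bounded quotient times [r], which tends to 0. *)
Lemma is_derive_chain (V : normedModType R) A f Df (u : V -> 'rV[R]_n) x v
    (d : 'I_n -> R) :
  partials_on A f Df -> A (u x) -> (\forall h \near (0 : R), A (u (h *: v + x))) ->
  (forall l, is_derive x v (fun y => u y ord0 l) (d l)) ->
  is_derive x v (f \o u) (\sum_(l < n) d l * Df l (u x)).
Proof.
move=> pf Aux Au ud; have [r r0 fE] := partials_on_remainder pf Aux.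
pose w h : 'rV[R]_n := u (h *: v + x) - u x.
have wl l : h^-1 * w h ord0 l @[h --> 0^'] --> d l.
  have [dx <-] := ud l; move: dx; rewrite /derivable /derive.
  rewrite (_ : (fun h => _) = (fun h : R => h^-1 * w h ord0 l)) //.
  by apply/funext => h /=; rewrite /w !mxE.
have wv : h^-1 *: w h @[h --> 0^'] --> \row_l d l.
  have wE h l : (\row_l d l - h^-1 *: w h) ord0 l = d l - h^-1 * w h ord0 l.
    by rewrite /w !mxE.
  apply/cvgrPdist_lt => e e0.
  have : \forall h \near 0^', forall l, `|d l - h^-1 * w h ord0 l| < e.
    by apply: filter_forall => l; have /cvgrPdist_lt := wl l; exact.
  by apply: filterS => h he; apply: normr_rV_lt => // l; rewrite wE.
have w0 : w h @[h --> 0^'] --> (0 : 'rV[R]_n).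
  have : h *: (h^-1 *: w h) @[h --> 0^'] --> (0 : R) *: \row_l d l.
    by apply: cvgZ => //; apply: cvg_within_filter; exact: cvg_id.
  rewrite scale0r; apply: cvg_trans; apply: near_eq_cvg.
  have : \forall h \near 0^', h != 0 :> R by exact: nbhs_dnbhs_neq.
  by apply: filterS => h h0; rewrite scalerA divff // scale1r.
have uA : u (h *: v + x) @[h --> 0^'] --> within A (nbhs (u x)).
  have ux : u (h *: v + x) @[h --> 0^'] --> u x.
    have : w h + u x @[h --> 0^'] --> 0 + u x by apply: cvgD => //; exact: cvg_cst.
    rewrite add0r; apply: cvg_trans; apply: near_eq_cvg.
    by apply: nearW => h; rewrite /w subrK.
  move=> S /ux S1; have Au' := nbhs_dnbhs Au.
  by apply: filterS2 S1 Au' => h; exact.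
have rw := cvg_comp _ _ uA r0.
have wn : `|h^-1| * `|w h| * `|r (u (h *: v + x))| @[h --> 0^'] --> 0.
  rewrite [X in _ --> X](_ : _ = `|\row_l d l| * `|0 : R|); last by rewrite normr0 mulr0.
  apply: cvgM; last exact: cvg_norm.
  rewrite (_ : (fun h => _) = (fun h : R => `|h^-1 *: w h|)); last first.
    by apply/funext => h; rewrite normrZ.
  exact: cvg_norm.
have main : (fun h : R => h^-1 *: ((f \o u \o shift x) (h *: v) - (f \o u) x)) @ 0^'
    --> \sum_(l < n) d l * Df l (u x).
  rewrite (_ : (fun h => _) = (fun h => \sum_(l < n) (h^-1 * w h ord0 l) * Df l (u x) +
      h^-1 * (`|w h| * r (u (h *: v + x))))); last first.
    apply/funext => h /=; rewrite (fE (u (h *: v + x))) -/(w h).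
    rewrite [_ *: _](_ : _ = h^-1 * (\sum_(l < n) w h ord0 l * Df l (u x)
      + `|w h| * r (u (h *: v + x)))); last by congr (_ * _); ring.
    rewrite mulrDr mulr_sumr; congr (_ + _); apply: eq_bigr => l _; ring.
  rewrite -[X in _ --> X]addr0; apply: cvgD.
    by apply: cvg_sumR => l _; apply: cvgM => //; exact: cvg_cst.
  apply: norm_cvg0; move: wn; apply: cvg_trans; apply: near_eq_cvg.
  by apply: nearW => h; rewrite !normrM normr_id; ring.
by apply: DeriveDef; [apply/cvg_ex; eexists; exact: main | exact: cvg_lim main].
Unshelve. all: by end_near. Qed.

(** The one-dimensional mean value theorem on the segment from [V] to [W],
    which stays in [O]. *)
Lemma convex_mean_value O f Df V W :
  convex_set (O : set (convex_lmodType 'rV[R]_n)) -> partials_on O f Df ->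
  O V -> O W ->
  exists P, [/\ O P, `|P - V| <= `|W - V| &
    f W - f V = \sum_(l < n) (W - V) ord0 l * Df l P].
Proof.
move=> cO pf OV OW; pose c (s : R) := V + s *: (W - V).
have Oc s : 0 <= s <= 1 -> O (c s) by move=> s01; exact: convex_segment.
have [] := @MVT_segment R (f \o c) (fun s => \sum_(l < n) (W - V) ord0 l * Df l (c s)) 0 1 ler01.
- move=> s; rewrite in_itv /= => /andP[s0 s1].
  apply: is_derive_chain pf _ _ _; first by apply: Oc; rewrite !ltW.
    have : \forall t \near s, t \in `]0, 1[ by apply: near_in_itvoo; rewrite in_itv /= s0.
    move=> st; have h0 : h *: 1 + s @[h --> (0 : R)] --> s.
      rewrite -[X in _ --> X]add0r; apply: cvgD; last exact: cvg_cst.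
      by rewrite -[X in _ --> X](scale0r (1 : R)); apply: cvgZr_tmp; exact: cvg_id.
    have {}st : \forall h \near (0 : R), h *: 1 + s \in `]0, 1[ by exact: (h0 _ st).
    apply: filterS st => h; rewrite in_itv /= => /andP[h0' h1].
    by apply: Oc; rewrite !ltW.
  move=> l.
  rewrite (_ : (fun y => _) = (fun s => V ord0 l + s * (W - V) ord0 l)); last first.
    by apply/funext => y; rewrite /c !mxE.
  apply: is_derive_eq; rewrite scaler0 !add0r mul1r; exact: mulr1.
- apply/subspace_continuousP => s /= ; rewrite in_itv /= => s01.
  have /subspace_continuousP cf := partials_on_continuous pf.
  have cs : c t @[t --> within `[0, 1] (nbhs s)] --> within O (nbhs (c s)).
    have c0 : c t @[t --> s] --> c s.
      apply: cvgD; first exact: cvg_cst.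
      by apply: cvgZr_tmp; exact: cvg_id.
    move=> S /c0 S1; rewrite /within /=.
    have {}S1 : \forall t \near s, O (c t) -> S (c t) by exact: S1.
    by apply: filterS S1 => t St t01; apply/St/Oc; move: t01; rewrite /= in_itv.
  exact: (cvg_comp _ _ cs (cf _ (Oc _ s01))).
- move=> t; rewrite in_itv /= => t01 E; exists (c t); split; first exact: Oc.
    rewrite /c addrAC subrr add0r normrZ ler_piMl //.
    by have /andP[t0 t1] := t01; rewrite ger0_norm.
  move: E; rewrite subr0 mulr1 /= /c scale0r addr0 scale1r => <-.
  by congr (f _ - f _); rewrite addrC subrK.
Unshelve. all: by end_near. Qed.

Lemma sum_coord_le (v : 'rV[R]_n) (d : 'I_n -> R) M :
  (forall l, `|d l| <= M) -> `|\sum_(l < n) v ord0 l * d l| <= n%:R * (`|v| * M).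
Proof.
move=> dM; apply: le_trans (ler_norm_sum _ _ _) _.
apply: (@le_trans _ _ (\sum_(l < n) `|v| * M)).
  by apply: ler_sum => l _; rewrite normrM ler_pM // normr_coord_le.
by rewrite sumr_const card_ord mulr_natl.
Qed.

Lemma convex_lipschitz O f Df V W M :
  convex_set (O : set (convex_lmodType 'rV[R]_n)) -> partials_on O f Df ->
  O V -> O W -> (forall l P, O P -> `|P - V| <= `|W - V| -> `|Df l P| <= M) ->
  `|f W - f V| <= n%:R * (`|W - V| * M).
Proof.
move=> cO pf OV OW DM; have [P [OP PV ->]] := convex_mean_value cO pf OV OW.
by apply: sum_coord_le => l; exact: DM.
Qed.

(** Mean value theorem for [f], then for its partial derivatives, whence the
    factor [n ^ 2] in place of the usual [1 / 2]. *)
Lemma convex_taylor O f Df D2f V W M :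
  convex_set (O : set (convex_lmodType 'rV[R]_n)) -> partials_on O f Df ->
  (forall l, partials_on O (Df l) (D2f l)) ->
  O V -> O W -> (forall l l' P, O P -> `|D2f l l' P| <= M) ->
  `|f W - f V - \sum_(l < n) (W - V) ord0 l * Df l V| <=
    n%:R ^+ 2 * M * `|W - V| ^+ 2.
Proof.
move=> cO pf pDf OV OW DM; have [P [OP PV ->]] := convex_mean_value cO pf OV OW.
rewrite -sumrB (eq_bigr (fun l => (W - V) ord0 l * (Df l P - Df l V))); last first.
  by move=> l _; rewrite mulrBr.
apply: le_trans (sum_coord_le _ (M := n%:R * (`|W - V| * M)) _) _; last first.
  by rewrite le_eqVlt; apply/orP; left; apply/eqP; ring.
move=> l; have M0 : 0 <= M by exact: le_trans (normr_ge0 _) (DM l l V OV).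
apply: le_trans (convex_lipschitz cO (pDf l) OV OP (M := M) _) _.
  by move=> l' P' OP' _; exact: DM.
by rewrite ler_wpM2l // ler_wpM2r.
Qed.

End partials.

(** * Averages of maps with values in a convex set *)

Section convex_separation.
Context {R : realType}.

Definition dot n (u v : 'rV[R]_n) : R := \sum_(i < n) u ord0 i * v ord0 i.

Lemma dotDr n (u v w : 'rV[R]_n) : dot u (v + w) = dot u v + dot u w.
Proof. by rewrite -big_split; apply: eq_bigr => i _; rewrite mxE mulrDr. Qed.

Lemma dotZr n c (u v : 'rV[R]_n) : dot u (c *: v) = c * dot u v.
Proof. by rewrite mulr_sumr; apply: eq_bigr => i _; rewrite mxE mulrCA. Qed.

Lemma dotC n (u v : 'rV[R]_n) : dot u v = dot v u.
Proof. by apply: eq_bigr => i _; rewrite mulrC. Qed.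

Lemma dotvv_ge0 n (u : 'rV[R]_n) : 0 <= dot u u.
Proof. by apply: sumr_ge0 => i _; rewrite -expr2 sqr_ge0. Qed.

Lemma dot_line n (u v : 'rV[R]_n) s :
  dot (u + s *: v) (u + s *: v) = dot u u + (s * dot u v + s * dot u v) + s * s * dot v v.
Proof.
rewrite /dot !mulr_sumr -!big_split; apply: eq_bigr => i _ /=; rewrite !mxE; ring.
Qed.

Lemma continuous_dot n (v : 'rV[R]_n) : continuous (fun u => dot u v).
Proof.
apply: continuous_sumR => j _ u.
apply: (@cvgM _ _ (nbhs u) _ (fun u : 'rV[R]_n => u ord0 j) (cst (v ord0 j))).
  exact: coord_continuous.
exact: cvg_cst.
Qed.

(** Splitting off the first point, the others are rescaled by their total
    weight [s]; when [s = 0] the first point carries all the weight. *)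
Lemma convex_combination n (O : set 'rV[R]_n) :
  convex_set (O : set (convex_lmodType 'rV[R]_n)) ->
  forall r (t : 'I_r -> R) (v : 'I_r -> 'rV[R]_n), (forall i, 0 <= t i) ->
  \sum_(i < r) t i = 1 -> (forall i, O (v i)) -> O (\sum_(i < r) t i *: v i).
Proof.
move=> cO; elim=> [|r IH] t v t0; first by rewrite big_ord0 => /esym/eqP; rewrite oner_eq0.
rewrite !big_ord_recl => t1 Ov; set s := \sum_(i < r) _ in t1.
have s0 : 0 <= s by apply: sumr_ge0.
have [sE|sn0] := eqVneq s 0.
  move: t1; rewrite sE addr0 => ->; rewrite scale1r big1 ?addr0 // => i _.
  have /eqP := sE; rewrite psumr_eq0 // => /allP/(_ i (mem_index_enum _)) /= /eqP ->.
  by rewrite scale0r.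
rewrite (_ : \sum_(i < r) _ = (1 - t ord0) *: \sum_(i < r) (t (lift ord0 i) / s) *: v (lift ord0 i)).
  apply: convex_setE => //; first by rewrite t0 -t1 lerDl.
  apply: IH => //; first by move=> i; rewrite divr_ge0.
  by rewrite -mulr_suml divff.
rewrite -t1 addrC addKr scaler_sumr; apply: eq_bigr => i _.
by rewrite scalerA mulrC divfK.
Qed.

(** Gordan's alternative.  Let [p t] be the point of least Euclidean norm in the
    convex hull of the [w i].  If [p t] had a negative scalar product with some
    [w i - p t], moving from [p t] towards [w i] would decrease the norm; so
    [dot (p t) (w i) >= dot (p t) (p t) >= 0], and [p t] is normalised. *)
Lemma gordan n r (w : 'I_r -> 'rV[R]_n.+1) :
  (forall t : 'I_r -> R, (forall i, 0 <= t i) -> \sum_(i < r) t i = 1 ->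
    \sum_(i < r) t i *: w i <> 0) ->
  exists2 l : 'rV[R]_n.+1, `|l| = 1 & forall i, 0 <= dot l (w i).
Proof.
case: r w => [w _|r w w0].
  exists (const_mx 1); last by case.
  apply/eqP; rewrite eq_le; apply/andP; split.
    by apply: normr_rV_le => // i; rewrite mxE normr1.
  by have := normr_coord_le (const_mx 1 : 'rV[R]_n.+1) ord0; rewrite mxE normr1.
pose S := [set t : 'rV[R]_r.+1 | (forall i, 0 <= t ord0 i) /\ \sum_i t ord0 i = 1].
pose p (t : 'rV[R]_r.+1) := \sum_i t ord0 i *: w i.
have pE t j : p t ord0 j = \sum_i t ord0 i * w i ord0 j.
  by rewrite summxE; apply: eq_bigr => i _; rewrite mxE.
have dE (i : 'I_r.+1) j : \sum_k (delta_mx ord0 i : 'rV[R]_r.+1) ord0 k * w k ord0 j = w i ord0 j.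
  rewrite (bigD1 i) //= mxE !eqxx mul1r big1 ?addr0 // => k /negbTE ki.
  by rewrite mxE ki andbF mul0r.
have cp : continuous (fun t => dot (p t) (p t)).
  have cpj j : continuous (fun t : 'rV[R]_r.+1 => p t ord0 j).
    rewrite (_ : (fun t => _) = fun t : 'rV[R]_r.+1 => \sum_i t ord0 i * w i ord0 j).
      apply: continuous_sumR => i _ t.
      apply: (@cvgM _ _ (nbhs t) _ (fun t : 'rV[R]_r.+1 => t ord0 i) (cst (w i ord0 j))).
        exact: coord_continuous.
      exact: cvg_cst.
    exact/funext.
  apply: continuous_sumR => j _ t; apply: (@cvgM _ _ (nbhs t) _ (fun t => p t ord0 j)); exact: cpj.
have compS : compact S.
  apply: (subclosed_compact _ (@compact_closed_cube _ _ 1)).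
    rewrite (_ : S = \bigcap_i [set t : 'rV[R]_r.+1 | 0 <= t ord0 i] `&` [set t | \sum_i t ord0 i = 1]).
      apply: closedI.
        apply: closed_bigI => i _; apply: (@closed_comp _ _ (fun t : 'rV[R]_r.+1 => t ord0 i) [set x | 0 <= x]).
          by move=> t _; exact: coord_continuous.
        exact: closed_ge.
      apply: (@closed_comp _ _ (fun t : 'rV[R]_r.+1 => \sum_i t ord0 i) [set 1]).
        by move=> t _; apply: continuous_sumR => j _; exact: coord_continuous.
      exact: closed_eq.
    by apply/seteqP; split => t [t0 t1]; split => // i; [move=> _|]; exact: t0.
  move=> t [t0 t1] /=; apply: normr_rV_le => // i.
  by rewrite ger0_norm // -t1 (bigD1 i) //= lerDl sumr_ge0.
have S0 : S !=set0.
  exists (delta_mx ord0 ord0); split => [i|]; first by rewrite mxE; case: (_ && _).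
  by rewrite (bigD1 ord0) //= mxE !eqxx big1 ?addr0 // => i /negbTE i0; rewrite mxE i0 andbF.
have [|t tS tmin] := compact_EVT_min S0 compS (f := fun t => dot (p t) (p t)).
  exact: continuous_subspaceT.
move: tS; rewrite inE => -[t0 t1].
have pt0 : p t != 0 by apply/eqP; apply: w0.
have pw i : 0 <= dot (p t) (w i - p t).
  rewrite leNgt; apply/negP => neg.
  (* [s] minimises [|p t + s (w i - p t)|^2] up to a harmless enlargement of
     the denominator, which keeps it in the unit interval *)
  set a := dot (p t) _ in neg; pose b := dot (w i - p t) (w i - p t).
  have b0 : 0 <= b by exact: dotvv_ge0.
  pose s := - a / (b - a).
  have ba : 0 < b - a by lra.
  have s_gt0 : 0 < s by rewrite divr_gt0 // oppr_gt0.
  have s_le1 : s <= 1 by rewrite ler_pdivrMr // mul1r lerBrDr; lra.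
  have sE : s * (b - a) = - a by rewrite /s divfK // gt_eqF.
  clearbody s.
  pose t' := (1 - s) *: t + s *: delta_mx ord0 i.
  have pt' : p t' = p t + s *: (w i - p t).
    apply/rowP => j; rewrite pE.
    under eq_bigr => k _ do
      rewrite /t' mxE [(_ *: t) _ _]mxE [(_ *: delta_mx _ _) _ _]mxE mulrDl -!mulrA.
    rewrite big_split /= -!mulr_sumr dE -pE.
    have -> : (p t + s *: (w i - p t)) ord0 j = p t ord0 j + s * (w i ord0 j - p t ord0 j).
      by move: (p t) => q; rewrite !mxE.
    ring.
  have t'S : t' \in S.
    rewrite inE; split => [k|].
      by rewrite !mxE addr_ge0 // mulr_ge0 //; lra.
    under eq_bigr => k _ do rewrite !mxE.
    rewrite big_split /= -!mulr_sumr t1 (bigD1 i) //= big1 ?eqxx; first by rewrite /=; lra.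
    by move=> k /negbTE ki; rewrite ki ?andbF.
  have := tmin _ t'S; rewrite pt'.
  rewrite dot_line -/a -/b.
  have : s * s * b + s * a + s * a < 0.
    have -> : s * s * b = s * (s * (b - a)) + s * s * a by ring.
    rewrite sE.
    have -> : s * - a + s * s * a + s * a + s * a = s * (a * (1 + s)) by ring.
    by rewrite pmulr_rlt0 // nmulr_rlt0 //; lra.
  lra.
have np : 0 < `|p t| by rewrite normr_gt0.
exists (`|p t|^-1 *: p t) => [|i].
  by rewrite normrZ normfV normr_id mulVf // gt_eqF.
rewrite dotC dotZr mulr_ge0 ?invr_ge0 // dotC.
have := pw i; rewrite dotDr -scaleN1r dotZr mulN1r subr_ge0.
by apply: le_trans; exact: dotvv_ge0.
Qed.

(** The set [O] is arbitrary, so the functional comes from compactness of the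
    unit sphere: the closed conditions [0 <= dot l (v - m)], one for each [v]
    in [O], are satisfiable finitely many at a time by [gordan], since [m] is
    not a convex combination of points of [O]. *)
Lemma convex_separation n (O : set 'rV[R]_n.+1) m :
  convex_set (O : set (convex_lmodType 'rV[R]_n.+1)) -> ~ O m ->
  exists2 l : 'rV[R]_n.+1, l != 0 & forall v, O v -> 0 <= dot l (v - m).
Proof.
move=> cO Om.
pose S := [set l : 'rV[R]_n.+1 | `|l| = 1].
have cS : compact S.
  apply: (subclosed_compact _ (@compact_closed_cube _ _ 1)); last by move=> l /= ->.
  apply: (@closed_comp _ _ (fun l : 'rV[R]_n.+1 => `|l|) [set 1]).
    by move=> l _; exact: norm_continuous.
  exact: closed_eq.
pose H v := [set l : 'rV[R]_n.+1 | 0 <= dot l (v - m)].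
move: cS; rewrite compact_In0 => /(_ _ O (fun v => S `&` H v)) [].
- exists H => // v _; apply: (@closed_comp _ _ (fun l : 'rV[R]_n.+1 => dot l (v - m)) [set x | 0 <= x]).
    by move=> l _; exact: continuous_dot.
  exact: closed_ge.
- move=> D' D'O; pose E := finmap.enum_fset D'.
  have [|l l1 lP] := @gordan n (size E) (fun i => nth m E i - m).
    move=> t t0 t1 tE; apply: Om.
    have -> : m = \sum_(i < size E) t i *: nth m E i.
      apply/esym/eqP; rewrite -subr_eq0 -[X in _ - X]scale1r -t1 scaler_suml -sumrB.
      by apply/eqP; rewrite -[RHS]tE; apply: eq_bigr => i _; rewrite scalerBr.
    apply: convex_combination => // i; have := D'O (nth m E i).
    by rewrite inE; apply; exact: mem_nth.
  exists l => v /= vD'; split => //; rewrite /H /=.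
  by have := lP (Ordinal (etrans (index_mem v E) vD')); rewrite /= nth_index.
- move=> l lP; have [[v Ov]|nO] := pselect (O !=set0).
    exists l; last by move=> u /lP[].
    by have [l1 _] := lP v Ov; apply/eqP => l0; move: l1; rewrite /S /= l0 normr0 => /esym/eqP; rewrite oner_eq0.
  exists (const_mx 1); last by move=> v Ov; exfalso; apply: nO; exists v.
  by apply/eqP => /rowP/(_ ord0); rewrite !mxE => /eqP; rewrite oner_eq0.
Qed.

End convex_separation.

(** Suppose that the mean [m] is outside [O] and let [l] separate it from [O].
    Then [w * dot l (f - m)] is nonnegative with integral 0, hence vanishes
    almost everywhere, and [f] takes almost all its values in the hyperplane
    [dot l (v - m) = 0].  Replacing [w] by 0 on the exceptional null set
    changes no integral, and forgetting a coordinate [j0] with [l_j0 != 0]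
    identifies the slice of [O] by this hyperplane with a convex set of
    dimension one less; by induction the mean lies in the slice. *)
Lemma barycenter_convex (R : realType) d (T : measurableType d)
    (mu : {measure set T -> \bar R}) n (O : set 'rV[R]_n) (w : T -> R)
    (f : T -> 'rV[R]_n) :
  convex_set (O : set (convex_lmodType 'rV[R]_n)) ->
  (forall x, 0 <= w x) -> mu.-integrable setT (EFin \o w) ->
  \int[mu]_x w x = 1 ->
  (forall i, mu.-integrable setT (EFin \o (fun x => w x * f x ord0 i))) ->
  (forall x, 0 < w x -> O (f x)) ->
  O (\row_i \int[mu]_x (w x * f x ord0 i)).
Proof.
elim: n O w f => [|n IH] O w f cO w0 iw w1 iwf wO.
  have [x wx] : exists x, 0 < w x.
    apply: contrapT => nx; move: w1; rewrite (_ : w = cst 0).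
      by rewrite Rintegral_cst // mul0r => /esym/eqP; rewrite oner_eq0.
    apply/funext => x; apply/eqP; rewrite eq_le w0 andbT leNgt.
    by apply/negP => wx; apply: nx; exists x.
  by rewrite (_ : \row_i _ = f x); [exact: wO | apply/rowP; case].
set m := \row_i _; apply: contrapT => nOm.
have [l l0 lO] := convex_separation cO nOm.
pose h x := dot l (f x - m).
have whE x : w x * h x = \sum_j (l ord0 j * (w x * f x ord0 j) - l ord0 j * m ord0 j * w x).
  by rewrite /h /dot mulr_sumr; apply: eq_bigr => j _; rewrite mxE [(- m) _ _]mxE; ring.
have iwh_j j : mu.-integrable setT (EFin \o (fun x => l ord0 j * (w x * f x ord0 j) - l ord0 j * m ord0 j * w x)).
  by apply: integrableRB; apply: integrableRZ => //; exact: iwf.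
have iwh : mu.-integrable setT (EFin \o (fun x => w x * h x)).
  under eq_fun do rewrite /= whE.
  exact: integrableR_sum.
have wh0 x : 0 <= w x * h x.
  have := w0 x; rewrite le_eqVlt => /predU1P[<-|wx]; first by rewrite mul0r.
  by rewrite mulr_ge0 //; apply: lO; exact: wO.
have int_wh : \int[mu]_x (w x * h x) = 0.
  under eq_Rintegral => x _ do rewrite whE.
  rewrite Rintegral_sum // big1 // => j _.
  rewrite RintegralB //; [|exact: integrableRZ|exact: integrableRZ].
  by rewrite !RintegralZl // w1 mulr1 mxE subrr.
have wh_ae : ae_eq mu setT (EFin \o (fun x => w x * h x)) (cst 0%E).
  apply/ae_eq_integral_abs => //; first exact: measurable_int iwh.
  under eq_integral => x _ do rewrite /= ger0_norm //.
  by rewrite -(fineK (integrable_fin_num measurableT iwh)); congr (_%:E).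
(* [w'] lives on the hyperplane and differs from [w] on a null set only *)
pose w' x := if w x * h x == 0 then w x else 0.
have mw' : measurable_fun setT w'.
  apply: measurable_fun_ifT => //; last exact: measurable_integrableR iw.
  by apply: measurable_fun_eqr => //; exact: measurable_integrableR iwh.
have w'w x : `|w' x| <= w x by rewrite /w'; case: ifP => _; rewrite ?normr0 // ger0_norm.
have w'0 x : 0 <= w' x by rewrite /w'; case: ifP.
have mf j : mu.-integrable setT (EFin \o (fun x => w' x * f x ord0 j)).
  have -> : (fun x => w' x * f x ord0 j) =
            (fun x => if w x * h x == 0 then w x * f x ord0 j else 0).
    by apply/funext => x; rewrite /w'; case: ifP => // _; rewrite mul0r.
  apply: (le_integrable measurableT _ _ (iwf j)) => [|x _ /=].
    apply/measurable_EFinP; apply: measurable_fun_ifT => //.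
      by apply: measurable_fun_eqr => //; exact: measurable_integrableR iwh.
    exact: measurable_integrableR (iwf j).
  by rewrite lee_fin; case: ifP => // _; rewrite normr0.
have ae_w' (g : T -> R) : mu.-integrable setT (EFin \o (fun x => w x * g x)) ->
    mu.-integrable setT (EFin \o (fun x => w' x * g x)) ->
    \int[mu]_x (w' x * g x) = \int[mu]_x (w x * g x).
  move=> ig ig'; congr fine; apply: ae_eq_integral => //.
  - exact: measurable_int ig'.
  - exact: measurable_int ig.
  - apply: filterS wh_ae => x /(_ Logic.I) [wx0] _.
    by rewrite /w' wx0 eqxx.
have iw' : mu.-integrable setT (EFin \o w') by exact: le_integrableR iw.
have w'1 : \int[mu]_x w' x = 1.
  rewrite -w1; under eq_Rintegral => x _ do rewrite -(mulr1 (w' x)).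
  rewrite ae_w'; by [under eq_Rintegral => x _ do rewrite mulr1 |
     under eq_fun do rewrite /= mulr1 ].
have [j0 lj0] : exists j, l ord0 j != 0.
  apply: contrapT => nj; move/negP: l0; apply; apply/eqP/rowP => j; rewrite mxE.
  by apply: contrapT => /eqP lj; apply: nj; exists j.
(* the slice of [O], seen through all the coordinates but [j0] *)
pose O' := [set u : 'rV[R]_n | exists v, [/\ O v, dot l (v - m) = 0 & u = \row_j v ord0 (lift j0 j)]].
have cO' : convex_set (O' : set (convex_lmodType 'rV[R]_n)).
  move=> u1 u2 t; rewrite !inE => -[v1 [Ov1 lv1 ->]] [v2 [Ov2 lv2 ->]].
  pose v : 'rV[R]_n.+1 := t%:num *: v1 + (1 - t%:num) *: v2.
  exists v; split; first by apply: convex_setE => //; rewrite ge0 le1.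
    rewrite (_ : v - m = t%:num *: (v1 - m) + (1 - t%:num) *: (v2 - m)).
      by rewrite dotDr !dotZr lv1 lv2; ring.
    by apply/rowP => j; rewrite !mxE; ring.
  by apply/rowP => j; rewrite !mxE.
have [] := IH O' w' (fun x => \row_j f x ord0 (lift j0 j)) cO' w'0 iw' w'1.
- by move=> i; under eq_fun do rewrite /= mxE; exact: mf.
- move=> x; rewrite /w'; case: ifP => [/eqP wh wx|]; last by rewrite ltxx.
  exists (f x); split => //; first exact: wO.
  by apply/eqP; move/eqP: wh; rewrite mulf_eq0 gt_eqF.
(* [m] and [v] agree in the coordinates other than [j0]; the equation of the
   hyperplane then determines the coordinate [j0] *)
move=> v [Ov lv vE]; apply: nOm; rewrite (_ : m = v) //.
have coordE j : m ord0 (lift j0 j) = v ord0 (lift j0 j).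
  have /rowP/(_ j) := vE; rewrite !mxE => <-; rewrite -ae_w' //.
  by apply: eq_Rintegral => x _; rewrite mxE.
apply/rowP => j; case: (unliftP j0 j) => [j' -> //|->].
move: lv; rewrite /dot (bigD1 j0) //= big1 ?addr0.
  by move/eqP; rewrite mulf_eq0 (negbTE lj0) /= mxE [(- m) _ _]mxE subr_eq0 => /eqP.
move=> i; case: (unliftP j0 i) => [j' -> _|->]; last by rewrite eqxx.
by rewrite mxE [(- m) _ _]mxE coordE subrr mulr0.
Qed.

(** * Convolution with a compactly supported kernel *)

Section is_derive_extra.
Context {R : realType} {V : normedModType R}.
Implicit Types f g : V -> R.

Lemma is_derive_mulR f g x v a b : is_derive x v f a -> is_derive x v g b ->
  is_derive x v (fun y => f y * g y) (f x * b + g x * a).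
Proof. by move=> fa gb; exact: (is_deriveM fa gb). Qed.

Lemma is_derive_addR f g x v a b : is_derive x v f a -> is_derive x v g b ->
  is_derive x v (fun y => f y + g y) (a + b).
Proof. by move=> fa gb; exact: (is_deriveD fa gb). Qed.

Lemma is_derive_subR f g x v a b : is_derive x v f a -> is_derive x v g b ->
  is_derive x v (fun y => f y - g y) (a - b).
Proof. by move=> fa gb; exact: (is_deriveB fa gb). Qed.

Lemma is_derive_sumR (I : Type) (s : seq I) (h : I -> V -> R) x v (d : I -> R) :
  (forall i, is_derive x v (h i) (d i)) ->
  is_derive x v (fun y => \sum_(i <- s) h i y) (\sum_(i <- s) d i).
Proof.
move=> hd; elim: s => [|i s IH].
  rewrite big_nil (_ : (fun y => _) = cst 0); first exact: is_derive_cst.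
  by apply/funext => y; rewrite big_nil.
rewrite big_cons (_ : (fun y => _) = fun y => h i y + \sum_(j <- s) h j y).
  exact: is_derive_addR.
by apply/funext => y; rewrite big_cons.
Qed.

(** A quadratic remainder is a convenient sufficient condition here: it is
    stable under integration against a kernel. *)
Lemma is_derive_quadratic f x v d L :
  (forall t, `|t| <= 1 -> `|f (t *: v + x) - f x - t * d| <= L * t ^+ 2) ->
  is_derive x v f d.
Proof.
move=> fq.
have L0 : 0 <= L.
  have := fq 1; rewrite normr1 lexx expr1n mulr1 => /(_ isT); exact: le_trans.
have main : (fun h : R => h^-1 *: ((f \o shift x) (h *: v) - f x)) @ 0^' --> d.
  apply/cvgrPdist_lt => e e0.
  have r0 : 0 < Num.min 1 (e / (L + 1)) by rewrite lt_min ltr01 divr_gt0 // ltr_wpDl.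
  have : \forall h \near (0 : R), `|h| < Num.min 1 (e / (L + 1)).
    have := nbhsx_ballx (0 : R) _ r0; apply: filterS => h.
    by rewrite /ball /= sub0r normrN.
  move=> hs; have h0 : \forall h \near 0^', h != 0 :> R by exact: nbhs_dnbhs_neq.
  apply: filterS2 h0 (nbhs_dnbhs hs) => h hn0; rewrite lt_min => /andP[h1 he].
  rewrite /= distrC (_ : _ - d = h^-1 * (f (h *: v + x) - f x - h * d)); last first.
    by rewrite mulrBr mulKf.
  have nh : 0 < `|h| by rewrite normr_gt0.
  rewrite normrM normfV -(ltr_pM2l nh) mulVKf ?gt_eqF //.
  apply: le_lt_trans (fq h (ltW h1)) _.
  rewrite -(real_normK (num_real h)) expr2 mulrCA ltr_pM2l //.
  apply: (@le_lt_trans _ _ ((L + 1) * `|h|)); first by rewrite ler_wpM2r // lerDl.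
  by rewrite mulrC -ltr_pdivlMr // ltr_wpDl.
by apply: DeriveDef; [apply/cvg_ex; eexists; exact: main | exact: cvg_lim main].
Qed.

End is_derive_extra.

Section mollify.
Context {R : realType} {m : nat}.
Notation mu := (lebesgue_rV R m).
Notation cube r := [set x : 'rV[R]_m | `|x| <= r].
Notation integrableR f := (mu.-integrable setT (EFin \o f)).
Implicit Types (f g k : 'rV[R]_m -> R).

(** As [`|x|] is the largest coordinate in absolute value, the sets on which
    integrability is required are cubes. *)
Definition loc_integrable f :=
  measurable_fun setT f /\ forall r, mu.-integrable (cube r) (EFin \o f).

(** Convolution of [f] with the reflection of [k], which is [k] itself when
    [k] is even. *)
Definition mollify k f (y : 'rV[R]_m) : R := \int[mu]_x (k (x - y) * f x).

Definition mass f r : R := \int[mu]_(x in cube r) `|f x|.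

Lemma loc_integrable_cst c : loc_integrable (cst c).
Proof.
split=> [|r]; first exact: measurable_cst.
apply: measurable_bounded_integrable; [exact: measurable_closed_cube| | |].
- by apply: (@lebesgue_bounded _ _ _ r); first exact: measurable_closed_cube.
- exact: measurable_cst.
- by exists `|c|; split; rewrite ?num_real // => M cM x _ /=; rewrite ltW.
Qed.

Lemma loc_integrableD f g : loc_integrable f -> loc_integrable g ->
  loc_integrable (fun x => f x + g x).
Proof.
move=> [mf fi] [mg gi]; split; first exact: measurable_funD.
by move=> r; exact: (integrableD (measurable_closed_cube r) (fi r) (gi r)).
Qed.

Lemma loc_integrableZ c f : loc_integrable f -> loc_integrable (fun x => c * f x).
Proof.
move=> [mf fi]; split; first exact: measurable_funM.
by move=> r; exact: (integrableZl (measurable_closed_cube r) c (fi r)).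
Qed.

Lemma le_loc_integrable f g : measurable_fun setT f -> (forall x, `|f x| <= g x) ->
  loc_integrable g -> loc_integrable f.
Proof.
move=> mf fg [mg gi]; split=> // r.
apply: (le_integrable (measurable_closed_cube r) _ _ (gi r)) => [|x _ /=].
  by apply/measurable_EFinP; apply: measurable_funTS.
by rewrite lee_fin (le_trans (fg x)) // ler_norm.
Qed.

(** The integrand is dominated by [M |f|] on a cube containing the translate
    of the support of [k]. *)
Lemma integrable_kernel k f r M y : continuous k -> (forall z, `|k z| <= M) ->
  (forall z, r < `|z| -> k z = 0) -> loc_integrable f ->
  integrableR (fun x => k (x - y) * f x).
Proof.
move=> ck kM k0 [mf fi].
have cky : continuous (fun x : 'rV[R]_m => k (x - y)).
  move=> x; apply: continuous_comp; last exact: ck.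
  by apply: continuousB; [exact: cvg_id | exact: cst_continuous].
have /integrable_norm fn := fi (r + `|y|).
move/(integrable_mkcond _ (measurable_closed_cube (r + `|y|))) : fn => fn.
apply: (@le_integrableR _ _ _ _ _ (fun x => M * ((Num.norm \o f) \_ (cube (r + `|y|))) x)).
- by apply: measurable_funM => //; exact: continuous_measurable_rV.
- move=> x; rewrite normrM /patch; case: ifPn => [_|].
    by rewrite ler_pM.
  rewrite notin_setE /= => /negP; rewrite -ltNge => rx.
  have : `|x| <= `|x - y| + `|y| by rewrite -[X in `|X| <= _](subrK y) ler_normD.
  by move=> tri; rewrite k0 ?normr0 ?mul0r ?mulr0 //; lra.
- apply: integrableRZ; move: fn; rewrite -restrict_EFin.
  by congr (mu.-integrable _ _); apply/funext => x; rewrite /patch; case: ifP.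
Qed.

Lemma mollify_le k f r M y rho : continuous k -> (forall z, `|k z| <= M) ->
  (forall z, r < `|z| -> k z = 0) -> loc_integrable f -> r + `|y| <= rho ->
  `|mollify k f y| <= M * mass f rho.
Proof.
move=> ck kM k0 lf rho_ge.
have ik := integrable_kernel y ck kM k0 lf.
have M0 : 0 <= M by exact: le_trans (normr_ge0 _) (kM 0).
apply: le_trans (le_normr_Rintegral measurableT ik) _.
have /integrable_norm fn := lf.2 rho.
have fnT := fn; move/(integrable_mkcond _ (measurable_closed_cube rho)) : fnT.
rewrite restrict_EFin => fnT.
rewrite /mass [X in _ * X]Rintegral_mkcond -RintegralZl //.
apply: (@le_Rintegral _ _ _ mu setT (fun x => `|k (x - y) * f x|)
  (fun x => M * ((Num.norm \o f) \_ (cube rho)) x)) => //.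
- exact: integrable_norm ik.
- exact: integrableRZ.
- move=> x _; rewrite normrM /patch; case: ifPn => [_|]; first by rewrite ler_pM.
  rewrite notin_setE /= => /negP; rewrite -ltNge => rx.
  have : `|x| <= `|x - y| + `|y| by rewrite -[X in `|X| <= _](subrK y) ler_normD.
  by move=> tri; rewrite k0 ?normr0 ?mul0r ?mulr0 //; lra.
Qed.

Lemma mollify_shift k f y h :
  mollify k f (h + y) = mollify (fun z => k (z - h)) f y.
Proof. by apply: eq_Rintegral => x _; rewrite opprD addrA addrAC. Qed.

Lemma mollifyB k1 k2 f r M y : continuous k1 -> continuous k2 ->
  (forall z, `|k1 z| <= M) -> (forall z, `|k2 z| <= M) ->
  (forall z, r < `|z| -> k1 z = 0) -> (forall z, r < `|z| -> k2 z = 0) ->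
  loc_integrable f ->
  mollify (fun z => k1 z - k2 z) f y = mollify k1 f y - mollify k2 f y.
Proof.
move=> c1 c2 kM1 kM2 k01 k02 lf; rewrite /mollify -RintegralB //.
- by apply: eq_Rintegral => x _; rewrite mulrBl.
- exact: (integrable_kernel y c1 kM1 k01 lf).
- exact: (integrable_kernel y c2 kM2 k02 lf).
Qed.

Lemma mollifyZ c k f r M y : continuous k ->
  (forall z, `|k z| <= M) -> (forall z, r < `|z| -> k z = 0) -> loc_integrable f ->
  mollify (fun z => c * k z) f y = c * mollify k f y.
Proof.
move=> ck kM k0 lf; rewrite /mollify -RintegralZl //.
- by apply: eq_Rintegral => x _; rewrite mulrA.
- exact: (integrable_kernel y ck kM k0 lf).
Qed.

Lemma shift_kernel k r M h : continuous k -> (forall z, `|k z| <= M) ->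
  (forall z, r < `|z| -> k z = 0) -> `|h| <= 1 ->
  [/\ continuous (fun z => k (z - h)), (forall z, `|k (z - h)| <= M) &
      forall z, r + 1 < `|z| -> k (z - h) = 0].
Proof.
move=> ck kM k0 h1; split=> // [z|z rz].
  apply: continuous_comp; last exact: ck.
  by apply: continuousB; [exact: cvg_id | exact: cst_continuous].
apply: k0; have : `|z| <= `|z - h| + `|h| by rewrite -[X in `|X| <= _](subrK h) ler_normD.
lra.
Qed.

(** Moving [y] by [h] amounts to translating the kernel, and a Lipschitz
    kernel moves by [O(|h|)] uniformly, with support in a slightly larger
    cube. *)
Lemma continuous_mollify k f r M L : continuous k -> (forall z, `|k z| <= M) ->
  (forall z, r < `|z| -> k z = 0) ->
  (forall z h, `|h| <= 1 -> `|k (z - h) - k z| <= L * `|h|) ->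
  loc_integrable f -> continuous (mollify k f).
Proof.
move=> ck kM k0 kL lf y.
pose rho := r + 1 + `|y|; pose J := mass f rho.
have J0 : 0 <= J by apply: Rintegral_ge0.
have L0 : 0 <= `|L| by [].
apply/(@cvgrPdist_lt _ _ _ (nbhs y)) => e e0.
have r0 : 0 < Num.min 1 (e / (`|L| * J + 1)).
  by rewrite lt_min ltr01 divr_gt0 // ltr_wpDl // mulr_ge0.
have := nbhsx_ballx y _ r0; apply: filterS => x.
rewrite mx_norm_ball /ball_ /= distrC lt_min => /andP[h1 he].
set h := x - y in h1 he; have -> : x = h + y by rewrite subrK.
have [ckh khM kh0] := shift_kernel ck kM k0 (ltW h1).
have k0' z : r + 1 < `|z| -> k z = 0 by move=> rz; apply: k0; lra.
rewrite distrC mollify_shift -(@mollifyB _ _ _ (r + 1) M) //.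
apply: (@le_lt_trans _ _ (`|L| * `|h| * J)).
  apply: (@mollify_le _ _ (r + 1)) => //.
  - exact: continuousRB.
  - move=> z; apply: le_trans (kL z h (ltW h1)) _.
    by rewrite ler_wpM2r // ler_norm.
  - by move=> z rz; rewrite kh0 // k0' // subrr.
rewrite mulrAC mulrC; apply: (@le_lt_trans _ _ (`|h| * (`|L| * J + 1))).
  by rewrite ler_wpM2l // lerDl.
by rewrite -ltr_pdivlMr // ltr_wpDl // mulr_ge0.
Qed.

(** Since the kernel is evaluated at [x - y], the derivative in [y] carries a
    minus sign.  The quadratic Taylor remainder of the kernel integrates to a
    quadratic remainder of the convolution. *)
Lemma is_derive_mollify k k' f r M L v y : continuous k -> continuous k' ->
  (forall z, `|k z| <= M) -> (forall z, `|k' z| <= M) ->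
  (forall z, r < `|z| -> k z = 0) -> (forall z, r < `|z| -> k' z = 0) ->
  `|v| <= 1 ->
  (forall z t, `|t| <= 1 -> `|k (z - t *: v) - k z + t * k' z| <= L * t ^+ 2) ->
  loc_integrable f ->
  is_derive y v (mollify k f) (- mollify k' f y).
Proof.
move=> ck ck' kM kM' k0 k0' v1 kL lf.
apply: (@is_derive_quadratic _ _ _ _ _ _ (L * mass f (r + 1 + `|y|))) => t t1.
have tv : `|t *: v| <= 1.
  by rewrite normrZ mulr_ile1.
have [ckh khM kh0] := shift_kernel ck kM k0 tv.
have k01 z : r + 1 < `|z| -> k z = 0 by move=> rz; apply: k0; lra.
have k01' z : r + 1 < `|z| -> k' z = 0 by move=> rz; apply: k0'; lra.
have M0 : 0 <= M by exact: le_trans (normr_ge0 _) (kM 0).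
rewrite mollify_shift -(@mollifyB _ _ _ (r + 1) M) //.
have ctk : continuous (fun z => (- t) * k' z).
  exact: continuousRZ.
rewrite mulrN -mulNr -(@mollifyZ _ _ _ (r + 1) M) //.
rewrite -(@mollifyB _ _ _ (r + 1) (M + M)) //; first last.
- by move=> z rz; rewrite k01' // mulr0.
- by move=> z rz; rewrite kh0 // k01 // subrr.
- move=> z; rewrite normrM normrN; apply: (@le_trans _ _ (1 * M)); last by rewrite mul1r lerDl.
  by rewrite ler_pM.
- by move=> z; rewrite (le_trans (ler_normB _ _)) // lerD.
- exact: continuousRB.
rewrite mulrAC; apply: (@mollify_le _ _ (r + 1)) => //.
- by apply: continuousRB => //; exact: continuousRB.
- by move=> z; rewrite mulNr opprK; exact: kL.
- by move=> z rz; rewrite kh0 // k01 // k01' // mulr0 !subrr.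
Qed.

End mollify.

(** * A bump function of class C1 *)

Section positive_part.
Context {R : realType}.
Implicit Types s d : R.

Lemma max0_lipschitz s d : `|Num.max 0 s - Num.max 0 d| <= `|s - d|.
Proof.
have A := ler_norm (s - d); have B := ler_norm (d - s); rewrite distrC in B.
by rewrite !maxElt ler_norml; case: (ltP 0 s) => ?; case: (ltP 0 d) => ?; lra.
Qed.

(** The square of the positive part has derivative [2 max(0, s)], which is
    Lipschitz; hence a quadratic remainder. *)
Lemma max0_sqr_taylor s d :
  `|Num.max 0 (s + d) ^+ 2 - Num.max 0 s ^+ 2 - 2 * Num.max 0 s * d| <= d ^+ 2.
Proof.
rewrite !maxElt; case: (ltP 0 (s + d)) => sd; case: (ltP 0 s) => s0;
  rewrite ler_norml; apply/andP; split; nra.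
Qed.

Lemma continuous_max0 : continuous (fun s : R => Num.max 0 s).
Proof.
move=> s; apply/cvgrPdist_lt => e e0.
have := nbhsx_ballx s _ e0; apply: filterS => t.
by rewrite /ball /=; apply: le_lt_trans; exact: max0_lipschitz.
Qed.

Lemma differentiable_max0_sqr s : differentiable (fun s : R => Num.max 0 s ^+ 2) s.
Proof.
apply/derivable1_diffP.
have [//] : is_derive s 1 (fun s : R => Num.max 0 s ^+ 2) (2 * Num.max 0 s).
apply: (@is_derive_quadratic _ _ _ _ _ _ 1) => t _.
have -> : t *: 1 + s = s + t by rewrite addrC [t *: 1]mulr1.
by rewrite mul1r [t * _]mulrC; exact: max0_sqr_taylor.
Qed.

End positive_part.

Section bump.
Context {R : realType} {m : nat}.
Implicit Types (z h v : 'rV[R]_m) (e t : R).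

(** An even kernel of class C1 supported in the Euclidean ball of radius [e]:
    the square of the positive part of [e^2 - |z|^2].  Its derivative along [v]
    is [dbump e v]. *)
Definition cap e z : R := Num.max 0 (e ^+ 2 - dot z z).
Definition bump e z : R := cap e z ^+ 2.
Definition dbump e v z : R := - 4 * dot z v * cap e z.

Lemma sqr_coord_le_dot z i : z ord0 i ^+ 2 <= dot z z.
Proof.
rewrite /dot (bigD1 i) //= expr2 lerDl; apply: sumr_ge0 => j _.
by rewrite -expr2 sqr_ge0.
Qed.

Lemma enormE z : enorm z = Num.sqrt (dot z z).
Proof. by rewrite /enorm big_ord1; congr Num.sqrt; apply: eq_bigr => i _; rewrite expr2. Qed.

Lemma normr_le_enorm z : `|z| <= enorm z.
Proof.
apply: normr_rV_le => [|i]; first by rewrite enormE sqrtr_ge0.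
by rewrite enormE -sqrtr_sqr ler_sqrt ?dotvv_ge0 // sqr_coord_le_dot.
Qed.

Lemma enorm_le_normr z : enorm z <= m%:R * `|z|.
Proof.
rewrite enormE -(@ger0_norm _ (m%:R * `|z|)); last by rewrite mulr_ge0.
rewrite -sqrtr_sqr ler_sqrt ?sqr_ge0 //.
apply: (@le_trans _ _ (\sum_(i < m) `|z| ^+ 2)).
  apply: ler_sum => i _; rewrite -expr2 -(real_normK (num_real (z ord0 i))).
  by rewrite lerXn2r ?nnegrE // normr_coord_le.
rewrite sumr_const card_ord -[_ ^+ 2 *+ _]mulr_natl exprMn ler_wpM2r ?sqr_ge0 //.
by rewrite -natrX ler_nat; case: (m) => // k; rewrite -mulnn leq_pmulr.
Qed.

Lemma cap_ge0 e z : 0 <= cap e z. Proof. by rewrite /cap le_max lexx. Qed.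

Lemma cap_le e z : cap e z <= e ^+ 2.
Proof. by rewrite /cap ge_max sqr_ge0 lerBlDr lerDl dotvv_ge0. Qed.

Lemma cap_gt0 e z : 0 < e -> (0 < cap e z) = (enorm z < e).
Proof.
move=> e0; rewrite /cap lt_max ltxx /= subr_gt0 enormE.
rewrite -[in RHS](ger0_norm (ltW e0)) -sqrtr_sqr ltr_sqrt // exprn_gt0 //.
Qed.

Lemma cap_eq0 e z : 0 < e -> e <= `|z| -> cap e z = 0.
Proof.
move=> e0 ez; apply/eqP; rewrite eq_le cap_ge0 andbT leNgt cap_gt0 // -leNgt.
exact: le_trans ez (normr_le_enorm z).
Qed.

Lemma normr_dot_le z v : `|dot z v| <= m%:R * (`|z| * `|v|).
Proof. by apply: sum_coord_le => l; exact: normr_coord_le. Qed.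

Lemma continuous_cap e : continuous (cap e).
Proof.
have c : continuous (fun z => e ^+ 2 - dot z z).
  apply: continuousRB; first exact: cst_continuous.
  apply: continuous_sumR => i _; apply: continuousRM; exact: coord_continuous.
by move=> z; apply: (continuous_comp (c z)); exact: continuous_max0.
Qed.

Lemma continuous_bump e : continuous (bump e).
Proof. by apply: continuousRM; exact: continuous_cap. Qed.

Lemma continuous_dbump e v : continuous (dbump e v).
Proof.
apply: continuousRM; last exact: continuous_cap.
apply: continuousRZ; exact: continuous_dot.
Qed.

Lemma bump_ge0 e z : 0 <= bump e z. Proof. exact: sqr_ge0. Qed.

Lemma bump_le e z : `|bump e z| <= e ^+ 4.
Proof.
rewrite ger0_norm ?bump_ge0 // /bump (exprM _ 2 2).
by rewrite lerXn2r ?nnegrE ?cap_ge0 ?sqr_ge0 // cap_le.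
Qed.

Lemma bump_eq0 e z : 0 < e -> e < `|z| -> bump e z = 0.
Proof. by move=> e0 /ltW ez; rewrite /bump cap_eq0 // expr0n. Qed.

Lemma dbump_eq0 e v z : 0 < e -> e < `|z| -> dbump e v z = 0.
Proof. by move=> e0 /ltW ez; rewrite /dbump cap_eq0 // mulr0. Qed.

Lemma dbump_le e v z : 0 < e -> `|v| <= 1 -> `|dbump e v z| <= 4 * m%:R * e ^+ 3.
Proof.
move=> e0 v1; have [ez|ze] := leP e `|z|.
  by have e0' := ltW e0; rewrite /dbump cap_eq0 // mulr0 normr0 !mulr_ge0.
rewrite /dbump !normrM normrN normr_nat (ger0_norm (cap_ge0 _ _)).
have dz : `|dot z v| <= m%:R * e.
  apply: le_trans (normr_dot_le z v) _; rewrite ler_wpM2l //.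
  by rewrite -[leRHS]mulr1 ler_pM // ltW.
rewrite [leRHS](_ : _ = 4 * (m%:R * e) * e ^+ 2); last by ring.
by rewrite ler_pM ?cap_ge0 ?cap_le // ?mulr_ge0 // ler_wpM2l.
Qed.

Lemma dotB z h : dot (z - h) (z - h) = dot z z - \sum_i h ord0 i * (2 * z ord0 i - h ord0 i).
Proof.
rewrite /dot -sumrB; apply: eq_bigr => i _; rewrite !mxE; ring.
Qed.

Lemma cap_lipschitz e z h r : `|z| <= r -> `|h| <= 1 ->
  `|cap e (z - h) - cap e z| <= m%:R * (`|h| * (2 * r + 1)).
Proof.
move=> zr h1; apply: le_trans (max0_lipschitz _ _) _.
rewrite (_ : _ - _ = \sum_i h ord0 i * (2 * z ord0 i - h ord0 i)); last first.
  by rewrite dotB; lra.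
apply: sum_coord_le => i; rewrite (le_trans (ler_normB _ _)) // lerD //.
  by rewrite normrM normr_nat ler_wpM2l // (le_trans (normr_coord_le _ _)).
exact: le_trans (normr_coord_le _ _) h1.
Qed.

Lemma far_cap0 e z h : 0 < e -> e + 1 < `|z| -> `|h| <= 1 -> cap e (z - h) = 0.
Proof.
move=> e0 ez h1; apply: cap_eq0 => //.
have : `|z| <= `|z - h| + `|h| by rewrite -[X in `|X| <= _](subrK h) ler_normD.
lra.
Qed.

Lemma bump_lipschitz e z h : 0 < e -> `|h| <= 1 ->
  `|bump e (z - h) - bump e z| <= 2 * e ^+ 2 * (m%:R * (2 * (e + 1) + 1)) * `|h|.
Proof.
move=> e0 h1; have [zr|rz] := leP `|z| (e + 1); last first.
  rewrite /bump far_cap0 // cap_eq0 //; last lra.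
  rewrite subrr normr0 !mulr_ge0 ?exprn_ge0 //; lra.
rewrite /bump subr_sqr mulrC normrM -!mulrA; rewrite [X in _ <= _ * X]mulrA.
have cl := cap_lipschitz e zr h1.
rewrite [leRHS](_ : _ = (2 * e ^+ 2) * (m%:R * (`|h| * (2 * (e + 1) + 1)))); last by ring.
rewrite ler_pM //.
rewrite ger0_norm ?addr_ge0 ?cap_ge0 //.
have := cap_le e z; have := cap_le e (z - h); lra.
Qed.

Lemma dbump_lipschitz e v z h : 0 < e -> `|v| <= 1 -> `|h| <= 1 ->
  `|dbump e v (z - h) - dbump e v z| <=
    4 * (m%:R * ((e + 1) * (m%:R * (2 * (e + 1) + 1)) + e ^+ 2)) * `|h|.
Proof.
move=> e0 v1 h1; have [zr|rz] := leP `|z| (e + 1); last first.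
  rewrite /dbump far_cap0 // cap_eq0 //; last lra.
  rewrite !mulr0 subrr normr0 !mulr_ge0 // ?addr_ge0 ?mulr_ge0 ?exprn_ge0 //; lra.
rewrite /dbump.
have -> : dot (z - h) v = dot z v - dot h v.
  by rewrite /dot -sumrB; apply: eq_bigr => i _; rewrite !mxE mulrBl.
rewrite [X in `|X|](_ : _ = - 4 * (dot z v * (cap e (z - h) - cap e z) - dot h v * cap e (z - h))); last by ring.
rewrite normrM normrN normr_nat -!mulrA ler_wpM2l //.
apply: le_trans (ler_normB _ _) _; rewrite !normrM.
have cl := cap_lipschitz e zr h1.
have dz : `|dot z v| <= m%:R * (e + 1).
  apply: le_trans (normr_dot_le z v) _; rewrite ler_wpM2l //.
  by rewrite -[leRHS]mulr1 ler_pM.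
have dh : `|dot h v| <= m%:R * `|h|.
  apply: le_trans (normr_dot_le h v) _; rewrite ler_wpM2l //.
  by rewrite -[leRHS]mulr1 ler_pM.
have ce : `|cap e (z - h)| <= e ^+ 2 by rewrite ger0_norm ?cap_ge0 // cap_le.
apply: (@le_trans _ _ ((m%:R * (e + 1)) * (m%:R * (`|h| * (2 * (e + 1) + 1))) + (m%:R * `|h|) * e ^+ 2)).
  by apply: lerD; apply: ler_pM.
by rewrite le_eqVlt; apply/orP; left; apply/eqP; ring.
Qed.

(** Along a line the argument [e^2 - |z|^2] of the positive part is a
    quadratic polynomial in [t]; its increment [d] is [O(|t|)] for [z] near the
    support, and [max0_sqr_taylor] applies.  Away from the support all the
    terms vanish. *)
Lemma bump_taylor e v z t : 0 < e -> `|v| <= 1 -> `|t| <= 1 ->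
  `|bump e (z - t *: v) - bump e z + t * dbump e v z| <=
    (m%:R ^+ 2 * (2 * (e + 1) + 1) ^+ 2 + 2 * m%:R * e ^+ 2) * t ^+ 2.
Proof.
move=> e0 v1 t1; have tv : `|t *: v| <= 1 by rewrite normrZ mulr_ile1.
have [zr|rz] := leP `|z| (e + 1); last first.
  rewrite /bump /dbump far_cap0 // cap_eq0 //; last lra.
  rewrite !mulr0 expr0n /= subrr addr0 normr0 mulr_ge0 ?sqr_ge0 // addr_ge0 //.
    by rewrite mulr_ge0 // sqr_ge0.
  by have e0' := ltW e0; rewrite !mulr_ge0.
pose d := 2 * t * dot z v - t ^+ 2 * dot v v.
have capE : cap e (z - t *: v) = Num.max 0 (e ^+ 2 - dot z z + d).
  rewrite /cap -scaleNr dot_line /d; congr (Num.max _ _); ring.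
have vv : dot v v <= m%:R.
  rewrite -[leLHS]ger0_norm ?dotvv_ge0 // (le_trans (normr_dot_le v v)) //.
  by rewrite -[leRHS]mulr1 ler_wpM2l // mulr_ile1.
have dd : `|d| <= `|t| * (m%:R * (2 * (e + 1) + 1)).
  rewrite (_ : d = t * (2 * dot z v - t * dot v v)); last by rewrite /d; ring.
  rewrite normrM ler_wpM2l // (le_trans (ler_normB _ _)) // mulrDr mulr1 lerD //.
    rewrite normrM normr_nat mulrCA ler_wpM2l //.
    apply: le_trans (normr_dot_le z v) _; rewrite ler_wpM2l //.
    by rewrite -[leRHS]mulr1 ler_pM.
  by rewrite normrM -[leRHS]mul1r ler_pM // ger0_norm // dotvv_ge0.
have := max0_sqr_taylor (e ^+ 2 - dot z z) d; rewrite -capE -/(cap e z) => T.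
rewrite /bump /dbump.
rewrite [X in `|X|](_ : _ = (cap e (z - t *: v) ^+ 2 - cap e z ^+ 2 - 2 * cap e z * d)
  - 2 * (t ^+ 2 * dot v v) * cap e z); last by rewrite /d; ring.
apply: le_trans (ler_normB _ _) _; rewrite [leRHS]mulrDl; apply: lerD.
  apply: le_trans T _; rewrite -(real_normK (num_real d)) -(real_normK (num_real t)).
  rewrite -!exprMn lerXn2r ?nnegrE ?mulr_ge0 //; last by rewrite mulrC.
  lra.
have tv0 : 0 <= 2 * (t ^+ 2 * dot v v).
  exact: (mulr_ge0 (ler0n _ 2) (mulr_ge0 (sqr_ge0 t) (dotvv_ge0 v))).
rewrite ger0_norm; last exact: (mulr_ge0 tv0 (cap_ge0 e z)).
rewrite [leRHS](_ : _ = 2 * (t ^+ 2 * m%:R) * e ^+ 2); last by ring.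
apply: ler_pM => //; [exact: cap_ge0 | | exact: cap_le].
by rewrite ler_wpM2l // ler_wpM2l // sqr_ge0.
Qed.

End bump.

(** * Local averages *)

Section smoothing.
Context {R : realType} {k : nat}.
Notation m := k.+1.
Notation mu := (lebesgue_rV R m).
Notation integrableR f := (mu.-integrable setT (EFin \o f)).
Implicit Types (f g : 'rV[R]_m -> R) (y : 'rV[R]_m) (e : R) (j : 'I_m).

Definition unit_vec j : 'rV[R]_m := delta_mx ord0 j.

Lemma normr_unit_vec j : `|unit_vec j| <= 1.
Proof.
by apply: normr_rV_le => // i; rewrite mxE; case: (_ && _); rewrite ?normr1 ?normr0.
Qed.

Lemma continuous_shift (h : 'rV[R]_m -> R) y : continuous h ->
  continuous (fun x : 'rV[R]_m => h (x - y)).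
Proof.
move=> ch x; apply: continuous_comp; last exact: ch.
by apply: continuousB; [exact: cvg_id | exact: cst_continuous].
Qed.

Lemma open_eball y e : 0 < e -> open (eball y e).
Proof.
move=> e0; rewrite (_ : eball y e = (fun x => cap e (x - y)) @^-1` [set t | 0 < t]).
  apply: open_comp; last exact: open_gt.
  by move=> x _; exact: (@continuous_shift (cap e) y (@continuous_cap _ _ e)).
by apply/seteqP; split => x /=; rewrite cap_gt0.
Qed.

Lemma measurable_eball y e : 0 < e -> measurable (eball y e).
Proof. by move=> e0; apply: open_measurable_rV; exact: open_eball. Qed.

Lemma eball_sub_cube y e x : eball y e x -> `|x - y| < e.
Proof. by apply: le_lt_trans; exact: normr_le_enorm. Qed.

Lemma lebesgue_eball_le y e : 0 < e -> (mu (eball y e) <= ((2 * e) ^+ m)%:E)%E.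
Proof.
move=> e0; rewrite -(lebesgue_open_cube y (ltW e0)); apply: le_measure.
- by rewrite inE; exact: measurable_eball.
- by rewrite inE; exact: measurable_open_cube.
- move=> x /eball_sub_cube xy i; apply: le_lt_trans xy.
  by have := normr_coord_le (x - y) i; rewrite !mxE.
Qed.

Lemma loc_integrable_eball f y e : 0 < e -> loc_integrable f ->
  mu.-integrable (eball y e) (EFin \o f).
Proof.
move=> e0 [mf fi]; apply: integrableS (fi (`|y| + e)).
- exact: measurable_closed_cube.
- exact: measurable_eball.
- move=> x /eball_sub_cube xy /=.
  by rewrite -[X in `|X|](subrK y) addrC (le_trans (ler_normD _ _)) // lerD // ltW.
Qed.

(** Dividing by the mass of the kernel at each point makes smoothing exact on
    constants; that this mass is constant enters only through its derivative,
    in [dbump_mass]. *)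
Definition bump_mass e y : R := mollify (bump e) (cst 1) y.

Definition smooth e f y : R := (bump_mass e y)^-1 * mollify (bump e) f y.

(** The [j]-th partial derivative of [smooth e f]. *)
Definition dsmooth e j f y : R :=
  - ((bump_mass e y)^-1 * mollify (dbump e (unit_vec j)) f y).

(** The mean of [`|f|] over the ball up to a dimensional factor: the power
    [e ^ m] replaces the volume of the ball. *)
Definition avg e f y : R := (e ^+ m)^-1 * \int[mu]_(x in eball y e) `|f x|.

Lemma bump_integrable e f y : 0 < e -> loc_integrable f ->
  integrableR (fun x => bump e (x - y) * f x).
Proof.
move=> e0 lf; apply: (@integrable_kernel _ _ _ _ e (e ^+ 4)) => //.
- exact: continuous_bump.
- exact: bump_le.
- by move=> z; exact: bump_eq0.
Qed.

Lemma dbump_integrable e f y j : 0 < e -> loc_integrable f ->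
  integrableR (fun x => dbump e (unit_vec j) (x - y) * f x).
Proof.
move=> e0 lf; apply: (@integrable_kernel _ _ _ _ e (4 * m%:R * e ^+ 3)) => //.
- exact: continuous_dbump.
- by move=> z; apply: dbump_le => //; exact: normr_unit_vec.
- by move=> z; exact: dbump_eq0.
Qed.

(** On the cube of half-side [e / (2 m)] the squared Euclidean norm is at most
    [e^2 / 4], so that [bump e >= (3 e^2 / 4)^2]; the cube has volume
    [(e / m)^m]. *)
Lemma bump_mass_ge e y : 0 < e ->
  9 / 16 * e ^+ 4 * (e / m%:R) ^+ m <= bump_mass e y.
Proof.
move=> e0; pose r := e / (2 * m%:R).
have m0 : 0 < m%:R :> R by rewrite ltr0n.
have r0 : 0 < r by rewrite divr_gt0 // mulr_gt0.
have -> : (e / m%:R) ^+ m = fine (mu (open_cube y r)).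
  rewrite lebesgue_open_cube ?ltW //=; congr (_ ^+ _).
  by rewrite /r; field; rewrite lt0r_neq0.
rewrite -Rintegral_cst; last exact: measurable_open_cube.
rewrite Rintegral_mkcond; apply: le_Rintegral => //.
- rewrite -restrict_EFin.
  apply/(integrable_mkcond _ (measurable_open_cube y r)).
  apply: measurable_bounded_integrable.
  + exact: measurable_open_cube.
  + by rewrite /= lebesgue_open_cube ?ltW // ltry.
  + exact: measurable_cst.
  + exists (9 / 16 * e ^+ 4); split; first exact: num_real.
    move=> M HM x _ /=; rewrite ger0_norm ?ltW //.
    by rewrite mulr_gt0 ?exprn_gt0 // divr_gt0.
- by apply: bump_integrable => //; exact: loc_integrable_cst.
- move=> x _; rewrite mulr1 /patch; case: ifPn => [|_]; last exact: bump_ge0.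
  rewrite inE /= => xr.
  have dz : dot (x - y) (x - y) <= e ^+ 2 / 4.
    apply: (@le_trans _ _ (\sum_(i < m) r ^+ 2)).
      apply: ler_sum => i _; rewrite -expr2 -(real_normK (num_real _)).
      rewrite lerXn2r ?nnegrE // ?ltW //; have := xr i; by rewrite !mxE => /ltW.
    rewrite sumr_const card_ord -[_ ^+ 2 *+ _]mulr_natl /r.
    rewrite (_ : _ * _ = e ^+ 2 / 4 * m%:R^-1); last by field; rewrite lt0r_neq0.
    rewrite -[leRHS]mulr1 ler_wpM2l //; first by rewrite divr_ge0 // sqr_ge0.
    by rewrite invf_le1 // ler1n.
  have : 3 / 4 * e ^+ 2 <= cap e (x - y) by rewrite /cap le_max; apply/orP; right; lra.
  move=> c3; rewrite /bump.
  rewrite (_ : 9 / 16 * e ^+ 4 = (3 / 4 * e ^+ 2) ^+ 2); last by field.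
  by rewrite lerXn2r ?nnegrE ?cap_ge0 // mulr_ge0 ?sqr_ge0 // divr_ge0.
Qed.

Lemma bump_mass_gt0 e y : 0 < e -> 0 < bump_mass e y.
Proof.
move=> e0; apply: lt_le_trans (bump_mass_ge y e0).
have em : 0 < e / m%:R by rewrite divr_gt0 // ltr0n.
by rewrite mulr_gt0 ?exprn_gt0 // mulr_gt0 ?exprn_gt0 // divr_gt0.
Qed.

Lemma is_derive_bump e x j : 0 < e ->
  is_derive x (unit_vec j) (bump e) (dbump e (unit_vec j) x).
Proof.
move=> e0; pose L : R := m%:R ^+ 2 * (2 * (e + 1) + 1) ^+ 2 + 2 * m%:R * e ^+ 2.
apply: (@is_derive_quadratic _ _ _ _ _ _ L) => t t1.
have := @bump_taylor _ _ e (unit_vec j) x (- t) e0 (normr_unit_vec j).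
by rewrite normrN sqrrN scaleNr opprK mulNr [x + _]addrC; exact.
Qed.

(** The kernel is the derivative of a compactly supported function. *)
Lemma dbump_mass e j y : 0 < e -> mollify (dbump e (unit_vec j)) (cst 1) y = 0.
Proof.
move=> e0; rewrite /mollify /Rintegral; under eq_integral => x _ do rewrite mulr1.
rewrite (_ : (\int[mu]_x _)%E = 0%E) //.
apply: (@integral_partial_support _ _ (fun x => bump e (x - y))
  (fun x => dbump e (unit_vec j) (x - y)) j (e + `|y| + 1)).
- exact: (@continuous_shift _ y (@continuous_dbump _ _ e (unit_vec j))).
- move=> x; apply/(@is_derive_affine _ _ _ _ (bump e) (fun x => x - y) x _ (unit_vec j)).
    by move=> h; rewrite addrA.
  exact: is_derive_bump.
- move=> x xe; have : `|x| <= `|x - y| + `|y| by rewrite -[X in `|X| <= _](subrK y) ler_normD.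
  by move=> tri; rewrite bump_eq0 // ?dbump_eq0 //; lra.
Qed.

Lemma is_derive_mollify_bump e f j y : 0 < e -> loc_integrable f ->
  is_derive y (unit_vec j) (mollify (bump e) f) (- mollify (dbump e (unit_vec j)) f y).
Proof.
move=> e0 lf; apply: (@is_derive_mollify _ _ _ _ _ e (Num.max (e ^+ 4) (4 * m%:R * e ^+ 3))
  (m%:R ^+ 2 * (2 * (e + 1) + 1) ^+ 2 + 2 * m%:R * e ^+ 2)) => //.
- exact: continuous_bump.
- exact: continuous_dbump.
- by move=> z; rewrite le_max bump_le.
- by move=> z; rewrite le_max dbump_le ?orbT // normr_unit_vec.
- by move=> z; exact: bump_eq0.
- by move=> z; exact: dbump_eq0.
- exact: normr_unit_vec.
- by move=> z t t1; apply: bump_taylor => //; exact: normr_unit_vec.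
Qed.

Lemma continuous_mollify_bump e f : 0 < e -> loc_integrable f ->
  continuous (mollify (bump e) f).
Proof.
move=> e0 lf; apply: (@continuous_mollify _ _ _ _ e (e ^+ 4)
  (2 * e ^+ 2 * (m%:R * (2 * (e + 1) + 1)))) => //.
- exact: continuous_bump.
- exact: bump_le.
- by move=> z; exact: bump_eq0.
- by move=> z h; exact: bump_lipschitz.
Qed.

Lemma continuous_mollify_dbump e f j : 0 < e -> loc_integrable f ->
  continuous (mollify (dbump e (unit_vec j)) f).
Proof.
move=> e0 lf; apply: (@continuous_mollify _ _ _ _ e (4 * m%:R * e ^+ 3)
  (4 * (m%:R * ((e + 1) * (m%:R * (2 * (e + 1) + 1)) + e ^+ 2)))) => //.
- exact: continuous_dbump.
- by move=> z; apply: dbump_le => //; exact: normr_unit_vec.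
- by move=> z; exact: dbump_eq0.
- by move=> z h; apply: dbump_lipschitz => //; exact: normr_unit_vec.
Qed.

Lemma continuous_bump_massV e : 0 < e -> continuous (fun y => (bump_mass e y)^-1).
Proof.
move=> e0 y; apply: (@cvgV _ _ (nbhs y) _ (bump_mass e)); first by rewrite gt_eqF // bump_mass_gt0.
by apply: continuous_mollify_bump => //; exact: loc_integrable_cst.
Qed.

Lemma continuous_smooth e f : 0 < e -> loc_integrable f -> continuous (smooth e f).
Proof.
by move=> e0 lf; apply: continuousRM; [exact: continuous_bump_massV | exact: continuous_mollify_bump].
Qed.

Lemma continuous_dsmooth e j f : 0 < e -> loc_integrable f -> continuous (dsmooth e j f).
Proof.
move=> e0 lf.
have c : continuous (fun y => (bump_mass e y)^-1 * mollify (dbump e (unit_vec j)) f y).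
  by apply: continuousRM; [exact: continuous_bump_massV | exact: continuous_mollify_dbump].
move=> y; apply: (@cvgN _ _ _ (nbhs y) _
  (fun y => (bump_mass e y)^-1 * mollify (dbump e (unit_vec j)) f y)); exact: c.
Qed.

(** The normalising mass has zero derivative by [dbump_mass], so only the
    numerator is differentiated. *)
Lemma is_derive_smooth e f j y : 0 < e -> loc_integrable f ->
  is_derive y (unit_vec j) (smooth e f) (dsmooth e j f y).
Proof.
move=> e0 lf.
have N0 : bump_mass e y != 0 by rewrite gt_eqF // bump_mass_gt0.
have [dN NE] := is_derive_mollify_bump j y e0 (loc_integrable_cst 1).
rewrite dbump_mass // oppr0 in NE.
have dV : is_derive y (unit_vec j) (fun y => (bump_mass e y)^-1) 0.
  apply: DeriveDef; first exact: derivableV.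
  by rewrite deriveV // NE scaler0.
have := is_derive_mulR dV (is_derive_mollify_bump j y e0 lf).
by rewrite mulr0 addr0 mulrN.
Qed.

Lemma smooth_cst e c y : 0 < e -> smooth e (cst c) y = c.
Proof.
move=> e0; rewrite /smooth (_ : mollify _ _ y = c * bump_mass e y).
  by rewrite mulrCA mulVf ?mulr1 // gt_eqF // bump_mass_gt0.
rewrite /bump_mass /mollify -RintegralZl //.
  by apply: eq_Rintegral => x _; rewrite mulr1 mulrC.
by apply: bump_integrable => //; exact: loc_integrable_cst.
Qed.

Lemma smoothD e f g y : 0 < e -> loc_integrable f -> loc_integrable g ->
  smooth e (fun x => f x + g x) y = smooth e f y + smooth e g y.
Proof.
move=> e0 lf lg; rewrite /smooth /mollify -mulrDr -RintegralD //.
- by congr (_ * _); apply: eq_Rintegral => x _; rewrite mulrDr.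
- exact: bump_integrable.
- exact: bump_integrable.
Qed.

Lemma smoothZ e c f y : 0 < e -> loc_integrable f ->
  smooth e (fun x => c * f x) y = c * smooth e f y.
Proof.
move=> e0 lf; rewrite /smooth /mollify.
have -> : \int[mu]_x (bump e (x - y) * (c * f x)) = c * \int[mu]_x (bump e (x - y) * f x).
  rewrite -RintegralZl //; last exact: bump_integrable.
  by apply: eq_Rintegral => x _; rewrite mulrCA.
by rewrite mulrCA.
Qed.

Lemma dsmoothB_cst e j f c y : 0 < e -> loc_integrable f ->
  dsmooth e j (fun x => f x - c) y = dsmooth e j f y.
Proof.
move=> e0 lf; rewrite /dsmooth; congr (- (_ * _)).
rewrite /mollify; under eq_Rintegral => x _ do rewrite mulrBr.
rewrite RintegralB //; first last.
- exact: (dbump_integrable y j e0 (loc_integrable_cst c)).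
- exact: dbump_integrable.
rewrite (_ : \int[mu]_x (_ * c) = 0) ?subr0 //.
have := dbump_mass j y e0; rewrite /mollify => E.
rewrite RintegralZr //; first by under eq_Rintegral => x _ do rewrite -[dbump _ _ _]mulr1; rewrite E mul0r.
have := dbump_integrable y j e0 (loc_integrable_cst 1).
by apply: eq_integrable => // x _ /=; rewrite mulr1.
Qed.

Lemma kernel_le_eball e k0 f M y : 0 < e -> continuous k0 ->
  (forall z, `|k0 z| <= M) -> (forall z, cap e z = 0 -> k0 z = 0) -> loc_integrable f ->
  `|mollify k0 f y| <= M * \int[mu]_(x in eball y e) `|f x|.
Proof.
move=> e0 ck kM kc lf.
have M0 : 0 <= M by exact: le_trans (normr_ge0 _) (kM 0).
have ik : integrableR (fun x => k0 (x - y) * f x).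
  apply: (@integrable_kernel _ _ _ _ e M) => // z /ltW ez.
  by apply: kc; rewrite cap_eq0.
apply: le_trans (le_normr_Rintegral measurableT ik) _.
have fn := integrable_norm (loc_integrable_eball y e0 lf).
rewrite -RintegralZl //; last exact: measurable_eball.
rewrite [leRHS]Rintegral_mkcond; apply: le_Rintegral => //.
- exact: integrable_norm ik.
- rewrite -restrict_EFin; apply/(integrable_mkcond _ (measurable_eball y e0)).
  by apply: (integrableZl _ M fn); exact: measurable_eball.
- move=> x _; rewrite normrM /patch; case: ifPn => [_|]; first by rewrite ler_pM.
  rewrite notin_setE /= => /negP; rewrite -cap_gt0 // -leNgt => c0.
  rewrite kc ?normr0 ?mul0r //; apply/eqP; by rewrite eq_le c0 cap_ge0.
Qed.

(** The inverse of the lower bound [bump_mass_ge], without its powers of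
    [e]. *)
Definition smooth_const : R := 16 / 9 * m%:R ^+ m.

Lemma bump_massV_le e y : 0 < e ->
  (bump_mass e y)^-1 <= smooth_const * (e ^+ 4)^-1 * (e ^+ m)^-1.
Proof.
move=> e0; have m0 : 0 < m%:R :> R by rewrite ltr0n.
rewrite (_ : smooth_const * _ * _ = (9 / 16 * e ^+ 4 * (e / m%:R) ^+ m)^-1).
  rewrite lef_pV2 ?posrE ?bump_mass_gt0 //; first exact: bump_mass_ge.
  have em : 0 < e / m%:R by rewrite divr_gt0.
  by rewrite mulr_gt0 ?exprn_gt0 // mulr_gt0 ?exprn_gt0 // divr_gt0.
rewrite expr_div_n /smooth_const.
have a0 : m%:R ^+ m != 0 :> R by rewrite expf_neq0 // gt_eqF.
have b0 : e ^+ m != 0 by rewrite expf_neq0 // gt_eqF.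
by field; rewrite a0 b0 gt_eqF.
Qed.

Lemma smooth_const_ge0 : 0 <= smooth_const.
Proof. by rewrite mulr_ge0 ?exprn_ge0 // divr_ge0. Qed.

Lemma smooth_le_avg e f y : 0 < e -> loc_integrable f ->
  `|smooth e f y| <= smooth_const * avg e f y.
Proof.
move=> e0 lf; have N0 := bump_mass_gt0 y e0.
rewrite normrM (ger0_norm (ltW _)) ?invr_gt0 //.
have H : `|mollify (bump e) f y| <= e ^+ 4 * \int[mu]_(x in eball y e) `|f x|.
  apply: kernel_le_eball => //; [exact: continuous_bump | exact: bump_le |].
  by move=> z c0; rewrite /bump c0 expr0n.
have I0 : 0 <= \int[mu]_(x in eball y e) `|f x| by apply: Rintegral_ge0.
apply: le_trans (ler_pM _ _ (bump_massV_le y e0) H) _ => //; first by rewrite invr_ge0 ltW.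
rewrite /avg le_eqVlt; apply/orP; left; apply/eqP.
have b0 : e ^+ m != 0 by rewrite expf_neq0 // gt_eqF.
by field; rewrite b0 gt_eqF.
Qed.

Lemma dsmooth_le_avg e j f y : 0 < e -> loc_integrable f ->
  `|dsmooth e j f y| <= 4 * m%:R * smooth_const / e * avg e f y.
Proof.
move=> e0 lf; have N0 := bump_mass_gt0 y e0.
rewrite normrN normrM (ger0_norm (ltW _)) ?invr_gt0 //.
have H : `|mollify (dbump e (unit_vec j)) f y| <= 4 * m%:R * e ^+ 3 * \int[mu]_(x in eball y e) `|f x|.
  apply: kernel_le_eball => //; first exact: continuous_dbump.
    by move=> z; apply: dbump_le => //; exact: normr_unit_vec.
  by move=> z c0; rewrite /dbump c0 mulr0.
have I0 : 0 <= \int[mu]_(x in eball y e) `|f x| by apply: Rintegral_ge0.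
apply: le_trans (ler_pM _ _ (bump_massV_le y e0) H) _ => //; first by rewrite invr_ge0 ltW.
rewrite /avg le_eqVlt; apply/orP; left; apply/eqP.
have b0 : e ^+ m != 0 by rewrite expf_neq0 // gt_eqF.
by field; rewrite b0 gt_eqF.
Qed.

(** The normalised kernel is a probability density, so the smoothed map is a
    barycenter of values of [u]. *)
Lemma smooth_convex n (O : set 'rV[R]_n) e (u : 'rV[R]_m -> 'rV[R]_n) y :
  convex_set (O : set (convex_lmodType 'rV[R]_n)) -> 0 < e ->
  (forall l, loc_integrable (fun x => u x ord0 l)) -> (forall x, O (u x)) ->
  O (\row_l smooth e (fun x => u x ord0 l) y).
Proof.
move=> cO e0 lu Ou; have N0 := bump_mass_gt0 y e0.
pose w x := (bump_mass e y)^-1 * bump e (x - y).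
have iw : integrableR w.
  apply: integrableRZ; have := bump_integrable y e0 (loc_integrable_cst 1).
  by apply: eq_integrable => // x _ /=; rewrite mulr1.
have := @barycenter_convex R _ _ mu n O w u cO.
rewrite (_ : (\row_i \int[mu]_x _) = \row_l smooth e (fun x => u x ord0 l) y).
  apply => //.
  - by move=> x; rewrite mulr_ge0 ?bump_ge0 // invr_ge0 ltW.
  - have := smooth_cst 1 y e0; rewrite /smooth /mollify -RintegralZl // => [<-|].
      by apply: eq_Rintegral => x _; rewrite /w mulr1.
    by apply: bump_integrable => //; exact: loc_integrable_cst.
  - move=> i; under eq_fun do rewrite /= /w -mulrA.
    by apply: integrableRZ; exact: bump_integrable.
apply/rowP => l; rewrite !mxE /smooth /mollify -RintegralZl //; last exact: bump_integrable.
by apply: eq_Rintegral => x _; rewrite /w mulrA.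
Qed.

End smoothing.

(** * Moments of the increments *)

(** The integral of a nonnegative function is a supremum over the simple
    functions below it, hence monotone whether or not the integrands are
    measurable.  It applies to mean oscillations, whose measurability in the
    centre is not part of the Besov condition. *)
Lemma ge0_le_integral_any d (T : measurableType d) (R : realType)
    (mu : {measure set T -> \bar R}) (D : set T) (f g : T -> \bar R) :
  (forall x, D x -> (0 <= f x)%E) -> (forall x, D x -> (f x <= g x)%E) ->
  (\int[mu]_(x in D) f x <= \int[mu]_(x in D) g x)%E.
Proof.
move=> f0 fg; have g0 x : D x -> (0 <= g x)%E.
  by move=> Dx; apply: le_trans (fg x Dx); exact: f0.
have pD0 h : (forall x, D x -> (0 <= h x)%E) -> forall x, (0 <= (h \_ D) x)%E.
  by move=> h0 x; rewrite /patch; case: ifPn => // /set_mem /h0.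
rewrite [leLHS]integral_mkcond [leRHS]integral_mkcond !ge0_integralTE; [|exact: pD0|exact: pD0].
apply: le_ereal_sup => _ [h hf <-]; exists h => // x.
apply: le_trans (hf x) _; rewrite /patch; case: ifPn => // /set_mem; exact: fg.
Qed.

Section avg_theory.
Context {R : realType} {k : nat}.
Notation m := k.+1.
Notation mu := (lebesgue_rV R m).
Implicit Types (f g : 'rV[R]_m -> R) (y : 'rV[R]_m) (e : R).

Lemma avg_ge0 e f y : 0 < e -> 0 <= avg e f y.
Proof.
move=> e0; rewrite mulr_ge0 //; last exact: Rintegral_ge0.
by rewrite invr_ge0 exprn_ge0 // ltW.
Qed.

(** Integrate the pointwise inequality over the ball; the constant [c2] is
    integrated with the bound [(2 e)^m] for the volume, and [avg] is normalised
    by [e^m]. *)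
Lemma avg_affine_le e f g y c1 c2 c3 : 0 < e -> loc_integrable f -> loc_integrable g ->
  0 <= c2 -> (forall x, c1 * `|f x| <= c2 + c3 * `|g x|) ->
  c1 * avg e f y <= c2 * 2 ^+ m + c3 * avg e g y.
Proof.
move=> e0 lf lg c20 fg; have em : 0 < e ^+ m by rewrite exprn_gt0.
have fi := integrable_norm (loc_integrable_eball y e0 lf).
have gi := integrable_norm (loc_integrable_eball y e0 lg).
have mB := measurable_eball y e0.
have Vfin : (mu (eball y e) < +oo)%E by exact: le_lt_trans (lebesgue_eball_le y e0) (ltry _).
have ic : mu.-integrable (eball y e) (EFin \o cst c2).
  apply: measurable_bounded_integrable => //.
  by exists `|c2|; split; rewrite ?num_real // => M cM x _ /=; rewrite ltW.
have H : c1 * \int[mu]_(x in eball y e) `|f x| <=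
    c2 * fine (mu (eball y e)) + c3 * \int[mu]_(x in eball y e) `|g x|.
  rewrite -Rintegral_cst // -!RintegralZl // -RintegralD //; last exact: (integrableZl mB c3 gi).
  apply: le_Rintegral => //.
  - exact: (integrableZl mB c1 fi).
  - exact: (integrableD mB ic (integrableZl mB c3 gi)).
have V2 : fine (mu (eball y e)) <= 2 ^+ m * e ^+ m.
  rewrite -exprMn -lee_fin fineK; first exact: lebesgue_eball_le.
  by rewrite ge0_fin_numE.
rewrite /avg mulrCA -(ler_pM2l em) mulVKf ?gt_eqF // mulrDr.
rewrite [X in _ + X](_ : _ = c3 * \int[mu]_(x in eball y e) `|g x|); last first.
  by set E := e ^+ m in em *; field; rewrite gt_eqF.
apply: le_trans H _; rewrite lerD2r [leRHS]mulrCA ler_wpM2l //.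
by rewrite mulrC.
Qed.

Lemma avg_le e f g y : 0 < e -> loc_integrable f -> loc_integrable g ->
  (forall x, `|f x| <= g x) -> avg e f y <= avg e g y.
Proof.
move=> e0 lf lg fg; rewrite /avg ler_wpM2l //.
  by rewrite invr_ge0 exprn_ge0 // ltW.
apply: le_Rintegral; first exact: measurable_eball.
- exact: integrable_norm (loc_integrable_eball y e0 lf).
- exact: integrable_norm (loc_integrable_eball y e0 lg).
- by move=> x _; rewrite (le_trans (fg x)) // ler_norm.
Qed.

Lemma expr_le_cube (t : R) i : 0 <= t -> (i <= 3)%N -> t ^+ i <= 1 + t ^+ 3.
Proof.
move=> t0 i3; have [t1|t1] := leP t 1.
  by rewrite -[leLHS]addr0 lerD ?exprn_ge0 // exprn_ile1.
by rewrite -[leLHS]add0r lerD // ler_eXn2l // ltW.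
Qed.

Lemma loc_integrable_pow (s : 'rV[R]_m -> R) i : (forall x, 0 <= s x) -> measurable_fun setT s ->
  loc_integrable (fun x => s x ^+ 3) -> (i <= 3)%N -> loc_integrable (fun x => s x ^+ i).
Proof.
move=> s0 ms ls i3.
have lg := loc_integrableD (loc_integrable_cst 1) ls.
apply: le_loc_integrable lg; first exact: measurable_funX.
move=> x; rewrite /= ger0_norm ?exprn_ge0 //.
exact: expr_le_cube.
Qed.

Section young.
Context (e : R) (y : 'rV[R]_m) (s : 'rV[R]_m -> R).
Context (e0 : 0 < e) (s0 : forall x, 0 <= s x) (ms : measurable_fun setT s)
  (ls : loc_integrable (fun x => s x ^+ 3)).

Let T : R := 2 ^+ m.
Let a := avg e s y.
Let b := avg e (fun x => s x ^+ 2) y.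
Let A := avg e (fun x => s x ^+ 3) y.

Let T0 : 0 < T. Proof. by rewrite exprn_gt0. Qed.
Let a0 : 0 <= a. Proof. exact: avg_ge0. Qed.
Let ls1 : loc_integrable s.
Proof. exact: (@loc_integrable_pow s 1 s0 ms ls isT). Qed.
Let ls2 : loc_integrable (fun x => s x ^+ 2).
Proof. exact: (@loc_integrable_pow s 2 s0 ms ls isT). Qed.
Let s30 x : 0 <= s x ^+ 3. Proof. by rewrite exprn_ge0. Qed.
Let s20 x : 0 <= s x ^+ 2. Proof. by rewrite exprn_ge0. Qed.

(** Jensen's inequality for the cube, up to the normalisation of [avg]: the
    tangent at [p] gives [3 p^2 s <= 2 p^3 + s^3], and the choice
    [p = a / 2^m] absorbs the constant term after averaging. *)
Lemma avg_cube_le : a ^+ 3 <= T ^+ 2 * A.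
Proof.
pose p := a / T; have p0 : 0 <= p by rewrite divr_ge0 // ltW.
have aE : a = p * T by rewrite /p divfK // gt_eqF.
have := @avg_affine_le e s (fun x => s x ^+ 3) y (3 * p ^+ 2) (2 * p ^+ 3) 1 e0 ls1 ls.
rewrite -/a -/A -/T mul1r => H.
have {}H : 3 * p ^+ 2 * a <= 2 * p ^+ 3 * T + A.
  apply: H; first by rewrite mulr_ge0 // exprn_ge0.
  move=> x; rewrite mul1r !ger0_norm // -subr_ge0.
  rewrite (_ : _ - _ = (s x - p) ^+ 2 * (s x + 2 * p)); last by ring.
  by rewrite mulr_ge0 ?sqr_ge0 // addr_ge0 // mulr_ge0.
have {}H : p ^+ 3 * T <= A.
  rewrite aE in H; rewrite -(lerD2l (2 * p ^+ 3 * T)); apply: le_trans H.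
  by rewrite le_eqVlt; apply/orP; left; apply/eqP; ring.
rewrite aE (_ : _ ^+ 3 = T ^+ 2 * (p ^+ 3 * T)); last by ring.
by rewrite ler_wpM2l // sqr_ge0.
Qed.

(** Average [3 p s^2 <= p^3 + 2 s^3] with the same [p] as for
    [avg_cube_le], which bounds the term in [p^3]. *)
Lemma avg_mul_le : a * b <= T * A.
Proof.
pose p := a / T; have p0 : 0 <= p by rewrite divr_ge0 // ltW.
have aE : a = p * T by rewrite /p divfK // gt_eqF.
have := @avg_affine_le e _ (fun x => s x ^+ 3) y (3 * p) (p ^+ 3) 2 e0 ls2 ls.
rewrite -/b -/A -/T => H.
have {}H : 3 * p * b <= p ^+ 3 * T + 2 * A.
  apply: H; first by rewrite exprn_ge0.
  move=> x; rewrite !ger0_norm // -subr_ge0.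
  rewrite (_ : _ - _ = (s x - p) ^+ 2 * (2 * s x + p)); last by ring.
  by rewrite mulr_ge0 ?sqr_ge0 // addr_ge0 // mulr_ge0.
have H2 : p ^+ 3 * T <= A.
  have := avg_cube_le; rewrite aE (_ : (p * T) ^+ 3 = T ^+ 2 * (p ^+ 3 * T)); last by ring.
  by rewrite ler_pM2l // exprn_gt0.
have {}H : p * b <= A by lra.
by rewrite aE mulrAC [_ * T]mulrC ler_wpM2l // ltW.
Qed.

(** Where [s >= d w] the weight is at most [s / d]; elsewhere [s^2] is at most
    [(d w)^2]. *)
Lemma avg_weight_le w d : 0 <= w -> 0 < d -> w * b <= T * (d ^+ 2 * w ^+ 3) + d^-1 * A.
Proof.
move=> w0 d0; rewrite [T * _]mulrC.
apply: avg_affine_le => //; first by rewrite mulr_ge0 ?exprn_ge0 // ltW.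
move=> x; rewrite !ger0_norm //; have [wd|wd] := leP (d * w) (s x).
  rewrite -[leLHS]add0r lerD //; first by rewrite mulr_ge0 ?exprn_ge0 // ltW.
  rewrite -(ler_pM2l d0) mulrA mulVKf ?gt_eqF // [_ ^+ 3]exprS.
  by rewrite ler_wpM2r // exprn_ge0.
rewrite -[leLHS]addr0 lerD //; last by rewrite mulr_ge0 ?invr_ge0 ?exprn_ge0 // ltW.
rewrite (_ : d ^+ 2 * w ^+ 3 = w * (d * w) ^+ 2); last by ring.
by rewrite ler_wpM2l // lerXn2r ?nnegrE // ?mulr_ge0 // ltW.
Qed.

End young.

End avg_theory.

(** Absorption of the weights.  Here [w] stands for [1 + |u|], the numbers
    [a], [b], [A] for the first three moments of the increments, and
    [T = 2^m].  Every product is split according to which of [d w] and the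
    increment is larger; the factors [1 / d] and [1 / e] are at least 1, and
    so lower powers of them are bounded by [d^-2] and [e^-1]. *)
Lemma young_products (R : realType) (T w a b A d e : R) :
  1 <= T -> 0 <= w -> 0 <= a -> 0 <= b -> 0 <= A -> 0 < d <= 1 -> 0 < e <= 1 ->
  a ^+ 3 <= T ^+ 2 * A -> a * b <= T * A ->
  w * b <= T * (d ^+ 2 * w ^+ 3) + d^-1 * A ->
  (w + a + a / e) * (b + a ^+ 2) <= 4 * T ^+ 2 * (d * w ^+ 3 + (d^-1 ^+ 2 + e^-1) * A) /\
  a * w ^+ 2 + a ^+ 3 <= 4 * T ^+ 2 * (d * w ^+ 3 + (d^-1 ^+ 2 + e^-1) * A).
Proof.
move=> T1 w0 a0 b0 A0 /andP[d0 d1] /andP[e0 e1] a3 ab wb.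
have D1 : 1 <= d^-1 by rewrite invf_ge1.
have E1 : 1 <= e^-1 by rewrite invf_ge1.
set D := d^-1 in wb D1 *; set E := e^-1 in E1 *.
have dD : d * D = 1 by rewrite /D divff // gt_eqF.
have D0 : 0 <= D by lra.
have E0 : 0 <= E by lra.
have W0 : 0 <= w ^+ 3 by rewrite exprn_ge0.
set W := w ^+ 3 in wb W0 *.
have T2 : T <= T ^+ 2 by rewrite expr2 ler_peMl //; lra.
have T20 : 1 <= T ^+ 2 by lra.
have a30 : 0 <= a ^+ 3 by rewrite exprn_ge0.
have Da0 : 0 <= D * a ^+ 3 by rewrite mulr_ge0.
have D2a0 : 0 <= D ^+ 2 * a ^+ 3 by rewrite mulr_ge0 ?sqr_ge0.
have dW : 0 <= d * W by rewrite mulr_ge0 //; lra.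
have waD : d * w <= a -> w <= D * a.
  by move=> wd; rewrite -[leLHS]mul1r -dD mulrAC mulrC ler_wpM2l.
(* if [d w <= a] the weight is bounded by [a / d], otherwise [a] by [d w] *)
have wa : w * a ^+ 2 <= d * W + D * a ^+ 3.
  have [/waD wD|/ltW wd] := leP (d * w) a.
    have : w * a ^+ 2 <= D * a * a ^+ 2 by rewrite ler_wpM2r ?sqr_ge0.
    rewrite -mulrA -exprS; lra.
  have : w * a ^+ 2 <= w * (d * w) ^+ 2.
    by rewrite ler_wpM2l // lerXn2r ?nnegrE ?mulr_ge0 //; lra.
  rewrite (_ : w * (d * w) ^+ 2 = d * (d * W)); last by rewrite /W; ring.
  have : d * (d * W) <= d * W by rewrite ler_piMl.
  lra.
have aw : a * w ^+ 2 <= d * W + D ^+ 2 * a ^+ 3.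
  have [/waD wD|/ltW wd] := leP (d * w) a.
    have : a * w ^+ 2 <= a * (D * a) ^+ 2.
      by rewrite ler_wpM2l // lerXn2r ?nnegrE ?mulr_ge0.
    rewrite (_ : a * (D * a) ^+ 2 = D ^+ 2 * a ^+ 3); [lra | ring].
  have : a * w ^+ 2 <= d * w * w ^+ 2 by rewrite ler_wpM2r ?sqr_ge0.
  rewrite -mulrA -exprS -/W; lra.
have DD : D <= D ^+ 2 by rewrite expr2 ler_peMl //; lra.
have T2A : A <= T ^+ 2 * A by rewrite ler_peMl.
have TA : T * A <= T ^+ 2 * A by rewrite ler_wpM2r.
have X0 : 0 <= T ^+ 2 * A by rewrite mulr_ge0 //; lra.
set X := T ^+ 2 * A in a3 T2A TA X0 *.
have TW : d * W <= T ^+ 2 * (d * W) by rewrite ler_peMl.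
have Da3 : D * a ^+ 3 <= D ^+ 2 * X.
  by rewrite ler_pM ?exprn_ge0 //; lra.
have D2a3 : D ^+ 2 * a ^+ 3 <= D ^+ 2 * X by rewrite ler_wpM2l // sqr_ge0.
have D2X : X <= D ^+ 2 * X by rewrite ler_peMl //; lra.
have rhsE : 4 * T ^+ 2 * (d * W + (D ^+ 2 + E) * A) =
    4 * (T ^+ 2 * (d * W)) + 4 * (D ^+ 2 * X) + 4 * (E * X) by rewrite /X; ring.
have EX : X <= E * X by rewrite ler_peMl.
rewrite rhsE; split; last first.
  by lra.
have wb' : w * b <= T ^+ 2 * (d * W) + D ^+ 2 * X.
  apply: le_trans wb _; apply: lerD.
    rewrite (_ : T * (d ^+ 2 * W) = T * d * (d * W)); last by ring.
    rewrite ler_wpM2r //; apply: le_trans T2; rewrite ler_piMr //; lra.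
  by rewrite ler_pM //; lra.
have Eab : E * (a * b) <= E * X by rewrite ler_wpM2l //; lra.
have Ea3 : E * a ^+ 3 <= E * X by rewrite ler_wpM2l //; lra.
rewrite (_ : (w + a + a / e) * (b + a ^+ 2) = w * b + w * a ^+ 2 + a * b + a ^+ 3 +
  E * (a * b) + E * a ^+ 3); last by rewrite /E; ring.
lra.
Qed.

(** * Commutator estimate *)

Section local_estimates.
Context {R : realType} {k n : nat}.
Notation m := k.+1.
Notation mu := (lebesgue_rV R m).
Context (O : set 'rV[R]_n) (cO : convex_set (O : set (convex_lmodType 'rV[R]_n))).
Context (u : 'rV[R]_m -> 'rV[R]_n) (mu_u : measurable_fun setT u)
  (lu : loc_integrable (fun x => `|u x| ^+ 3)) (Ou : forall x, O (u x)).
Implicit Types (y x : 'rV[R]_m) (e : R) (g : 'rV[R]_n -> R).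

Definition dist_at y x : R := `|u x - u y|.
Definition smooth_vec e y : 'rV[R]_n := \row_l smooth e (fun x => u x ord0 l) y.

Lemma cubeD_le (a b : R) : 0 <= a -> 0 <= b -> (a + b) ^+ 3 <= 4 * (a ^+ 3 + b ^+ 3).
Proof.
move=> a0 b0; rewrite -subr_ge0 (_ : _ - _ = 3 * (a - b) ^+ 2 * (a + b)); last by ring.
apply: mulr_ge0; last exact: addr_ge0.
by rewrite mulr_ge0 // sqr_ge0.
Qed.

Lemma measurable_norm_rV d (T : measurableType d) (f : T -> 'rV[R]_n) :
  measurable_fun setT f -> measurable_fun setT (fun x : T => `|f x|).
Proof.
move=> mf; apply: (measurableT_comp (f := fun v : 'rV[R]_n => `|v|)) => //.
by apply: continuous_measurable_rV => v; exact: norm_continuous.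
Qed.

Lemma measurable_rVB d (T : measurableType d) (f g : T -> 'rV[R]_n) :
  measurable_fun setT f -> measurable_fun setT g -> measurable_fun setT (fun x : T => f x - g x).
Proof.
move=> mf mg; apply: measurable_fun_coordP => i.
rewrite (_ : (fun x : T => _) = (fun x : T => f x ord0 i - g x ord0 i)); last first.
  by apply/funext => x; rewrite !mxE.
by apply: measurable_funB; apply: (measurableT_comp (measurable_coord i)).
Qed.

Lemma measurable_dist_at y : measurable_fun setT (dist_at y).
Proof. by apply: measurable_norm_rV; apply: measurable_rVB. Qed.

Lemma dist_at_ge0 y x : 0 <= dist_at y x. Proof. exact: normr_ge0. Qed.

Lemma loc_integrable_growth (f : 'rV[R]_m -> R) C : measurable_fun setT f ->
  (forall x, `|f x| <= C * (1 + `|u x| ^+ 3)) -> loc_integrable f.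
Proof.
move=> mf fC; apply: le_loc_integrable mf fC _.
by apply: loc_integrableZ; apply: loc_integrableD => //; exact: loc_integrable_cst.
Qed.

Lemma loc_integrable_dist3 y : loc_integrable (fun x => dist_at y x ^+ 3).
Proof.
apply: (@loc_integrable_growth _ (4 * (1 + `|u y| ^+ 3))).
  by apply: measurable_funX; exact: measurable_dist_at.
move=> x; rewrite ger0_norm ?exprn_ge0 ?dist_at_ge0 //.
apply: (@le_trans _ _ ((`|u x| + `|u y|) ^+ 3)).
  by rewrite lerXn2r ?nnegrE ?dist_at_ge0 ?addr_ge0 // ler_normB.
apply: le_trans (cubeD_le _ _) _ => //; rewrite -mulrA ler_wpM2l //.
have a0 : 0 <= `|u x| ^+ 3 by rewrite exprn_ge0.
have b0 : 0 <= `|u y| ^+ 3 by rewrite exprn_ge0.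
by move: (_ ^+ 3) (_ ^+ 3) a0 b0 => a b a0 b0; have := mulr_ge0 a0 b0; nra.
Qed.

Lemma loc_integrable_dist y : loc_integrable (dist_at y).
Proof.
exact: (@loc_integrable_pow _ _ _ 1 (dist_at_ge0 y) (measurable_dist_at y) (loc_integrable_dist3 y)).
Qed.

Lemma loc_integrable_dist2 y : loc_integrable (fun x => dist_at y x ^+ 2).
Proof.
exact: (@loc_integrable_pow _ _ _ 2 (dist_at_ge0 y) (measurable_dist_at y) (loc_integrable_dist3 y)).
Qed.

Lemma loc_integrable_coord l : loc_integrable (fun x => u x ord0 l).
Proof.
apply: (@loc_integrable_growth _ 1); first exact: (measurableT_comp (measurable_coord l)).
move=> x; rewrite mul1r; apply: le_trans (normr_coord_le _ _) _.
exact: (@expr_le_cube _ _ 1).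
Qed.

Lemma smooth_vec_in e y : 0 < e -> O (smooth_vec e y).
Proof. by move=> e0; apply: smooth_convex => //; exact: loc_integrable_coord. Qed.

(** Constants are reproduced by smoothing, so the difference is the smoothing
    of [u - u y], coordinate by coordinate. *)
Lemma smooth_vec_dist e y : 0 < e ->
  `|smooth_vec e y - u y| <= @smooth_const R k * avg e (dist_at y) y.
Proof.
move=> e0; apply: normr_rV_le => [|l].
  by rewrite mulr_ge0 ?smooth_const_ge0 ?avg_ge0.
rewrite !mxE (_ : _ - _ = smooth e (fun x => u x ord0 l + - u y ord0 l) y); last first.
  rewrite smoothD //; first by rewrite smooth_cst.
    exact: loc_integrable_coord.
  exact: loc_integrable_cst.
have lD : loc_integrable (fun x => u x ord0 l + - u y ord0 l).
  by apply: loc_integrableD; [exact: loc_integrable_coord|exact: loc_integrable_cst].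
apply: le_trans (smooth_le_avg y e0 lD) _.
rewrite ler_wpM2l ?smooth_const_ge0 //; apply: avg_le => //; first exact: loc_integrable_dist.
by move=> x; have := normr_coord_le (u x - u y) l; rewrite !mxE.
Qed.

(** The derivative kernel has mean 0, so [u] may be replaced by [u - u y]; its
    size relative to the kernel is [1 / e]. *)
Lemma dsmooth_vec_le e j l y : 0 < e ->
  `|dsmooth e j (fun x => u x ord0 l) y| <=
    4 * m%:R * @smooth_const R k / e * avg e (dist_at y) y.
Proof.
move=> e0; rewrite -(dsmoothB_cst j (u y ord0 l)) //; last exact: loc_integrable_coord.
have lD : loc_integrable (fun x => u x ord0 l - u y ord0 l).
  by apply: loc_integrableD; [exact: loc_integrable_coord|exact: loc_integrable_cst].
apply: le_trans (dsmooth_le_avg j y e0 lD) _.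
rewrite ler_wpM2l //.
  by rewrite divr_ge0 ?mulr_ge0 ?smooth_const_ge0 // ltW.
apply: avg_le => //; first exact: loc_integrable_dist.
by move=> x; have := normr_coord_le (u x - u y) l; rewrite !mxE.
Qed.

Lemma loc_integrable_sum (I : Type) (r : seq I) (h : I -> 'rV[R]_m -> R) :
  (forall i, loc_integrable (h i)) -> loc_integrable (fun x => \sum_(i <- r) h i x).
Proof.
move=> lh; elim: r => [|i r IH].
  rewrite (_ : (fun x => _) = cst 0); first exact: loc_integrable_cst.
  by apply/funext => x; rewrite big_nil.
rewrite (_ : (fun x => _) = fun x => h i x + \sum_(j <- r) h j x); last first.
  by apply/funext => x; rewrite big_cons.
exact: loc_integrableD.
Qed.

Lemma smooth_sum e y (I : Type) (r : seq I) (h : I -> 'rV[R]_m -> R) : 0 < e ->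
  (forall i, loc_integrable (h i)) ->
  smooth e (fun x => \sum_(i <- r) h i x) y = \sum_(i <- r) smooth e (h i) y.
Proof.
move=> e0 lh; elim: r => [|i r IH].
  rewrite (_ : (fun x => _) = cst 0); first by rewrite smooth_cst // big_nil.
  by apply/funext => x; rewrite big_nil.
rewrite big_cons -IH -smoothD //; last exact: loc_integrable_sum.
by congr (smooth e _ y); apply/funext => x; rewrite big_cons.
Qed.

(** Write [rem] for the remainder of the first order expansion of [g] at
    [V = smooth_vec e y], evaluated at [u x].  The linear term averages to 0
    because [V] is the average of [u], so the left-hand side is the smoothing
    of [rem].  By [convex_taylor] the remainder is quadratic in
    [u x - V = (u x - u y) + (u y - V)], and the second difference is
    controlled by the first moment. *)
Lemma commutator_le e y g Dg D2g M : 0 < e -> partials_on O g Dg ->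
  (forall l, partials_on O (Dg l) (D2g l)) ->
  (forall l l' P, O P -> `|D2g l l' P| <= M) -> loc_integrable (g \o u) ->
  `|g (smooth_vec e y) - smooth e (g \o u) y| <=
    2 * @smooth_const R k * (n%:R ^+ 2 * M) * (1 + @smooth_const R k ^+ 2 * 2 ^+ m) *
    (avg e (fun x => dist_at y x ^+ 2) y + avg e (dist_at y) y ^+ 2).
Proof.
move=> e0 pg pDg DM lg; set V := smooth_vec e y; set K := @smooth_const R k.
set b := avg e _ y; set a := avg e _ y.
have OV : O V by exact: smooth_vec_in.
have K0 : 0 <= K by exact: smooth_const_ge0.
have a0 : 0 <= a by exact: avg_ge0.
have b0 : 0 <= b by exact: avg_ge0.
(* arranged so that [smooth] can be distributed over the sum *)
pose rem x := g (u x) + (\sum_l (- Dg l V) * u x ord0 l + (- g V + \sum_l V ord0 l * Dg l V)).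
have remE x : rem x = g (u x) - g V - \sum_l (u x - V) ord0 l * Dg l V.
  rewrite /rem (_ : \sum_l (u x - V) ord0 l * Dg l V =
    \sum_l u x ord0 l * Dg l V - \sum_l V ord0 l * Dg l V); last first.
    by rewrite -sumrB; apply: eq_bigr => l _; rewrite !mxE mulrBl.
  rewrite (_ : \sum_l (- Dg l V) * u x ord0 l = - \sum_l u x ord0 l * Dg l V); last first.
    by rewrite -sumrN; apply: eq_bigr => l _; ring.
  ring.
have ll l : loc_integrable (fun x => - Dg l V * u x ord0 l).
  by apply: loc_integrableZ; exact: loc_integrable_coord.
have ls := loc_integrable_sum (index_enum _) ll.
have lc c : loc_integrable (fun _ : 'rV[R]_m => c) by exact: loc_integrable_cst.
have lrem : loc_integrable rem.
  by apply: loc_integrableD => //; exact: loc_integrableD.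
have -> : g V - smooth e (g \o u) y = - smooth e rem y.
  rewrite /rem smoothD //; last exact: loc_integrableD.
  rewrite smoothD // smooth_cst // smooth_sum //.
  rewrite (_ : \sum_l smooth e _ y = - \sum_l V ord0 l * Dg l V); last first.
    rewrite -sumrN; apply: eq_bigr => l _; rewrite smoothZ //; last exact: loc_integrable_coord.
    by rewrite [V ord0 l]mxE; ring.
  rewrite /comp; ring.
rewrite normrN; apply: le_trans (smooth_le_avg y e0 lrem) _; rewrite -/K.
have M0 : 0 <= n%:R ^+ 2 * M.
  case: (posnP n) => [->|n0]; first by rewrite expr0n /= mul0r.
  have l0 : 'I_n by exact: (Ordinal n0).
  by rewrite mulr_ge0 ?sqr_ge0 // (le_trans (normr_ge0 _) (DM l0 l0 _ OV)).
set M' := _ * M in M0 *.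
have := @avg_affine_le _ _ e rem (fun x => dist_at y x ^+ 2) y 1 (M' * (2 * (K * a) ^+ 2))
   (M' * 2) e0 lrem (loc_integrable_dist2 y).
rewrite mul1r -/b => H.
have {}H : avg e rem y <= M' * (2 * (K * a) ^+ 2) * 2 ^+ m + M' * 2 * b.
  apply: H; first by rewrite mulr_ge0 // mulr_ge0 // sqr_ge0.
  move=> x; rewrite mul1r [`|dist_at _ _ ^+ 2|]ger0_norm ?sqr_ge0 // remE.
  apply: le_trans (convex_taylor cO pg pDg OV (Ou x) DM) _; rewrite -/M'.
  rewrite [leRHS](_ : _ = M' * (2 * (K * a) ^+ 2 + 2 * dist_at y x ^+ 2)); last by ring.
  rewrite ler_wpM2l //.
  have dV : `|u x - V| <= dist_at y x + K * a.
    rewrite -[u x - V](subrKA (u y)) (le_trans (ler_normD _ _)) // lerD //.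
    by rewrite distrC; exact: smooth_vec_dist.
  apply: (@le_trans _ _ ((dist_at y x + K * a) ^+ 2)).
    have h0 : 0 <= dist_at y x + K * a by rewrite addr_ge0 ?dist_at_ge0 // mulr_ge0.
    by apply: lerXn2r; rewrite ?nnegrE.
  rewrite -subr_ge0 (_ : _ - _ = (dist_at y x - K * a) ^+ 2); last by ring.
  exact: sqr_ge0.
apply: le_trans (ler_wpM2l K0 H) _.
have KM : 0 <= K * M' by rewrite mulr_ge0.
have KT : 0 <= K ^+ 2 * 2 ^+ m by rewrite mulr_ge0 ?sqr_ge0 ?exprn_ge0.
rewrite [leLHS](_ : _ = 2 * (K * M') * (K ^+ 2 * 2 ^+ m * a ^+ 2 + b)); last by ring.
rewrite [leRHS](_ : _ = 2 * (K * M') * ((1 + K ^+ 2 * 2 ^+ m) * (b + a ^+ 2))); last by ring.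
apply: ler_wpM2l; first by rewrite mulr_ge0.
have zb := mulr_ge0 KT b0; have a20 : 0 <= a ^+ 2 by exact: sqr_ge0.
rewrite mulrDl mul1r mulrDr; lra.
Qed.

End local_estimates.

(** * Estimate of the companion law at a fixed scale *)

Lemma ler_normD_dist (R : numDomainType) (V : normedZmodType R) (x y : V) :
  `|x| <= `|y| + `|x - y|.
Proof. by rewrite -[X in `|X| <= _](subrK y x) addrC; exact: ler_normD. Qed.

Lemma continuous_within_comp (R : realType) n (T : topologicalType) (O : set 'rV[R]_n)
    (f : 'rV[R]_n -> R) (v : T -> 'rV[R]_n) :
  {within O, continuous f} -> continuous v -> (forall y, O (v y)) -> continuous (f \o v).
Proof.
move=> /subspace_continuousP cf cv Ov y.
have vw : v z @[z --> y] --> within O (nbhs (v y)).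
  move=> S; rewrite /within /= => /cv S1.
  have {}S1 : \forall z \near y, O (v z) -> S (v z) by exact: S1.
  by apply: filterS S1 => z; apply.
exact: (cvg_comp _ _ vw (cf _ (Ov y))).
Qed.

Section defect.
Context {R : realType} {k n : nat}.
Notation m := k.+1.
Notation mu := (lebesgue_rV R m).
Context (u : 'rV[R]_m -> 'rV[R]_n) (mu_u : measurable_fun setT u).

(** The mean of the cubed increments of [u] at scale [e]; the Besov condition
    says that its integral is [o(e)]. *)
Definition defect e y : R := avg e (fun x => dist_at u y x ^+ 3) y.

Lemma defect_ge0 e y : 0 < e -> 0 <= defect e y.
Proof. exact: avg_ge0. Qed.

(** The defect is a partial integral of a function measurable in both
    variables, and Tonelli's theorem applies.  The ball is written as
    [0 < cap e (x - y)], a condition that is jointly measurable. *)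
Lemma measurable_defect e : 0 < e -> measurable_fun setT (defect e).
Proof.
move=> e0.
pose f (p : 'rV[R]_m * 'rV[R]_m) : R :=
  if 0 < cap e (p.2 - p.1) then `|u p.2 - u p.1| ^+ 3 else 0.
have mf : measurable_fun setT f.
  have msub : measurable_fun setT (fun p : 'rV[R]_m * 'rV[R]_m => p.2 - p.1).
    by apply: measurable_rVB; [exact: measurable_snd | exact: measurable_fst].
  apply: measurable_fun_ifT => //.
    apply: measurable_fun_ltr; first exact: measurable_cst.
    exact: (measurableT_comp (continuous_measurable_rV (@continuous_cap R m e)) msub).
  apply: measurable_funX; apply: measurable_norm_rV; apply: measurable_rVB.
    exact: (measurableT_comp mu_u measurable_snd).
  exact: (measurableT_comp mu_u measurable_fst).
have f0 p : (0 <= (f p)%:E)%E.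
  by rewrite lee_fin /f; case: ifP => // _; rewrite exprn_ge0.
have mF := @measurable_fun_fubini_tonelli_F _ _ _ _ R mu (fun p => (f p)%:E)
  (proj2 (measurable_EFinP _ _) mf) f0.
rewrite (_ : defect e = fun y => (e ^+ m)^-1 * fine (\int[mu]_x (f (y, x))%:E)%E).
  by apply: measurable_funM; [exact: measurable_cst | apply: measurableT_comp mF].
apply/funext => y; rewrite /defect /avg; congr (_ * fine _).
rewrite integral_mkcond; apply: eq_integral => x _; rewrite /patch /f /=.
case: ifPn => [|].
  by rewrite inE /eball /= cap_gt0 // => ->; rewrite ger0_norm // exprn_ge0 // dist_at_ge0.
by rewrite notin_setE /eball /= cap_gt0 // => /negP/negbTE ->.
Qed.

Lemma lebesgue_eball_gt0 y e : 0 < e -> 0 < fine (mu (eball y e)).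
Proof.
move=> e0; have m0 : 0 < m%:R :> R by rewrite ltr0n.
have r0 : 0 < e / (2 * m%:R) by rewrite divr_gt0 // mulr_gt0.
have sub : (mu (open_cube y (e / (2 * m%:R))) <= mu (eball y e))%E.
  apply: le_measure; rewrite ?inE.
  - exact: measurable_open_cube.
  - exact: measurable_eball.
  - move=> x xr; apply: le_lt_trans (enorm_le_normr _) _.
    have : `|x - y| < e / (2 * m%:R).
      by apply: normr_rV_lt => // i; have := xr i; rewrite !mxE.
    rewrite ltr_pdivlMr ?mulr_gt0 // => h; rewrite mulrC.
    have : 0 <= `|x - y| * m%:R by rewrite mulr_ge0.
    lra.
rewrite (lebesgue_open_cube y (ltW r0)) in sub.
rewrite -lte_fin fineK; first by apply: (lt_le_trans _ sub); rewrite lte_fin exprn_gt0 // mulr_gt0.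
by rewrite ge0_fin_numE // (le_lt_trans (lebesgue_eball_le y e0)) // ltry.
Qed.

(** The factor [2^m] compares the normalisation [e^m] of [avg] with the
    volume of the Euclidean ball, which is at most [(2 e)^m]; the supremum norm
    is below the Euclidean one. *)
Lemma defect_le_mean (v : 'rV[R]_m -> 'rV[R]_n) e y : 0 < e ->
  loc_integrable (fun x => dist_at u y x ^+ 3) ->
  (forall x, eball y e x -> v x = u x) -> v y = u y ->
  (((2 ^+ m)^-1 * defect e y)%:E <= ((fine (mu (eball y e)))^-1)%:E *
     \int[mu]_(x in eball y e) (enorm (v y - v x) ^+ 3)%:E)%E.
Proof.
move=> e0 li vu vy; rewrite /defect /avg mulrA -invfM -exprMn EFinM.
apply: lee_pmul.
- by rewrite lee_fin invr_ge0 exprn_ge0 // mulr_ge0 // ltW.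
- by rewrite lee_fin; exact: Rintegral_ge0.
- rewrite lee_fin lef_pV2 ?posrE ?lebesgue_eball_gt0 // ?exprn_gt0 ?mulr_gt0 //.
  rewrite -lee_fin fineK; first exact: lebesgue_eball_le.
  by rewrite ge0_fin_numE // (le_lt_trans (lebesgue_eball_le y e0)) // ltry.
rewrite /Rintegral fineK; last first.
  apply: integrable_fin_num; first exact: measurable_eball.
  exact: integrable_norm (loc_integrable_eball y e0 li).
apply: ge0_le_integral_any => x xB; rewrite lee_fin //.
rewrite ger0_norm ?exprn_ge0 ?dist_at_ge0 //.
rewrite /dist_at -(vu x xB) -vy distrC lerXn2r ?nnegrE //.
- by rewrite enormE sqrtr_ge0.
- exact: normr_le_enorm.
Qed.

End defect.

Section companion.
Context {R : realType} {k n : nat}.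
Notation m := k.+1.
Notation mu := (lebesgue_rV R m).
Context (O : set 'rV[R]_n) (cO : convex_set (O : set (convex_lmodType 'rV[R]_n))).
Context (G : 'I_n -> 'I_m -> 'rV[R]_n -> R)
  (DG : 'I_n -> 'I_m -> 'I_n -> 'rV[R]_n -> R)
  (D2G : 'I_n -> 'I_m -> 'I_n -> 'I_n -> 'rV[R]_n -> R)
  (Q : 'I_m -> 'rV[R]_n -> R) (DQ : 'I_m -> 'I_n -> 'rV[R]_n -> R)
  (B : 'I_n -> 'rV[R]_n -> R) (DB : 'I_n -> 'I_n -> 'rV[R]_n -> R).
Context (pG : forall i j, partials_on O (G i j) (DG i j))
  (pDG : forall i j l, partials_on O (DG i j l) (D2G i j l))
  (pQ : forall j, partials_on O (Q j) (DQ j))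
  (pB : forall i, partials_on O (B i) (DB i))
  (cDB : forall i l, {within O, continuous (DB i l)})
  (compat : forall V j l, O V -> DQ j l V = \sum_(i < n) B i V * DG i j l V).
Context (u : 'rV[R]_m -> 'rV[R]_n) (mu_u : measurable_fun setT u)
  (lu : loc_integrable (fun x => `|u x| ^+ 3)) (Ou : forall x, O (u x)).
Context (lG : forall i j, loc_integrable (G i j \o u)).
Context (phi : 'rV[R]_m -> R) (dphi : 'I_m -> 'rV[R]_m -> R)
  (cphi : continuous phi) (cdphi : forall j, continuous (dphi j))
  (phi_d : forall j x, is_derive x (unit_vec j) phi (dphi j x)).

Notation V e y := (smooth_vec u e y).
Notation H e i j y := (smooth e (G i j \o u) y).
Notation dU e j l y := (dsmooth e j (fun x => u x ord0 l) y).

(** The [j]-th partial derivative of [phi * B_i(V)]. *)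
Let dphiB e i j y : R :=
  dphi j y * B i (V e y) + phi y * \sum_(l < n) dU e j l y * DB i l (V e y).

(** The [j]-th partial derivative of [potential e j]; see
    [is_derive_potential]. *)
Let flux e j y : R := dphi j y * Q j (V e y)
  - \sum_(i < n) dphiB e i j y * (G i j (V e y) - H e i j y)
  + phi y * \sum_(i < n) B i (V e y) * dsmooth e j (G i j \o u) y.

Let potential e j y : R := phi y * Q j (V e y)
  - \sum_(i < n) phi y * (B i (V e y) * (G i j (V e y) - H e i j y)).

Lemma continuous_smooth_vec e : 0 < e -> continuous (fun y => V e y).
Proof.
move=> e0; apply: continuous_rV => l.
rewrite (_ : (fun x => _) = smooth e (fun x => u x ord0 l)).
  by apply: continuous_smooth => //; exact: loc_integrable_coord.
by apply/funext => y; rewrite mxE.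
Qed.

(** The derivative of [Q_j(V)] is [\sum_i B_i(V) \sum_l DG_ij l (V) d_j V_l] by
    [compat].  This cancels the derivative of [G_ij(V)] in the second sum, and
    only the derivative of the smoothed [G_ij(u)] survives with the factor
    [B_i(V)]. *)
Lemma is_derive_potential e j y : 0 < e ->
  is_derive y (unit_vec j) (potential e j) (flux e j y).
Proof.
move=> e0; have OV z : O (V e z) by exact: smooth_vec_in.
have dV l : is_derive y (unit_vec j) (fun z => V e z ord0 l) (dU e j l y).
  rewrite (_ : (fun z => V e z ord0 l) = smooth e (fun x => u x ord0 l)).
    by apply: is_derive_smooth => //; exact: loc_integrable_coord.
  by apply/funext => z; rewrite mxE.
have chain f Df : partials_on O f Df ->
    is_derive y (unit_vec j) (fun z => f (V e z)) (\sum_(l < n) dU e j l y * Df l (V e y)).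
  by move=> pf; apply: (is_derive_chain pf) => //; apply: (@filterE _ (nbhs (0 : R))) => h; exact: OV.
have dH i := is_derive_smooth j y e0 (lG i j).
have dsum i := is_derive_mulR (phi_d j y)
  (is_derive_mulR (chain _ _ (pB i)) (is_derive_subR (chain _ _ (pG i j)) (dH i))).
have D := is_derive_subR (is_derive_mulR (phi_d j y) (chain _ _ (pQ j)))
  (is_derive_sumR (index_enum 'I_n) dsum).
apply: (@is_derive_eq _ _ _ (potential e j) y (unit_vec j) _ _ D).
rewrite (_ : \sum_(l < n) dU e j l y * DQ j l (V e y) =
    \sum_(i < n) B i (V e y) * \sum_(l < n) dU e j l y * DG i j l (V e y)); last first.
  under eq_bigr => l _ do rewrite compat // mulr_sumr.
  rewrite exchange_big; apply: eq_bigr => i _ /=; rewrite mulr_sumr.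
  by apply: eq_bigr => l _; rewrite mulrCA.
rewrite /flux /dphiB !mulr_sumr.
rewrite -!sumrN -!addrA -big_split [Q j _ * _]mulrC addrCA; congr (_ + _).
rewrite -big_split; apply: eq_bigr => i _ /=; ring.
Qed.

Lemma continuous_flux e j : (forall j, {within O, continuous (Q j)}) ->
  (forall i, {within O, continuous (B i)}) ->
  (forall i j, {within O, continuous (G i j)}) -> 0 < e -> continuous (flux e j).
Proof.
move=> cQ cB cG e0; have OV z : O (V e z) by exact: smooth_vec_in.
have cV := continuous_smooth_vec e0.
have cf (f : 'rV[R]_n -> R) : {within O, continuous f} -> continuous (fun y => f (V e y)).
  by move=> fc; exact: (continuous_within_comp fc cV OV).
have cdU l : continuous (fun y => dU e j l y).
  by apply: continuous_dsmooth => //; exact: loc_integrable_coord.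
have cH i : continuous (fun y => H e i j y) by exact: continuous_smooth.
apply: continuousRD; first apply: continuousRB.
- by apply: continuousRM; [exact: cdphi | exact: cf].
- apply: continuous_sumR => i _; apply: continuousRM; last first.
    by apply: continuousRB; [exact: cf | exact: cH].
  apply: continuousRD; first by apply: continuousRM; [exact: cdphi | exact: cf].
  apply: continuousRM; first exact: cphi.
  by apply: continuous_sumR => l _; apply: continuousRM; [exact: cdU | exact: cf].
- apply: continuousRM; first exact: cphi.
  apply: continuous_sumR => i _; apply: continuousRM; first exact: cf.
  exact: continuous_dsmooth.
Qed.

Context (M2 MB CB Mphi : R) (M2_ge0 : 0 <= M2) (MB_ge0 : 0 <= MB) (CB_ge0 : 0 <= CB)
  (Mphi_ge0 : 0 <= Mphi).
Context (D2G_le : forall i j l l' P, O P -> `|D2G i j l l' P| <= M2)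
  (DB_le : forall i l P, O P -> `|DB i l P| <= MB)
  (B_le : forall i P, O P -> `|B i P| <= CB * (1 + `|P|))
  (phi_le : forall y, `|phi y| <= Mphi) (dphi_le : forall j y, `|dphi j y| <= Mphi).

(** Integrate the bound on the second derivatives from the base point
    [u 0]. *)
Lemma DG_growth : exists2 C, 0 <= C &
  forall i j l P, O P -> `|DG i j l P| <= C * (1 + `|P|).
Proof.
pose o := u 0; have Oo : O o by exact: Ou.
pose S := \sum_i \sum_j \sum_l `|DG i j l o|.
have S0 : 0 <= S by do 3 (apply: sumr_ge0 => ? _).
have DGo i j l : `|DG i j l o| <= S.
  rewrite /S (bigD1 i) //= (bigD1 j) //= (bigD1 l) //= -!addrA lerDl.
  by rewrite !addr_ge0 //; repeat (apply: sumr_ge0 => ? _).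
have nM : 0 <= n%:R * M2 by rewrite mulr_ge0.
exists (S + n%:R * M2 * (1 + `|o|)); first by rewrite addr_ge0 // mulr_ge0 // addr_ge0.
move=> i j l P OP; rewrite -[DG i j l P](subrK (DG i j l o)).
apply: le_trans (ler_normD _ _) _; rewrite addrC mulrDl; apply: lerD.
  by apply: le_trans (DGo i j l) _; rewrite ler_peMr // lerDl.
apply: le_trans (convex_lipschitz cO (pDG i j l) Oo OP (M := M2) _) _.
  by move=> l' P' OP' _; exact: D2G_le.
rewrite [leLHS](_ : _ = n%:R * M2 * `|P - o|); last by ring.
rewrite -[leRHS]mulrA ler_wpM2l //.
apply: le_trans (ler_normB _ _) _; rewrite mulrDl mul1r.
by have := mulr_ge0 (normr_ge0 o) (normr_ge0 P); have := normr_ge0 o; rewrite mulrDr mulr1; lra.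
Qed.

Lemma DQ_growth : exists2 C, 0 <= C &
  forall j l P, O P -> `|DQ j l P| <= C * (1 + `|P|) ^+ 2.
Proof.
have [C C0 DGC] := DG_growth; exists (n%:R * (CB * C)); first by rewrite !mulr_ge0.
move=> j l P OP; rewrite compat //; apply: le_trans (ler_norm_sum _ _ _) _.
apply: (@le_trans _ _ (\sum_(i < n) (CB * C) * (1 + `|P|) ^+ 2)).
  apply: ler_sum => i _; rewrite normrM.
  rewrite (_ : CB * C * _ = (CB * (1 + `|P|)) * (C * (1 + `|P|))); last by ring.
  by rewrite ler_pM // ?B_le ?DGC.
by rewrite sumr_const card_ord -[_ *+ n]mulr_natl mulrA.
Qed.

Let w y := 1 + `|u y|.
Let a e y := avg e (dist_at u y) y.
Let b e y := avg e (fun x => dist_at u y x ^+ 2) y.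

Let w_ge0 y : 0 <= w y. Proof. by rewrite addr_ge0. Qed.
Let a_ge0 e y : 0 < e -> 0 <= a e y. Proof. exact: avg_ge0. Qed.
Let b_ge0 e y : 0 < e -> 0 <= b e y. Proof. exact: avg_ge0. Qed.

(** Mean value theorem between [u y] and [V].  The derivatives of [Q] have
    quadratic growth, and on that segment the norm is at most [|u y|] plus a
    multiple of the first moment. *)
Lemma flux_difference_le : exists2 C, 0 <= C & forall e j y, 0 < e ->
  `|Q j (u y) - Q j (V e y)| <= C * (a e y * w y ^+ 2 + a e y ^+ 3).
Proof.
have [C C0 DQC] := DQ_growth; pose K := @smooth_const R k.
have K0 : 0 <= K by exact: smooth_const_ge0.
exists (2 * n%:R * K * C * (1 + K ^+ 2)); first by rewrite !mulr_ge0 // addr_ge0 // sqr_ge0.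
move=> e j y e0; have OV := smooth_vec_in cO mu_u lu Ou y e0.
have dV : `|V e y - u y| <= K * a e y by exact: smooth_vec_dist.
have a0 := a_ge0 y e0; have Ka0 : 0 <= K * a e y by rewrite mulr_ge0.
rewrite distrC.
apply: le_trans (convex_lipschitz cO (pQ j) (Ou y) OV (M := C * (w y + K * a e y) ^+ 2) _) _.
  move=> l P OP PV; apply: le_trans (DQC j l P OP) _; rewrite ler_wpM2l //.
  rewrite lerXn2r ?nnegrE ?addr_ge0 // /w -addrA lerD2l.
  by rewrite (le_trans (ler_normD_dist P (u y))) // lerD2l (le_trans PV).
have S : (w y + K * a e y) ^+ 2 <= 2 * (w y ^+ 2 + K ^+ 2 * a e y ^+ 2).
  rewrite -subr_ge0 (_ : _ - _ = (w y - K * a e y) ^+ 2); last by ring.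
  exact: sqr_ge0.
apply: (@le_trans _ _ (n%:R * (K * a e y * (C * (2 * (w y ^+ 2 + K ^+ 2 * a e y ^+ 2)))))).
  apply: ler_wpM2l => //; apply: ler_pM => //; first by rewrite mulr_ge0 // sqr_ge0.
  exact: ler_wpM2l.
rewrite [leLHS](_ : _ = 2 * n%:R * K * C * (a e y * w y ^+ 2 + K ^+ 2 * a e y ^+ 3)); last by ring.
rewrite -[leRHS]mulrA ler_wpM2l ?mulr_ge0 //.
have K20 : 0 <= K ^+ 2 by exact: sqr_ge0.
have x0 : 0 <= a e y * w y ^+ 2 by rewrite mulr_ge0 ?sqr_ge0.
have y0 : 0 <= a e y ^+ 3 by rewrite exprn_ge0.
have := mulr_ge0 K20 x0; rewrite mulrDl mul1r mulrDr; lra.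
Qed.

(** The two summands are of different nature: in the first one the derivative
    falls on [phi] and the growth of [B] gives [w] and the moment [a], in the
    second one it falls on [B(V)] and gives [a / e]. *)
Lemma dphiB_le : exists2 C, 0 <= C & forall e i j y, 0 < e ->
  `|dphiB e i j y| <= C * (w y + a e y + a e y / e).
Proof.
pose K := @smooth_const R k; have K0 : 0 <= K by exact: smooth_const_ge0.
pose L := 4 * m%:R * K; have L0 : 0 <= L by rewrite !mulr_ge0.
exists (Mphi * CB * (1 + K) + Mphi * n%:R * L * MB).
  by rewrite addr_ge0 // ?mulr_ge0 // addr_ge0.
move=> e i j y e0; have OV := smooth_vec_in cO mu_u lu Ou y e0.
have dV : `|V e y - u y| <= K * a e y by exact: smooth_vec_dist.
have a0 := a_ge0 y e0; have Ka0 : 0 <= K * a e y by rewrite mulr_ge0.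
have ae0 : 0 <= a e y / e by rewrite divr_ge0 // ltW.
have w0 := w_ge0 y.
have V1 : 1 + `|V e y| <= w y + K * a e y.
  by rewrite /w -addrA lerD2l (le_trans (ler_normD_dist (V e y) (u y))) // lerD2l.
have wK : w y + K * a e y <= (1 + K) * (w y + a e y + a e y / e).
  have h1 := mulr_ge0 K0 w0; have h2 := mulr_ge0 K0 ae0.
  set z := a e y / e in ae0 h2 *.
  rewrite -subr_ge0 (_ : _ - _ = a e y + z + K * w y + K * z); [lra | ring].
apply: le_trans (ler_normD _ _) _; rewrite mulrDl; apply: lerD.
  rewrite normrM; apply: (@le_trans _ _ (Mphi * (CB * (w y + K * a e y)))).
    rewrite ler_pM // (le_trans (B_le i OV)) // ler_wpM2l //.
  rewrite [leRHS](_ : _ = Mphi * (CB * ((1 + K) * (w y + a e y + a e y / e)))); last by ring.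
  by do 2 apply: ler_wpM2l => //.
rewrite normrM [leRHS](_ : _ = Mphi * (n%:R * (L * (MB * (w y + a e y + a e y / e)))));
  last by ring.
apply: ler_pM => //; apply: le_trans (ler_norm_sum _ _ _) _.
apply: (@le_trans _ _ (\sum_(l < n) (L / e * a e y) * MB)).
  apply: ler_sum => l _; rewrite normrM ler_pM // ?DB_le //.
  exact: dsmooth_vec_le.
rewrite sumr_const card_ord -[_ *+ n]mulr_natl; apply: ler_wpM2l => //.
rewrite (_ : L / e * a e y * MB = L * (MB * (a e y / e))); last by ring.
by do 2 apply: ler_wpM2l => //; lra.
Qed.

(** The error terms that remain once the derivatives have been integrated
    away. *)
Let Psi e y : R := \sum_j dphi j y * (Q j (u y) - Q j (V e y)) +
  \sum_j \sum_i dphiB e i j y * (G i j (V e y) - H e i j y).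

(** All the bounds are products of the weight and of the moments [a] and [b]
    of the increments, to which [young_products] applies. *)
Lemma Psi_le : exists2 C, 0 <= C & forall e d y, 0 < e <= 1 -> 0 < d <= 1 ->
  `|Psi e y| <= C * (d * w y ^+ 3 + (d^-1 ^+ 2 + e^-1) * defect u e y).
Proof.
have [C1 C10 C1P] := dphiB_le; have [C3 C30 C3P] := flux_difference_le.
pose K := @smooth_const R k; have K0 : 0 <= K by exact: smooth_const_ge0.
pose C2 := 2 * K * (n%:R ^+ 2 * M2) * (1 + K ^+ 2 * 2 ^+ m).
have C20 : 0 <= C2.
  by rewrite !mulr_ge0 ?sqr_ge0 // addr_ge0 // mulr_ge0 ?sqr_ge0 // exprn_ge0.
pose T : R := 2 ^+ m.
have T1 : 1 <= T by rewrite exprn_ege1 // ler1n.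
exists ((m%:R * (Mphi * C3) + m%:R * (n%:R * (C1 * C2))) * (4 * T ^+ 2)).
  apply: mulr_ge0; last by rewrite mulr_ge0 // sqr_ge0.
  have C12 := mulr_ge0 C10 C20; have MC := mulr_ge0 Mphi_ge0 C30.
  by apply: addr_ge0; [rewrite mulr_ge0 | rewrite mulr_ge0 // mulr_ge0].
move=> e d y e01 d01; have e0 : 0 < e by case/andP: e01.
have OV := smooth_vec_in cO mu_u lu Ou y e0.
have ms := measurable_dist_at mu_u y.
have l3 := loc_integrable_dist3 mu_u lu y.
have s0 := dist_at_ge0 u y.
have [X Y] := young_products T1 (w_ge0 y) (a_ge0 y e0) (b_ge0 y e0) (defect_ge0 u y e0)
  d01 e01 (avg_cube_le y e0 s0 ms l3) (avg_mul_le y e0 s0 ms l3)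
  (avg_weight_le y e0 s0 ms l3 (w_ge0 y) (proj1 (andP d01))).
set Z := d * w y ^+ 3 + _ in X Y *.
have a0 := a_ge0 y e0; have b0 := b_ge0 y e0; have w0 := w_ge0 y.
have ae0 : 0 <= a e y / e by rewrite divr_ge0 // ltW.
apply: le_trans (ler_normD _ _) _; rewrite -mulrA mulrDl; apply: lerD.
  apply: (@le_trans _ _ (\sum_(j < m) Mphi * (C3 * (4 * T ^+ 2 * Z)))).
    apply: le_trans (ler_norm_sum _ _ _) _; apply: ler_sum => j _; rewrite normrM.
    rewrite ler_pM // (le_trans (C3P e j y e0)) // ler_wpM2l //.
  by rewrite sumr_const card_ord -[_ *+ m]mulr_natl -!mulrA.
apply: (@le_trans _ _ (\sum_(j < m) \sum_(i < n) (C1 * C2) * (4 * T ^+ 2 * Z))).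
  apply: le_trans (ler_norm_sum _ _ _) _; apply: ler_sum => j _.
  apply: le_trans (ler_norm_sum _ _ _) _; apply: ler_sum => i _; rewrite normrM.
  apply: (@le_trans _ _ (C1 * (w y + a e y + a e y / e) * (C2 * (b e y + a e y ^+ 2)))).
    rewrite ler_pM // ?C1P //.
    exact: commutator_le (pG i j) (pDG i j) (D2G_le i j) (lG i j).
  by rewrite mulrACA; apply: ler_wpM2l X; exact: mulr_ge0.
rewrite !sumr_const !card_ord -[_ *+ n]mulr_natl -[_ *+ m]mulr_natl.
by rewrite -!mulrA.
Qed.

Context (cQ : forall j, {within O, continuous (Q j)})
  (cB : forall i, {within O, continuous (B i)})
  (cG : forall i j, {within O, continuous (G i j)})
  (lQ : forall j, loc_integrable (Q j \o u)).
Context (K : set 'rV[R]_m) (mK : measurable K) (rK : R) (KrK : forall y, K y -> `|y| < rK)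
  (phiK : forall y, ~ K y -> phi y = 0) (dphiK : forall j y, ~ K y -> dphi j y = 0).

Let K_far y : rK <= `|y| -> ~ K y.
Proof. by move=> ry /KrK; rewrite ltNge ry. Qed.

Lemma flux_far e j y : ~ K y -> flux e j y = 0.
Proof.
move=> nK; rewrite /flux dphiK // phiK // !mul0r big1 ?subrr ?addr0 // => i _.
by rewrite /dphiB dphiK // phiK // !mul0r addr0 mul0r.
Qed.

Lemma integrable_flux e j : 0 < e -> mu.-integrable setT (EFin \o flux e j).
Proof.
move=> e0; apply: (@integrable_bounded_support _ _ _ rK).
  exact: continuous_flux.
by move=> y ry; apply: flux_far; apply: K_far; exact: ltW.
Qed.

Lemma integral_flux e j : 0 < e -> \int[mu]_y flux e j y = 0.
Proof.
move=> e0; rewrite /Rintegral.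
rewrite (_ : (\int[mu]_y (flux e j y)%:E)%E = 0%E) //.
apply: (@integral_partial_support _ _ (potential e j) _ j rK).
- exact: continuous_flux.
- by move=> y; exact: is_derive_potential.
- move=> y ry; split; last by apply: flux_far; exact: K_far.
  rewrite /potential phiK; last exact: K_far.
  by rewrite mul0r big1 ?subrr // => i _; rewrite mul0r.
Qed.

Lemma integrable_dphiQ j : mu.-integrable setT (EFin \o (fun y => dphi j y * Q j (u y))).
Proof.
have d0 z : rK < `|z| -> dphi j z = 0 by move=> /ltW /K_far; exact: dphiK.
have := integrable_kernel 0 (@cdphi j) (dphi_le j) d0 (lQ j).
by apply: eq_integrable => // x _ /=; rewrite subr0.
Qed.

(** Summed over [j], the last term of [flux] is a combination of the
    divergences of the smoothed rows of [G(u)], which vanish. *)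
Lemma flux_decomposition e y : 0 < e ->
  (forall i, \sum_j dsmooth e j (G i j \o u) y = 0) ->
  \sum_j dphi j y * Q j (u y) - \sum_j flux e j y = Psi e y.
Proof.
move=> e0 div0; rewrite /Psi /flux !big_split /= sumrN.
rewrite (_ : \sum_j phi y * _ = 0); last first.
  rewrite -mulr_sumr exchange_big big1 ?mulr0 // => i _ /=.
  by rewrite -mulr_sumr div0 mulr0.
rewrite addr0 opprB addrCA addrC; congr (_ + _).
by rewrite -sumrB; apply: eq_bigr => j _; rewrite mulrBr.
Qed.

(** Each [flux] integrates to 0 as a derivative of a compactly supported
    function, so the integral of [\sum_j d_j phi Q_j(u)] equals that of [Psi],
    which vanishes off [K]. *)
Lemma companion_estimate : exists2 C, 0 <= C & forall e d, 0 < e <= 1 -> 0 < d <= 1 ->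
  (forall y i, K y -> \sum_j dsmooth e j (G i j \o u) y = 0) ->
  mu.-integrable K (EFin \o defect u e) ->
  `|\int[mu]_y \sum_j dphi j y * Q j (u y)| <=
    C * (d + (d^-1 ^+ 2 + e^-1) * \int[mu]_(y in K) defect u e y).
Proof.
have [C C0 CP] := Psi_le.
have lw : loc_integrable (fun y => w y ^+ 3).
  apply: (@loc_integrable_growth _ _ _ u lu _ 4).
    apply: measurable_funX; apply: measurable_funD; first exact: measurable_cst.
    exact: measurable_norm_rV.
  move=> y; rewrite ger0_norm ?exprn_ge0 //.
  by apply: le_trans (cubeD_le _ _) _ => //; rewrite expr1n.
have iw : mu.-integrable K (EFin \o (fun y => w y ^+ 3)).
  apply: integrableS (lw.2 rK) => //; first exact: measurable_closed_cube.
  by move=> y /KrK /ltW.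
pose W := \int[mu]_(y in K) w y ^+ 3.
have W0 : 0 <= W by apply: Rintegral_ge0 => y _; rewrite exprn_ge0.
exists (C * (1 + W)); first by rewrite mulr_ge0 // addr_ge0.
move=> e d e01 d01 div0 iD; have e0 : 0 < e by case/andP: e01.
have d0 : 0 < d by case/andP: d01.
pose X := d^-1 ^+ 2 + e^-1.
have X0 : 0 <= X by rewrite addr_ge0 ?sqr_ge0 // invr_ge0 ltW.
have iflux : mu.-integrable setT (EFin \o (fun y => \sum_j flux e j y)).
  by apply: integrableR_sum => j _; exact: integrable_flux.
have iQ : mu.-integrable setT (EFin \o (fun y => \sum_j dphi j y * Q j (u y))).
  by apply: integrableR_sum => j _; exact: integrable_dphiQ.
have flux0 : \int[mu]_y (\sum_j flux e j y) = 0.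
  rewrite Rintegral_sum; last by move=> j _; exact: integrable_flux.
  by rewrite big1 // => j _; exact: integral_flux.
rewrite (_ : \int[mu]_y _ =
    \int[mu]_y (\sum_j dphi j y * Q j (u y) - \sum_j flux e j y)); last first.
  by rewrite RintegralB // flux0 subr0.
have idiff := integrableRB iQ iflux.
apply: le_trans (le_normr_Rintegral measurableT idiff) _.
have D0 : 0 <= \int[mu]_(y in K) defect u e y.
  by apply: Rintegral_ge0 => y _; exact: defect_ge0.
have iw' := integrableZl mK d iw; have iD' := integrableZl mK X iD.
have ibound := integrableZl mK C (integrableD mK iw' iD').
apply: (@le_trans _ _ (\int[mu]_(y in K) (C * (d * w y ^+ 3 + X * defect u e y)))).
  rewrite [leRHS]Rintegral_mkcond; apply: le_Rintegral => //.
  - exact: integrable_norm idiff.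
  - by rewrite -restrict_EFin; apply/(integrable_mkcond _ mK); exact: ibound.
  - move=> y _; rewrite /patch; case: ifPn => [|]; rewrite ?notin_setE ?inE => Ky.
      by rewrite flux_decomposition //; [exact: CP | move=> i; exact: div0].
    rewrite big1 ?big1 ?subrr ?normr0 // => j _; first exact: flux_far.
    by rewrite dphiK // mul0r.
rewrite RintegralZl //; last exact: (integrableD mK iw' iD').
rewrite -mulrA ler_wpM2l // RintegralD //.
rewrite (@RintegralZl _ _ _ _ _ _ d mK iw) (@RintegralZl _ _ _ _ _ _ X mK iD) -/W.
have W1 : 0 <= W * (X * \int[mu]_(y in K) defect u e y) by rewrite !mulr_ge0.
have X1 : 0 <= X * \int[mu]_(y in K) defect u e y by rewrite mulr_ge0.
rewrite -/X [leRHS](_ : _ = d + X * \int[mu]_(y in K) defect u e y +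
  (d * W + W * (X * \int[mu]_(y in K) defect u e y))); last by ring.
lra.
Qed.

End companion.

(** * Test functions and neighbourhoods of the support *)

Lemma is_derive_scale (R : realType) (V W : normedModType R) (f : V -> R) (w : W)
    x v d : is_derive x v f d -> is_derive x v (fun y => f y *: w) (d *: w).
Proof.
move=> [df dE].
have main : (fun h : R => h^-1 *: (((fun y => f y *: w) \o shift x) (h *: v) - f x *: w)) @ 0^'
    --> d *: w.
  rewrite (_ : (fun h => _) = fun h => (h^-1 *: ((f \o shift x) (h *: v) - f x)) *: w).
    by apply: cvgZr_tmp; rewrite -dE; exact: df.
  by apply/funext => h /=; rewrite -scalerBl scalerA.
by apply: DeriveDef; [apply/cvg_ex; eexists; exact: main | exact: cvg_lim main].
Qed.

Section test_function.
Context {R : realType} {k : nat}.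
Notation m := k.+1.
Implicit Types (x y : 'rV[R]_m) (e : R).

Lemma differentiable_bump_shift e y x : differentiable (fun x : 'rV[R]_m => bump e (x - y)) x.
Proof.
have dq : differentiable (fun x : 'rV[R]_m => e ^+ 2 - dot (x - y) (x - y)) x.
  have dc i : differentiable (fun x : 'rV[R]_m => x ord0 i - y ord0 i) x.
    by apply: differentiableB; [exact: differentiable_coord | exact: differentiable_cst].
  have -> : (fun x : 'rV[R]_m => e ^+ 2 - dot (x - y) (x - y)) =
     cst (e ^+ 2) - \sum_(i < m) (fun x : 'rV[R]_m => (x ord0 i - y ord0 i) * (x ord0 i - y ord0 i)).
    apply/funext => z; rewrite /dot !fctE fct_sumE; congr (_ - _).
    by apply: eq_bigr => i _; rewrite !mxE.
  apply: differentiableB; first exact: differentiable_cst.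
  by apply: differentiable_sum => i; exact: differentiableM.
exact: (differentiable_comp dq (differentiable_max0_sqr _)).
Qed.

Lemma closed_ball_rV y e : closed [set x : 'rV[R]_m | `|x - y| <= e].
Proof.
apply: (@closed_comp _ _ (fun x : 'rV[R]_m => `|x - y|) [set t | t <= e]); last exact: closed_le.
move=> x _; apply: (@continuous_shift R k (fun z => `|z|)).
by move=> z; exact: norm_continuous.
Qed.

Lemma compact_ball_rV y e : compact [set x : 'rV[R]_m | `|x - y| <= e].
Proof.
apply: bounded_closed_compact; last exact: closed_ball_rV.
exists (`|y| + e); split; first exact: num_real.
move=> M yM x /= xy; apply: le_trans (ltW yM).
by rewrite (le_trans (ler_normD_dist x y)) // lerD2l.
Qed.

Lemma partial_bump_scale n e y j (w : 'rV[R]_n) x : 0 < e ->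
  partial j (fun x => bump e (x - y) *: w) x = dbump e (unit_vec j) (x - y) *: w.
Proof.
move=> e0.
have D : is_derive x (unit_vec j) (fun x => bump e (x - y)) (dbump e (unit_vec j) (x - y)).
  apply/(@is_derive_affine _ _ _ _ (bump e) (fun x => x - y) x _ (unit_vec j)).
    by move=> h; rewrite addrA.
  exact: is_derive_bump.
by have [_ <-] := is_derive_scale w D.
Qed.

Lemma test_function_C1c n (X : set 'rV[R]_m) e y (w : 'rV[R]_n) : 0 < e ->
  (forall x, `|x - y| <= e -> X x) -> C1c X (fun x => bump e (x - y) *: w).
Proof.
move=> e0 eX; split.
- move=> x; apply: differentiableZl; exact: differentiable_bump_shift.
- move=> j.
  rewrite (_ : partial j _ = fun x => dbump e (unit_vec j) (x - y) *: w); last first.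
    by apply/funext => x; exact: partial_bump_scale.
  have c := @continuous_shift R k _ y (@continuous_dbump R m e (unit_vec j)).
  by move=> x; exact: (@cvgZr_tmp _ _ _ (nbhs x) (nbhs_filter x) _ _ w (c x)).
- have sub : closure [set x | bump e (x - y) *: w != 0] `<=` [set x | `|x - y| <= e].
    rewrite [X in _ `<=` X](closure_id _).1; last exact: closed_ball_rV.
    apply: closureS => x /= b0; rewrite leNgt; apply/negP => ex.
    by move: b0; rewrite bump_eq0 // scale0r eqxx.
  split; last by move=> x /sub; exact: eX.
  by apply: subclosed_compact sub; [exact: closed_closure | exact: compact_ball_rV].
Qed.

(** Up to sign and normalisation, the divergence at [y] of the smoothed row
    [i] is the integral of [G(u)] against the derivatives of the translated
    bump in the [i]-th component, and this bump is an admissible test function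
    as its support is in [X]. *)
Lemma weak_div_free n (X : set 'rV[R]_m) (G : 'rV[R]_n -> 'M[R]_(n, m))
    (U u : 'rV[R]_m -> 'rV[R]_n) e y (i : 'I_n) : 0 < e ->
  weak_sol_system X G U -> (forall x, `|x - y| <= e -> X x /\ u x = U x) ->
  (forall j, loc_integrable (fun x => G (u x) i j)) ->
  \sum_j dsmooth e j (fun x => G (u x) i j) y = 0.
Proof.
move=> e0 weak eX lG.
have /weak := @test_function_C1c n X e y (delta_mx ord0 i) e0 (fun x xy => (eX x xy).1).
rewrite integral_mkcond (_ : _ \_ X =
    fun x => (\sum_j dbump e (unit_vec j) (x - y) * G (u x) i j)%:E); last first.
  apply/funext => x; rewrite /patch.
  under eq_bigr => i' _ do under eq_bigr => j _ do rewrite partial_bump_scale // mxE.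
  have [xe|ex] := leP `|x - y| e.
    have [Xx uU] := eX x xe; rewrite mem_set //; congr (_%:E).
    rewrite (bigD1 i) //= [X in _ + X]big1 ?addr0 => [|i' /negbTE i'i].
      by apply: eq_bigr => j _; rewrite mxE !eqxx mulr1 mulrC uU.
    by rewrite big1 // => j _; rewrite mxE i'i andbF !mulr0.
  rewrite [in RHS]big1 => [|j _]; last by rewrite dbump_eq0 // mul0r.
  case: ifP => // _; congr (_%:E); rewrite big1 // => i' _; rewrite big1 // => j _.
  by rewrite dbump_eq0 // mul0r mulr0.
move=> H; rewrite /dsmooth sumrN -mulr_sumr /mollify.
rewrite -Rintegral_sum; last by move=> j _; exact: dbump_integrable.
by rewrite /Rintegral H mulr0 oppr0.
Qed.

End test_function.

Lemma compact_open_margin (R : realType) m (K X : set 'rV[R]_m) :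
  compact K -> open X -> K `<=` X ->
  exists2 r : R, 0 < r & forall y x, K y -> `|x - y| < r -> X x.
Proof.
move=> cK oX KX.
have near_K : \forall r \near (0 : R)^'+, K `<=` (fun y => forall x, `|x - y| < r -> X x).
  move/compact_near_coveringP : cK; apply => y Ky.
  have /nbhs_ballP[r /= r0 yr] : nbhs y X by apply: open_nbhs_nbhs; split => //; exact: KX.
  have r20 : 0 < r / 2 by lra.
  exists (ball y (r / 2), [set t | t < r / 2]) => /=.
    split; first exact: nbhsx_ballx.
    exact: nbhs_right_lt.
  move=> [y' t] /= [yy' tr] x xy'; apply: yr.
  rewrite mx_norm_ball /ball_ /= in yy' *.
  have := ler_normD (y - y') (y' - x); rewrite subrKA [`|y' - x|]distrC; lra.
have pos : \forall r \near (0 : R)^'+, 0 < r by exact: nbhs_right_gt.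
have [r [rK r0]] : exists r, (K `<=` (fun y => forall x, `|x - y| < r -> X x)) /\ 0 < r.
  by apply: (@filter_ex _ (0 : R)^'+); exact: filterI.
by exists r => // y x Ky; exact: rK.
Qed.

Section neighbourhood.
Context {R : realType} {m : nat} (K : set 'rV[R]_m).

Definition fatten (r : R) : set 'rV[R]_m := [set x | exists2 y, K y & `|x - y| < r].

Lemma open_fatten r : open (fatten r).
Proof.
rewrite openE => x [y Ky xy]; apply/nbhs_ballP; exists (r - `|x - y|) => /=; first by rewrite subr_gt0.
move=> z; rewrite mx_norm_ball /ball_ /= => xz; exists y => //.
have := ler_normD (z - x) (x - y); rewrite subrKA [`|z - x|]distrC; lra.
Qed.

Lemma fatten_compactly_inside r (X : set 'rV[R]_m) : compact K -> 0 < r ->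
  (forall y x, K y -> `|x - y| < 2 * r -> X x) -> compactly_inside (fatten r) X.
Proof.
move=> cK r0 KX; have [M [_ KM]] := compact_bounded cK.
have clo x : closure (fatten r) x -> exists2 y, K y & `|x - y| < 2 * r.
  move=> /(_ (ball x r) (nbhsx_ballx x r r0))[z [[y Ky zy]]].
  rewrite mx_norm_ball /ball_ /= => xz; exists y => //.
  have := ler_normD (x - z) (z - y); rewrite subrKA; lra.
split; last by move=> x /clo[y Ky xy]; exact: KX xy.
apply: bounded_closed_compact; last exact: closed_closure.
exists (`|M| + 1 + 2 * r); split; first exact: num_real.
move=> N MN x /= /clo[y Ky xy]; apply: le_trans (ltW MN).
apply: le_trans (ler_normD_dist x y) _; apply: lerD; last exact: ltW.
by apply: KM => //; rewrite (le_lt_trans (ler_norm M)) // ltrDl.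
Qed.

(** A point of [K] and a point at distance less than [r] from it are both in
    the open set [fatten r], so the second one is not on the boundary. *)
Lemma fatten_boundary r : (r%:E <= edist_set K (boundary (fatten r)))%E.
Proof.
apply: le_ereal_inf_tmp => _ /= [y Ky [z [_ nz] <-]]; rewrite lee_fin.
rewrite leNgt; apply/negP => yz; apply: nz.
have zr : fatten r z.
  by exists y => //; rewrite distrC; exact: le_lt_trans (normr_le_enorm _) yz.
by move: zr (@open_fatten r); rewrite openE => zr /(_ z zr).
Qed.

End neighbourhood.

(** * Passage to the limit *)

Lemma entry_le_enorm (R : realType) p q (A : 'M[R]_(p, q)) i j : `|A i j| <= enorm A.
Proof.
have sq0 i' : 0 <= \sum_(j' < q) A i' j' ^+ 2 by apply: sumr_ge0 => j' _; exact: sqr_ge0.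
rewrite /enorm -sqrtr_sqr ler_sqrt; last by apply: sumr_ge0 => i' _.
rewrite (bigD1 i) //= (bigD1 j) //= -addrA lerDl addr_ge0 //.
  by apply: sumr_ge0 => j' _; exact: sqr_ge0.
by apply: sumr_ge0 => i' _.
Qed.

(** Second order expansion at a base point [o]: [f] grows at most
    quadratically, and powers up to the third are bounded by
    [1 + |P - o|^3]. *)
Lemma cubic_growth (R : realType) n (O : set 'rV[R]_n) (f : 'rV[R]_n -> R) Df D2f o M :
  convex_set (O : set (convex_lmodType 'rV[R]_n)) -> partials_on O f Df ->
  (forall l, partials_on O (Df l) (D2f l)) -> O o -> 0 <= M ->
  (forall l l' P, O P -> `|D2f l l' P| <= M) ->
  exists C, forall P, O P -> `|f P| <= C * (1 + `|P| ^+ 3).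
Proof.
move=> cO pf pDf Oo M0 DM.
pose S := \sum_(l < n) `|Df l o|.
have S0 : 0 <= S by apply: sumr_ge0 => l _.
pose A := `|f o| + n%:R * S + n%:R ^+ 2 * M.
have nS : 0 <= n%:R * S by rewrite mulr_ge0.
have nM : 0 <= n%:R ^+ 2 * M by rewrite mulr_ge0 // sqr_ge0.
have A0 : 0 <= A by rewrite !addr_ge0.
exists (A * (5 + 4 * `|o| ^+ 3)) => P OP.
have tP : `|P - o| <= `|P| + `|o| by exact: ler_normB.
have t0 : 0 <= `|P - o| by [].
have taylor := convex_taylor cO pf pDf Oo OP DM.
have lin : `|\sum_(l < n) (P - o) ord0 l * Df l o| <= n%:R * (`|P - o| * S).
  apply: sum_coord_le => l; rewrite /S (bigD1 l) //= lerDl.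
  by apply: sumr_ge0 => l' _.
set L := \sum_(l < n) _ in taylor lin.
have fA : `|f P| <= A * (1 + `|P - o| ^+ 3).
  apply: (@le_trans _ _ (`|f o| + n%:R * (`|P - o| * S) + n%:R ^+ 2 * M * `|P - o| ^+ 2)).
    rewrite [f P](_ : _ = f o + L + (f P - f o - L)); last by ring.
    by apply: le_trans (ler_normD _ _) (lerD _ taylor); apply: le_trans (ler_normD _ _) (lerD _ lin).
  rewrite /A !mulrDl; apply: lerD; first apply: lerD.
  - by rewrite ler_peMr // lerDl exprn_ge0.
  - by rewrite -mulrA ler_wpM2l // mulrC ler_wpM2l // (@expr_le_cube _ _ 1).
  - by rewrite ler_wpM2l // (@expr_le_cube _ _ 2).
apply: le_trans fA _; rewrite -mulrA ler_wpM2l //.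
have c : `|P - o| ^+ 3 <= 4 * (`|P| ^+ 3 + `|o| ^+ 3).
  by apply: le_trans (cubeD_le _ _) => //; rewrite lerXn2r ?nnegrE // addr_ge0.
have P3 : 0 <= `|P| ^+ 3 by rewrite exprn_ge0.
have o3 : 0 <= `|o| ^+ 3 by rewrite exprn_ge0.
have := mulr_ge0 o3 P3; rewrite mulrDl !mulrDr; lra.
Qed.

(** Given [h > 0], first fix [d] with [C d <= h / 2]; the other term is then
    at most a constant times [omega e], which is below [h / 2] for small
    [e]. *)
Lemma vanishing_by_scales (R : realType) (I C T e0 : R) (omega : R -> R) :
  0 <= C -> 0 <= T -> 0 < e0 -> omega e @[e --> 0^'+] --> 0 -> (forall e, 0 <= omega e) ->
  (forall e d, 0 < e < e0 -> e <= 1 -> 0 < d <= 1 ->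
    `|I| <= C * (d + (d^-1 ^+ 2 + e^-1) * (T * (omega e * e)))) -> I = 0.
Proof.
move=> C0 T0 e00 om0 om_ge0 IC; apply/eqP; rewrite -normr_le0; apply/ler_addgt0Pr => h h0.
rewrite add0r.
(* the denominator avoids a division by zero when [C = 0] *)
pose d := Num.min 1 (h / (2 * (C + 1))).
have C1 : 0 < 2 * (C + 1) by rewrite mulr_gt0 // ltr_wpDl.
have d0 : 0 < d by rewrite lt_min ltr01 divr_gt0.
have d1 : d <= 1 by rewrite ge_min lexx.
have dh : C * d <= h / 2.
  apply: (@le_trans _ _ ((C + 1) * (h / (2 * (C + 1))))).
    by rewrite ler_pM ?(ltW d0) // ?lerDl // ge_min lexx orbT.
  by rewrite le_eqVlt; apply/orP; left; apply/eqP; field; rewrite gt_eqF // ltr_wpDl.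
pose A := C * (d^-1 ^+ 2 + 1) * T.
have A0 : 0 <= A by rewrite !mulr_ge0 // addr_ge0 // sqr_ge0.
have A1 : 0 < A + 1 by rewrite ltr_wpDl.
have om_small : \forall e \near 0^'+, omega e <= h / 2 / (A + 1).
  have hA : 0 < h / 2 / (A + 1) by rewrite divr_gt0 // divr_gt0.
  move/cvgr0Pnorm_le : om0 => /(_ _ hA); apply: filterS => e.
  exact: le_trans (ler_norm _).
have [e [/= oe ee1 ee0 pe]] : exists e, [/\ omega e <= h / 2 / (A + 1), e < 1, e < e0 & 0 < e].
  near (0 : R)^'+ => e; exists e; split.
  - by near: e.
  - by near: e; exact: nbhs_right_lt.
  - by near: e; exact: nbhs_right_lt.
  - by near: e; exact: nbhs_right_gt.
have := IC e d; rewrite pe ee0 d0 d1 => /(_ isT (ltW ee1) isT) /le_trans; apply.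
rewrite mulrDr [leRHS](_ : h = h / 2 + h / 2); last by field.
apply: lerD => //.
apply: (@le_trans _ _ (A * omega e)).
  rewrite (_ : (_ + e^-1) * (T * (omega e * e)) = (d^-1 ^+ 2 * e + 1) * (T * omega e)); last first.
    by field; rewrite !gt_eqF.
  rewrite [leRHS](_ : _ = C * ((d^-1 ^+ 2 + 1) * (T * omega e))); last by rewrite /A; ring.
  apply: ler_wpM2l => //; apply: ler_wpM2r; first by rewrite mulr_ge0.
  by apply: lerD => //; apply: ler_piMr; [exact: sqr_ge0 | exact: ltW].
apply: (@le_trans _ _ ((A + 1) * omega e)); first by rewrite ler_wpM2r // lerDl.
by rewrite mulrC -ler_pdivlMr.
Unshelve. all: by end_near. Qed.

Section test_data.
Context {R : realType} {k : nat}.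
Notation m := k.+1.
Context (X : set 'rV[R]_m) (psi : 'rV[R]_m -> R) (C1psi : C1c X psi).

Notation K := (closure [set x | psi x != 0]).

Lemma test_function_off_support x : ~ K x -> psi x = 0.
Proof. by move=> nK; apply: contra_notP nK => /eqP p0; exact: subset_closure. Qed.

(** The complement of the closed support is open, so [psi] vanishes in a
    neighbourhood of the point. *)
Lemma partial_off_support j x : ~ K x -> partial j psi x = 0.
Proof.
move=> nK; rewrite /partial (@near_eq_derive _ _ _ psi (cst 0)) ?derive_cst //.
have : nbhs x (~` K) by apply: open_nbhs_nbhs; split => //; exact/closed_openC/closed_closure.
by apply: filterS => y; exact: test_function_off_support.
Qed.

Lemma test_function_derive j x : is_derive x (unit_vec j) psi (partial j psi x).
Proof. by case: C1psi => dpsi _ _; apply: DeriveDef => //; exact: diff_derivable. Qed.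

Lemma test_function_continuous : continuous psi.
Proof. by case: C1psi => dpsi _ _ x; exact: differentiable_continuous. Qed.

Lemma support_bounded : exists r, forall y, K y -> `|y| < r.
Proof.
case: C1psi => _ _ [cK _]; have [M [_ KM]] := compact_bounded cK.
exists (`|M| + 2) => y Ky; apply: (@le_lt_trans _ _ (`|M| + 1)); last by rewrite ltrD2l ltr1n.
by apply: KM => //; rewrite (le_lt_trans (ler_norm M)) // ltrDl.
Qed.

Lemma test_function_bounded : exists2 M, 0 <= M &
  (forall y, `|psi y| <= M) /\ (forall j y, `|partial j psi y| <= M).
Proof.
case: (C1psi) => _ cpart _; have [r Kr] := support_bounded.
have [M M0 psiM] := continuous_bounded_on_cube r test_function_continuous.
have /choice[N NP] j : exists N, 0 <= N /\ forall x, `|x| <= r -> `|partial j psi x| <= N.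
  by have [N ? ?] := continuous_bounded_on_cube r (cpart j); exists N.
have N0 : 0 <= \sum_j N j by apply: sumr_ge0 => j _; exact: (NP j).1.
exists (M + \sum_j N j); first exact: addr_ge0.
split=> [y|j y]; (have [Ky|nK] := pselect (K y); last first).
- by rewrite test_function_off_support // normr0 addr_ge0.
- by apply: le_trans (psiM y (ltW (Kr y Ky))) _; rewrite lerDl.
- by rewrite partial_off_support // normr0 addr_ge0.
- apply: le_trans ((NP j).2 y (ltW (Kr y Ky))) _; rewrite (bigD1 j) //= addrCA lerDl addr_ge0 //.
  by apply: sumr_ge0 => j' _; exact: (NP j').1.
Qed.

End test_data.

Section extension.
Context {R : realType} {k n : nat}.
Notation m := k.+1.
Notation mu := (lebesgue_rV R m).
Context (Y : set 'rV[R]_m) (U : 'rV[R]_m -> 'rV[R]_n) (o : 'rV[R]_n).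
Context (mY : measurable Y) (U3 : in_L3 Y U).

(** A constant value [o] taken in the convex set keeps all the values in that
    set. *)
Definition extension x := if x \in Y then U x else o.

Lemma extensionE x : Y x -> extension x = U x.
Proof. by move=> Yx; rewrite /extension mem_set. Qed.

Lemma measurable_extension : measurable_fun setT extension.
Proof.
apply: measurable_fun_if => //.
- apply: (measurable_fun_bool true); rewrite setTI (_ : _ @^-1` _ = Y) //.
  by apply/seteqP; split => x /=; [move/set_mem | move/mem_set].
- apply: measurable_funS (U3.1) => // x [_ /set_mem]; exact.
Qed.

(** Dominated by the extension of [enorm U ^ 3] by 0, plus a constant. *)
Lemma loc_integrable_extension : loc_integrable (fun x => `|extension x| ^+ 3).
Proof.
have iE : mu.-integrable setT (EFin \o ((fun x => enorm (U x) ^+ 3) \_ Y)).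
  by rewrite -restrict_EFin; apply/(integrable_mkcond _ mY); exact: U3.2.
have lE : loc_integrable ((fun x => enorm (U x) ^+ 3) \_ Y).
  split; first exact: measurable_integrableR iE.
  by move=> r; apply: integrableS iE => //; exact: measurable_closed_cube.
have lD := loc_integrableD lE (loc_integrable_cst (`|o| ^+ 3)).
apply: le_loc_integrable lD.
  by apply: measurable_funX; apply: measurable_norm_rV; exact: measurable_extension.
move=> x; rewrite ger0_norm ?exprn_ge0 // /extension /patch /cst.
have e0 : 0 <= enorm (U x) by rewrite enormE sqrtr_ge0.
case: ifP => _; last by rewrite add0r.
by apply: ler_wpDr; rewrite ?exprn_ge0 // lerXn2r ?nnegrE // normr_le_enorm.
Qed.

End extension.

Section defect_bound.
Context {R : realType} {k n : nat}.
Notation m := k.+1.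
Notation mu := (lebesgue_rV R m).
Context (K : set 'rV[R]_m) (u v : 'rV[R]_m -> 'rV[R]_n).
Context (mK : measurable K) (mu_u : measurable_fun setT u)
  (lu : loc_integrable (fun x => `|u x| ^+ 3)).

Lemma integral_defect_le e c : 0 < e ->
  (forall y x, K y -> `|x - y| < e -> v x = u x) ->
  (\int[mu]_(y in K) (((fine (mu (eball y e)))^-1)%:E *
     \int[mu]_(x in eball y e) (enorm (v y - v x) ^+ 3)%:E) <= c%:E)%E ->
  mu.-integrable K (EFin \o defect u e) /\
  \int[mu]_(y in K) defect u e y <= 2 ^+ m * c.
Proof.
move=> e0 vu vc; have T0 : 0 < 2 ^+ m :> R by rewrite exprn_gt0.
have le1 : (\int[mu]_(y in K) ((2 ^+ m)^-1 * defect u e y)%:E <= c%:E)%E.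
  apply: (le_trans _ vc); apply: ge0_le_integral_any => y Ky.
    by rewrite lee_fin mulr_ge0 ?defect_ge0 // invr_ge0 ltW.
  apply: defect_le_mean => //.
  - exact: loc_integrable_dist3.
  - by move=> x xy; apply: (vu y) => //; exact: le_lt_trans (normr_le_enorm _) xy.
  - by apply: (vu y) => //; rewrite subrr normr0.
have md : measurable_fun K (EFin \o defect u e).
  by apply/measurable_EFinP; apply: measurable_funTS; exact: measurable_defect.
have le2 : (\int[mu]_(y in K) (defect u e y)%:E <= (2 ^+ m * c)%:E)%E.
  move: le1; under eq_integral => y _ do rewrite EFinM.
  rewrite (ge0_integralZl_EFin mu mK _ md) ?invr_ge0 ?(ltW T0) //; last first.
    by move=> y _; rewrite lee_fin defect_ge0.
  by rewrite lee_pdivrMl // EFinM.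
have pos : (0 <= \int[mu]_(y in K) (defect u e y)%:E)%E.
  by apply: integral_ge0 => y _; rewrite lee_fin defect_ge0.
split.
  apply/integrableP; split => //.
  under eq_integral => y _ do rewrite /= ger0_norm ?defect_ge0 //.
  by rewrite (le_lt_trans le2) // ltry.
rewrite -lee_fin /Rintegral fineK // ge0_fin_numE //.
by rewrite (le_lt_trans le2) // ltry.
Qed.

End defect_bound.

Theorem theorem3p1 (R : realType) (n k : nat)
    (X : set 'rV[R]_k.+1) (O : set 'rV[R]_n)
    (G : 'rV[R]_n -> 'M[R]_(n, k.+1))
    (DG : 'I_n -> 'rV[R]_n -> 'M[R]_(n, k.+1))
    (D2G : 'I_n -> 'I_n -> 'rV[R]_n -> 'M[R]_(n, k.+1))
    (Q : 'rV[R]_n -> 'rV[R]_k.+1) (DQ : 'I_n -> 'rV[R]_n -> 'rV[R]_k.+1)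
    (B : 'rV[R]_n -> 'rV[R]_n) (DB : 'I_n -> 'rV[R]_n -> 'rV[R]_n)
    (U : 'rV[R]_k.+1 -> 'rV[R]_n) :
  open X ->
  convex_set (O : set (convex_lmodType 'rV[R]_n)) ->
  C2_on (closure O) G DG D2G ->
  C1_on O Q DQ ->
  C1_on O B DB ->
  (exists M : R, forall V i, O V -> enorm (DB i V) <= M) ->
  (exists C : R, forall V, O V ->
     enorm (B V) <= C * (1 + enorm V) /\
     enorm (Q V) <= C * (1 + enorm V ^+ 3)) ->
  (exists M : R, forall V i j, O V -> enorm (D2G i j V) <= M) ->
  (forall V (j : 'I_k.+1) (l : 'I_n), O V ->
     DQ l V ord0 j = \sum_(i < n) B V ord0 i * DG l V i j) ->
  (forall x, X x -> O (U x)) ->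
  weak_sol_system X G U ->
  (forall X1 : set 'rV[R]_k.+1, open X1 -> compactly_inside X1 X ->
     besov_vmo X1 U) ->
  weak_sol_scalar X Q U.
Proof.
move=> oX cO [[pG cDG] pDG] [pQ cDQ] [pB cDB] [M1 DB_le] [C growth] [M2 D2G_le] compat UO weakG besov.
move=> psi C1psi.
have [X0|] := pselect (X !=set0); last first.
  by move/set0P/negP/negPn/eqP => ->; rewrite integral_set0.
have [x0 Xx0] := X0; pose o := U x0; have Oo : O o by exact: UO.
pose K := closure [set x | psi x != 0].
have [cK KX] : compactly_inside [set x | psi x != 0] X by case: C1psi.
have clK : closed K by exact: closed_closure.
have mK : measurable K by exact: closed_measurable_rV.
have [r0 r0_gt0 Kr0] := compact_open_margin cK oX KX.
(* half of the margin is spent on [Y], so that the closure of [Y] is in [X];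
   within [Y], radii up to [r / 2] are allowed by the Besov condition on [K] *)
pose r := r0 / 2; have r_gt0 : 0 < r by rewrite divr_gt0.
pose Y := fatten K r; have oY : open Y by exact: open_fatten.
have YX : compactly_inside Y X.
  apply: fatten_compactly_inside => // y x Ky xy; apply: (Kr0 y) => //.
  by move: xy; rewrite /r mulrCA divff // mulr1.
have subYX x : Y x -> X x by move=> Yx; apply: YX.2; exact: subset_closure.
have [U3 /(_ K mK)[|omega [om_ge0 om0 besovK]]] := besov Y oY YX.
  rewrite /compactly_inside -(closure_id K).1 //; split => // y Ky.
  by exists y => //; rewrite subrr normr0.
have mY : measurable Y by exact: open_measurable_rV.
pose u := extension Y U o.
have mu_u : measurable_fun setT u by exact: measurable_extension.
have lu : loc_integrable (fun x => `|u x| ^+ 3) by exact: loc_integrable_extension.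
have Ou x : O (u x).
  by rewrite /u /extension; case: ifP => // /set_mem Yx; apply/UO/subYX.
have near_u y x : K y -> `|x - y| < r -> X x /\ u x = U x.
  move=> Ky xy; have Yx : Y x by exists y.
  by split; [exact: subYX | exact: extensionE].
pose g i j V := G V i j; pose Dg i j l V := DG l V i j.
pose D2g i j l l' V := D2G l l' V i j.
pose q j V := Q V ord0 j; pose Dq j l V := DQ l V ord0 j.
pose b i V := B V ord0 i; pose Db i l V := DB l V ord0 i.
have subO : O `<=` closure O by exact: subset_closure.
have pg i j : partials_on O (g i j) (Dg i j) by exact/partials_on_coord/(partials_onS subO).
have pDg i j l : partials_on O (Dg i j l) (D2g i j l).
  exact/partials_on_coord/(partials_onS subO)/(pDG l).1.
have pq j : partials_on O (q j) (Dq j) by exact: partials_on_coord.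
have pb i : partials_on O (b i) (Db i) by exact: partials_on_coord.
have cDb i l : {within O, continuous (Db i l)}.
  apply/subspace_continuousP => V OV.
  move/subspace_continuousP : (cDB l) => /(_ V OV) cV.
  exact: (cvg_comp _ _ cV (@coord_continuous R 1 n ord0 i _)).
(* when [n = 0] the bounds on [DB] and [D2G] are vacuous and may be negative *)
have max0 (M : R) : 0 <= Num.max M 0 by rewrite le_max lexx orbT.
have max_ge (M t : R) : t <= M -> t <= Num.max M 0 by move=> tM; rewrite le_max tM.
have D2g_le i j l l' P : O P -> `|D2g i j l l' P| <= Num.max M2 0.
  by move=> OP; apply/max_ge/(le_trans (entry_le_enorm _ i j)); exact: D2G_le.
have Db_le i l P : O P -> `|Db i l P| <= Num.max M1 0.
  by move=> OP; apply/max_ge/(le_trans (entry_le_enorm _ ord0 i)); exact: DB_le.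
pose c := Num.max C 0; have c0 : 0 <= c by exact: max0.
have Cc : C <= c by rewrite le_max lexx.
have enorm_ge0 (P : 'rV[R]_n) : 0 <= enorm P by rewrite enormE sqrtr_ge0.
have N0 : 0 <= c * (1 + n%:R) by rewrite mulr_ge0 // addr_ge0.
have b_le i P : O P -> `|b i P| <= c * (1 + n%:R) * (1 + `|P|).
  move=> OP; apply: le_trans (entry_le_enorm _ ord0 i) _.
  apply: le_trans (growth P OP).1 _; apply: (@le_trans _ _ (c * (1 + enorm P))).
    by apply: ler_wpM2r => //; rewrite addr_ge0.
  rewrite -mulrA; apply: ler_wpM2l => //.
  have := enorm_le_normr P; have := normr_ge0 P; have := ler0n R n.
  rewrite (_ : (1 + n%:R) * (1 + `|P|) = 1 + `|P| + n%:R + n%:R * `|P|); last by ring.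
  lra.
have lg i j : loc_integrable (g i j \o u).
  have [E gE] := cubic_growth cO (pg i j) (pDg i j) Oo (max0 _) (D2g_le i j).
  apply: (loc_integrable_growth lu (C := E)); last by move=> x; exact: gE.
  exact: measurable_comp_within (partials_on_continuous (pg i j)) Ou mu_u.
have lq j : loc_integrable (q j \o u).
  apply: (loc_integrable_growth lu (C := c * (1 + n%:R ^+ 3))).
    exact: measurable_comp_within (partials_on_continuous (pq j)) Ou mu_u.
  move=> x; apply: le_trans (entry_le_enorm _ ord0 j) _.
  apply: le_trans (growth _ (Ou x)).2 _.
  apply: (@le_trans _ _ (c * (1 + enorm (u x) ^+ 3))).
    by apply: ler_wpM2r => //; rewrite addr_ge0 // exprn_ge0.
  rewrite -mulrA; apply: ler_wpM2l => //.
  have n3 : 0 <= n%:R ^+ 3 :> R by rewrite exprn_ge0.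
  have u3 : 0 <= `|u x| ^+ 3 by rewrite exprn_ge0.
  have : enorm (u x) ^+ 3 <= n%:R ^+ 3 * `|u x| ^+ 3.
    by rewrite -exprMn lerXn2r ?nnegrE ?mulr_ge0 // enorm_le_normr.
  rewrite (_ : (1 + n%:R ^+ 3) * (1 + `|u x| ^+ 3) =
    1 + `|u x| ^+ 3 + n%:R ^+ 3 + n%:R ^+ 3 * `|u x| ^+ 3); last by ring.
  lra.
have [Mpsi Mpsi0 [psi_le dpsi_le]] := test_function_bounded C1psi.
have [rK KrK] := support_bounded C1psi.
have cpart : forall j, continuous (partial j psi) by case: C1psi.
have [E E0 estimate] := companion_estimate cO pg pDg pq pb cDb
  (fun V j l OV => compat V j l OV) mu_u lu Ou lg
  (test_function_continuous C1psi) cpart (test_function_derive C1psi)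
  (max0 _) (max0 _) N0 Mpsi0 D2g_le Db_le b_le psi_le dpsi_le
  (fun j => partials_on_continuous (pq j)) (fun i => partials_on_continuous (pb i))
  (fun i j => partials_on_continuous (pg i j)) lq mK KrK
  (test_function_off_support (psi := psi)) (partial_off_support (psi := psi)).
set I := \int[_]_y _ in estimate.
have I0 : I = 0.
  have r2 : 0 < r / 2 by rewrite divr_gt0.
  have T0 : 0 <= 2 ^+ k.+1 :> R by rewrite exprn_ge0.
  apply: (vanishing_by_scales (C := E) (T := 2 ^+ k.+1) (e0 := r / 2) (omega := omega)) => //.
  move=> e d /andP[e0 er] e1 d01.
  have er' : e < r by lra.
  have e01 : 0 < e <= 1 by rewrite e0.
  have [||iD D_le] := @integral_defect_le _ _ _ K u U mK mu_u lu e (omega e * e) e0.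
  - by move=> y x Ky xy; have [_ ->] := near_u y x Ky (lt_trans xy er').
  - apply: besovK => //; apply: (@lt_le_trans _ _ (2^-1 * r)%:E).
      by rewrite lte_fin mulrC.
    by rewrite EFinM lee_pmul2l ?lte_fin ?invr_gt0 //; exact: fatten_boundary.
  apply: le_trans (estimate e d e01 d01 _ iD) _.
    move=> y i Ky; apply: (weak_div_free e0 weakG) => [x xy|j]; last exact: lg.
    by apply: (near_u y) => //; exact: le_lt_trans xy er'.
  apply: ler_wpM2l => //; rewrite lerD2l; apply: ler_wpM2l => //.
  by rewrite addr_ge0 ?sqr_ge0 // invr_ge0 ltW.
have iQ : (lebesgue_rV R k.+1).-integrable setT
    (EFin \o (fun y => \sum_j partial j psi y * q j (u y))).
  apply: integrableR_sum => j _.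
  exact: (integrable_dphiQ cpart dpsi_le lq KrK (partial_off_support (psi := psi))).
rewrite integral_mkcond (_ : _ \_ X =
    EFin \o (fun y => \sum_j partial j psi y * q j (u y))); last first.
  apply/funext => x; rewrite /patch /=.
  have [Kx|nK] := pselect (K x).
    have [Xx ux] : X x /\ u x = U x by apply: (near_u x) => //; rewrite subrr normr0.
    by rewrite mem_set // /q ux; congr (_%:E); apply: eq_bigr => j _; rewrite mulrC.
  rewrite [in RHS]big1 => [|j _]; last by rewrite partial_off_support // mul0r.
  case: ifP => // _; rewrite big1 // => j _.
  by rewrite partial_off_support // mulr0.
by rewrite -[LHS]fineK ?integrable_fin_num // -/(Rintegral _ _ _) -/I I0.
Qed.
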